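(* Let $1\le p<q<\infty$, $\alpha>0$, $r_0>0$ and $\lambda\ge1$. Assume that $E$ is totally bounded and that there are constants $C,C',C'',\delta,s,\sigma>0$ with $\sigma>s-\alpha p$ such that for all $x\in E$ and $0<r'<r\le r_0$: $$0<\mu(B(x,2r))\le C\mu(B(x,r))<\infty,\qquad0<\nu(B(x,2r))\le C\nu(B(x,r))<\infty,$$ $$\frac{\nu(B(x,r'))}{\nu(B(x,r))}\le C\Bigl(\frac{r'}r\Bigr)^\delta,\qquad\qquad\mu(B(x,r))\ge C'r^s,\qquad\qquad\nu(B(x,r))\le C''r^\sigma.$$ Let $\mathcal{Y}\subset P^{\alpha,p}_{\lambda,E}(X,\mu)$ be equipped with one of the norms $$\|u\|_{L^1(E,\nu)}+\|G(u)\|_{L^p(X,\mu)}\quad\text{or}\quad\|u\|_{L^1(X,\mu)}+\|G(u)\|_{L^p(X,\mu)},$$ where $G(u)$ is such that for all balls $B=B(x,r)$ with $x\in E$ and $0<r\le r_0$, $$\frac1{\mu(B)}\int_B|u-u_{B,\mu}|\,d\mu\le r^\alpha\biggl(\frac1{\mu(\lambda B)}\int_{\lambda B}G(u)^p\,d\mu\biggr)^{1/p}.$$ Then the following hold: (i) The embedding $\mathcal{Y}\hookrightarrow L^q(E,\nu)$ is compact whenever $q(s-\alpha p)<\sigma p$. When $\nu=\mu$, the upper bound $\nu(B(x,r))\le C''r^\sigma$ is not needed and the embedding is compact whenever $q(s-\alpha p)<sp$. (ii) If functions in $\mathcal{Y}$ satisfy the truncation property, then the embedding $\mathcal{Y}\hookrightarrow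 L^q(E,\nu)$ is bounded whenever $q(s-\alpha p)\le\sigma p$. When $\nu=\mu$, the upper bound $\nu(B(x,r))\le C''r^\sigma$ is not needed and the embedding is bounded whenever $q(s-\alpha p)\le sp$.
   Context: $(X,d)$ is a metric space with positive complete Borel measures $\mu,\nu$, and $E\subset X$ is $\nu$-measurable with $\nu(E)>0$. $B(x,r)$ is the open ball; balls come with a predetermined centre and radius; $\lambda B(x,r)=B(x,\lambda r)$; $u_{B,\mu}=\mu(B)^{-1}\int_Bu\,d\mu$. $L^1_{\rm loc}(X,\mu)$: integrable on all balls. $P^{\alpha,p}_{\tau,E}(X,\mu)$ ($\tau\ge1$) consists of all $u\in L^1_{\rm loc}(X,\mu)$ for which there is $0\le g\in L^p(X,\mu)$ with $$\frac1{\mu(B)}\int_B|u-u_{B,\mu}|\,d\mu\le r^\alpha\Bigl(\frac1{\mu(\tau B)}\int_{\tau B}g^p\,d\mu\Bigr)^{1/p}$$ for all balls $B=B(x,r)$ with $x\in E$ and $0<r\le r_0$. Truncation property: for each $u\in\mathcal{Y}$ and all $l<k$, the inequality $$\frac1{\mu(B)}\int_B|u_{l,k}-(u_{l,k})_{B,\mu}|\,d\mu\le C[\operatorname{diam}(B)]^\alpha\Bigl(\frac1{\mu(\lambda B)}\int_{\lambda B}g_{l,k}^p\,d\mu\Bigr)^{1/p}$$ holds for all balls $B$ centred in $E$ of radius at most $r_0$, where $u_{l,k}=\max\{l,\min\{u,k\}\}$, $g_{l,k}=G(u)\chi_{\{l<u<k\}}$ and $C$ is independent of $u,l,k,B$.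 Embeddings into $L^q(E,\nu)$ (and the norm $\|u\|_{L^1(E,\nu)}$) are understood through the representative $\bar u(x)=\limsup_{r\to0}\mu(B(x,r))^{-1}\int_{B(x,r)}u\,d\mu$, $x\in E$. The embedding is compact if every sequence in $\mathcal{Y}$ bounded in the chosen norm has a subsequence whose images converge in the target, and bounded if $\|\bar u\|_{L^q(E,\nu)}\le C\|u\|_{\mathcal{Y}}$ for all $u\in\mathcal{Y}$. That the upper bound $\nu(B(x,r))\le C''r^\sigma$ is not needed means that when $\nu=\mu$ neither this bound nor the condition $\sigma>s-\alpha p$ on its exponent $\sigma$ is assumed. *)

(* Defs.v *)
From HB Require Import structures.
From mathcomp Require Import all_boot all_order all_algebra.
From mathcomp Require Import all_classical all_reals all_analysis measurable_realfun.
Set Implicit Arguments.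
Unset Strict Implicit.
Unset Printing Implicit Defensive.
Import Order.TTheory GRing.Theory Num.Theory.
Import numFieldNormedType.Exports.
Local Open Scope classical_set_scope.
Local Open Scope ring_scope.
Local Open Scope ereal_scope.

(* Measurable types are pointed in the library; since the sets E considered below
   are nonempty, asking for a base point of X is no restriction. *)
#[short(type="pointedMetricType")]
HB.structure Definition PointedMetric (R : realType) :=
  { X of Metric R X & isPointed X }.

(* The sigma-algebra is part of the data, since two complete Borel measures on X
   need not have the same measurable sets: it is the one generated by [cb_sets]
   (every sigma-algebra generates itself). *)
Record complete_borel_measure (R : realType) (X : pointedMetricType R) :=
  CompleteBorelMeasure {
    cb_sets : set (set X);
    cb_measure :> {measure set (g_sigma_algebraType cb_sets) -> \bar R};
    cb_borel : forall U : set X, open U ->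
      measurable (U : set (g_sigma_algebraType cb_sets));
    cb_complete : measure_is_complete cb_measure }.

Definition totally_bounded (R : realType) (X : pointedMetricType R) (E : set X) :=
  forall e : R, (0 < e)%R ->
    exists2 A : set X, finite_set A & E `<=` \bigcup_(a in A) ball a e.

(* A supremum in R: meant for nonempty bounded sets, such as balls. *)
Definition diam (R : realType) (X : pointedMetricType R) (A : set X) : R :=
  sup [set mdist y z | y in A & z in A].

Section FunctionSpaces.
Context {R : realType} {X : pointedMetricType R}.
Implicit Types (mu nu : complete_borel_measure X) (E B : set X).
Implicit Types (u g : X -> R) (Y : set (X -> R)) (G : (X -> R) -> (X -> R)).
Implicit Types (alpha p q tau lambda : R).

(* The inverse of +oo in \bar R is 0: an average over a ball of infinite measure
   (possible for a dilated ball of radius larger than 2 r0) is 0. *)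
Definition avg mu B (f : X -> \bar R) : \bar R :=
  (mu B)^-1 * \int[mu]_(x in B) f x.

Definition mean_osc mu B u : \bar R :=
  avg mu B (fun x => `|(u x)%:E - avg mu B (EFin \o u)|).

Definition avg_Lp mu p B g : \bar R :=
  avg mu B (fun x => (g x `^ p)%:E) `^ p^-1.

(* Norm and membership for L^q(E, nu), 1 <= q < oo, for extended real-valued
   functions: [ubar] below may be infinite on a null set. *)
Definition norm_Lp nu E q (f : X -> \bar R) : \bar R :=
  Lnorm nu q%:E (f \_ E).

Definition in_Lp nu E q (f : X -> \bar R) : Prop :=
  measurable_fun (E : set (g_sigma_algebraType (cb_sets nu)))
    (f : g_sigma_algebraType (cb_sets nu) -> \bar R) /\
  norm_Lp nu E q f < +oo.

Definition L1loc mu : set (X -> R) :=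
  [set u | forall (x : X) (r : R), (0 < r)%R ->
    mu.-integrable (ball x r) (EFin \o u)].

Definition poincare mu E alpha p tau (r0 : R) u g : Prop :=
  forall (x : X) (r : R), E x -> (0 < r <= r0)%R ->
    mean_osc mu (ball x r) u
      <= (r `^ alpha)%:E * avg_Lp mu p (ball x (tau * r)) g.

Definition poincare_gradient mu E alpha p tau (r0 : R) u g : Prop :=
  [/\ forall x, (0 <= g x)%R,
      in_Lp mu setT p (EFin \o g) &
      poincare mu E alpha p tau r0 u g].

Definition P_space mu E alpha p tau (r0 : R) : set (X -> R) :=
  [set u | L1loc mu u /\ exists g, poincare_gradient mu E alpha p tau r0 u g].

Definition ubar mu u (x : X) : \bar R :=
  limf_esup (fun r : R => avg mu (ball x r) (EFin \o u)) (0%R)^'+.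

Definition trunc (l k : R) u (x : X) : R := Num.max l (Num.min (u x) k).

Definition truncation_property mu E alpha p lambda (r0 : R) Y G : Prop :=
  exists2 C : R, (0 < C)%R &
    forall u, Y u -> forall l k : R, (l < k)%R ->
    forall (x : X) (r : R), E x -> (0 < r <= r0)%R ->
      mean_osc mu (ball x r) (trunc l k u)
        <= (C * diam (ball x r) `^ alpha)%:E *
           avg_Lp mu p (ball x (lambda * r))
             (fun y => (G u y * \1_[set z | (l < u z < k)%R] y)%R).

Inductive L1_term := L1_on_E | L1_on_X.

Definition Y_norm (t : L1_term) mu nu E p G u : \bar R :=
  (match t with
   | L1_on_E => norm_Lp nu E 1 (ubar mu u)
   | L1_on_X => norm_Lp mu setT 1 (EFin \o u)
   end) + norm_Lp mu setT p (EFin \o G u).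

(* In the next three definitions [N] stands for the norm on [Y]; the embedding
   is u |-> ubar mu u. *)
Definition embeds mu nu E q Y : Prop :=
  forall u, Y u -> in_Lp nu E q (ubar mu u).

Definition bounded_embedding mu nu E q Y (N : (X -> R) -> \bar R) : Prop :=
  embeds mu nu E q Y /\
  exists2 C : R, (0 < C)%R &
    forall u, Y u -> norm_Lp nu E q (ubar mu u) <= C%:E * N u.

Definition compact_embedding mu nu E q Y (N : (X -> R) -> \bar R) : Prop :=
  embeds mu nu E q Y /\
  forall u_ : nat -> X -> R,
    (forall n, Y (u_ n)) ->
    (exists M : R, forall n, N (u_ n) <= M%:E) ->
    exists phi : nat -> nat, exists v : X -> R,
      [/\ {homo phi : m n / (m < n)%N},
          in_Lp nu E q (EFin \o v) &
          (fun n => norm_Lp nu E q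
             (fun x => ubar mu (u_ (phi n)) x - (v x)%:E)) @ \oo --> 0].

Definition upper_mass_bound nu E (r0 C sigma : R) : Prop :=
  forall (x : X) (r : R), E x -> (0 < r <= r0)%R ->
    nu (ball x r) <= (C * r `^ sigma)%:E.

End FunctionSpaces.

(* Main.v *)
(** Cover [E] at each scale [2^-k] by a finite net of balls and join the nested balls
    around a point into a chain.  Since [nu]-a.e. the values of the representative are
    limits of mean values along the chain, they differ from the mean at scale [k] by at
    most a tail of the series of "slopes" [r_j^alpha (mean of g^p over B_j)^(1/p)].

    When [q(s - alpha p) < sigma p] (with [s] for [sigma] if [nu = mu]) the [L^q(nu)]
    norm of the slope at scale [j] decays geometrically in [j], by Tonelli over the cells
    of the net, hence so does the [L^q] distance to the discrete means.  These take finitely many bounded values, so that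
    limits along an ultrafilter of their coefficients produce an [L^q] limit, and
    compactness follows.

    When only [q(s - alpha p) <= sigma p] the same chains give a weak-type estimate: the
    decay of [nu] splits the slope series at the scale where a Hedberg-type bound
    switches, and the Vitali covering of the level sets bounds their [nu]-measure.
    Maz'ya's truncation method, applied to the dyadic strips [2^k A < |u| < 2^(k+1) A],
    upgrades it to the strong estimate. *)

Require Import Defs.
From mathcomp Require Import all_boot all_order all_algebra.
From mathcomp Require Import all_classical all_reals all_analysis measurable_realfun.
From mathcomp Require Import lra.
Import Order.TTheory GRing.Theory Num.Theory.
Import numFieldNormedType.Exports.
Local Open Scope classical_set_scope.
Local Open Scope ring_scope.
Local Open Scope ereal_scope.

Set Implicit Arguments.
Unset Strict Implicit.
Unset Printing Implicit Defensive.

(** * Powers and series *)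

(** Two complete measures on [X] have different sigma-algebras, so quantities computed with [mu]
    have to be made measurable in [x] for [nu]. This is what the net is for: [mu] contributes only
    finitely many numbers per scale, and functions of [x] are built from the [nu]-measurable indices
    [idx k].

    The exponent conditions are condensed into [balanced]: [r^alpha nu(B)^(1/q) <= K r^eps
    mu(B)^(1/p)]. A power upper bound on [nu] yields it. For [nu = mu] the factor [mu(B)^(1/q)]
    cancels and the lower bound on [mu] handles the spare power [1/p - 1/q].

    The inequality [p < q] enters three times: one power of the energy is split off and summed over
    cells, the Hedberg bound gets the positive exponent [1/p - 1/q], and [q/p]-th powers of the
    energies of disjoint strips are summed.

    With the norm on [E], a [mu]-mean over a ball has to be recovered from [ubar] on a [nu]-cell.
    The weak-type estimate does it: on half of the cell [ubar] is close to that mean. Hence the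
    insistence on cells of positive [nu]-measure, and hence the weak-type estimate serves part (i)
    as well; it also shows that the slope series converges [nu]-almost everywhere. *)

Section powers_and_series.
Context {R : realType}.
Implicit Types (a b q r : R).

Lemma powR_le a b r : (0 <= r)%R -> (0 <= a)%R -> (a <= b)%R -> (a `^ r <= b `^ r)%R.
Proof.
by move=> r0 a0 ab; apply: ge0_ler_powR => //; rewrite nnegrE// (le_trans a0).
Qed.

Lemma poweR_le (x y : \bar R) r :
  (0 <= r)%R -> 0 <= x -> x <= y -> x `^ r <= y `^ r.
Proof.
move=> r0 x0 xy; apply: gt0_ler_poweR => //; rewrite in_itv/= ?x0 ?leey//.
by rewrite (le_trans x0 xy).
Qed.

Lemma powRK a r : r != 0%R -> (0 <= a)%R -> ((a `^ r) `^ r^-1 = a)%R.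
Proof. by move=> r0 a0; rewrite -powRrM mulfV// powRr1. Qed.

Lemma powRVK a r : r != 0%R -> (0 <= a)%R -> ((a `^ r^-1) `^ r = a)%R.
Proof. by move=> r0 a0; rewrite -powRrM mulVf// powRr1. Qed.

Lemma powR_div a b r : (0 <= a)%R -> (0 <= b)%R -> ((a / b) `^ r = a `^ r / b `^ r)%R.
Proof.
move=> a0 b0; rewrite powRM ?invr_ge0//; congr (_ * _)%R.
by rewrite -powR_inv1// -powRrM mulN1r powRN.
Qed.

Lemma powR_exp a r n : (0 <= a)%R -> ((a ^+ n) `^ r = (a `^ r) ^+ n)%R.
Proof.
move=> a0; rewrite -(powR_mulrn n a0) -(powR_mulrn n (powR_ge0 a r)) -!powRrM.
by rewrite mulrC.
Qed.

Lemma powR_lt1 a r : (0 < a < 1)%R -> (0 < r)%R -> (0 < a `^ r < 1)%R.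
Proof.
move=> /andP[a0 a1] r0; rewrite powR_gt0//=.
have := @gt0_ltr_powR R r r0 a 1%R; rewrite powR1; apply => //.
  by rewrite nnegrE ltW.
by rewrite nnegrE.
Qed.

Lemma nneseries_le (u : nat -> \bar R) (x : \bar R) k :
  (forall j, 0 <= u j) ->
  (forall n, \sum_(k <= j < n) u j <= x) ->
  \sum_(k <= j <oo) u j <= x.
Proof.
move=> u0 ux; apply: lime_le; first by apply: is_cvg_nneseries => n _ _.
by apply: nearW.
Qed.

Lemma le_nneseries_term (u : nat -> \bar R) k j : (forall j, 0 <= u j) ->
  (k <= j)%N -> u j <= \sum_(k <= j <oo) u j.
Proof.
move=> u0 kj; apply: le_trans (@nneseries_lim_ge R u xpredT k j.+1 _) => //.
by rewrite big_nat_recr//= leeDr// sume_ge0.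
Qed.

Lemma geometric_sum_le (th : R) (k n : nat) : (0 < th < 1)%R ->
  (\sum_(k <= j < n) th ^+ j <= th ^+ k / (1 - th))%R.
Proof.
move=> /andP[th0 th1].
have h1 : (0 < 1 - th)%R by rewrite subr_gt0.
have [nk|kn] := leqP n k.
  by rewrite big_geq// divr_ge0 ?exprn_ge0 ?ltW.
rewrite ler_pdivlMr//.
have -> : ((\sum_(k <= j < n) th ^+ j) * (1 - th) = th ^+ k - th ^+ n)%R.
  elim: n kn => // n IH; rewrite ltnS leq_eqVlt => /predU1P[->|kn].
    by rewrite big_nat1 exprS; lra.
  by rewrite (@big_nat_recr _ _ _ n k (fun j => th ^+ j)%R (ltnW kn))/= mulrDl (IH kn) exprS; lra.
by rewrite lerBlDr lerDl exprn_ge0// ltW.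
Qed.

Lemma geometric_nneseries_le (th c : R) k : (0 < th < 1)%R -> (0 <= c)%R ->
  \sum_(k <= j <oo) (c * th ^+ j)%:E <= (c * (th ^+ k / (1 - th)))%:E.
Proof.
move=> th01 c0; apply: nneseries_le => [j|n].
  by rewrite lee_fin mulr_ge0// exprn_ge0//; case/andP: th01 => /ltW.
by rewrite sumEFin lee_fin -mulr_sumr ler_wpM2l// geometric_sum_le.
Qed.

(* Since every [h j] is at most [(th ^ j Z)^(1/q)], where [Z] is the weighted sum,
   no Minkowski inequality is needed. *)
Lemma powR_series_le (q th : R) : (0 < q)%R -> (0 < th < 1)%R ->
  exists2 W : R, (0 < W)%R & forall (h : nat -> R) k,
    (forall j, 0 <= h j)%R ->
    (\sum_(k <= j <oo) (h j)%:E) `^ q <=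
    W%:E * \sum_(k <= j <oo) (h j `^ q / th ^+ j)%:E.
Proof.
move=> q0 th01; have /andP[th0 th1] := th01.
have t01 := @powR_lt1 th q^-1 th01 (eqbRL (invr_gt0 q) q0).
set t := (th `^ q^-1)%R in t01; have /andP[t0 t1] := t01.
exists ((1 - t)^-1 `^ q)%R; first by rewrite powR_gt0// invr_gt0 subr_gt0.
move=> h k h0; set Z := (X in _ <= _ * X).
have Z0 : 0 <= Z.
  by apply: nneseries_ge0 => j _ _; rewrite lee_fin divr_ge0 ?powR_ge0 ?exprn_ge0 ?ltW.
have W0 : (0 < (1 - t)^-1 `^ q)%R by rewrite powR_gt0// invr_gt0 subr_gt0.
case EZ : Z => [z| |]; last 2 first.
- by rewrite gt0_muley ?leey// lte_fin.
- by move: Z0; rewrite EZ.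
have z0 : (0 <= z)%R by rewrite -lee_fin -EZ.
have hz j : (k <= j)%N -> (h j <= z `^ q^-1 * t ^+ j)%R.
  move=> kj.
  have : (h j `^ q / th ^+ j)%:E <= z%:E.
    rewrite -EZ; apply: (@le_nneseries_term (fun j => (h j `^ q / th ^+ j)%:E)) => // i.
    by rewrite lee_fin divr_ge0 ?powR_ge0 ?exprn_ge0 ?ltW.
  rewrite lee_fin ler_pdivrMr ?exprn_gt0// => hj.
  rewrite -(@powRK (h j) q) ?gt_eqF// /t -powR_exp ?(ltW th0)//.
  rewrite -powRM ?exprn_ge0 ?(ltW th0)//.
  by apply: powR_le => //; rewrite ?invr_ge0 ?powR_ge0 ?(ltW q0).
have -> : ((1 - t)^-1 `^ q)%:E * z%:E = ((1 - t)^-1 * z `^ q^-1)%:E `^ q.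
  rewrite poweR_EFin powRM ?powR_ge0 ?invr_ge0 ?subr_ge0 ?(ltW t1)//.
  by rewrite powRVK ?gt_eqF.
apply: poweR_le; rewrite ?(ltW q0)//.
  by apply: nneseries_ge0 => j _ _; rewrite lee_fin.
apply: nneseries_le => [j|n]; first by rewrite lee_fin.
rewrite sumEFin lee_fin.
apply: (@le_trans _ _ (\sum_(k <= j < n) z `^ q^-1 * t ^+ j)%R).
  by rewrite big_nat [leRHS]big_nat; apply: ler_sum => j /andP[kj _]; exact: hz.
rewrite -mulr_sumr mulrC ler_wpM2r ?powR_ge0//.
apply: (le_trans (geometric_sum_le k n t01)).
rewrite -[leRHS]mul1r ler_wpM2r ?invr_ge0 ?subr_ge0 ?(ltW t1)//.
by rewrite exprn_ile1// ltW.
Qed.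

(** Each term is [a k * a k ^ (s - 1)], and the last factor is at most [A ^ (s - 1)]. With
    [s = q / p] this sums the dyadic strips. *)
Lemma powR_sum_le (a : nat -> R) (s A : R) n : (1 <= s)%R ->
  (forall k, 0 <= a k)%R -> (\sum_(0 <= k < n) a k <= A)%R ->
  (\sum_(0 <= k < n) a k `^ s <= A `^ s)%R.
Proof.
move=> s1 a0 aA.
have A0 : (0 <= A)%R by rewrite (le_trans _ aA)// sumr_ge0.
have s0 : (0 < s)%R by rewrite (lt_le_trans _ s1).
have pe (x : R) : (0 <= x)%R -> (x `^ s = x * x `^ (s - 1))%R.
  by move=> x0; rewrite mulr_powRB1.
rewrite (pe A)//; apply: (@le_trans _ _ (\sum_(0 <= k < n) a k * A `^ (s - 1))%R).
  rewrite big_nat [leRHS]big_nat; apply: ler_sum => k /andP[_ kn].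
  rewrite pe// ler_wpM2l//; apply: powR_le => //; first by rewrite subr_ge0.
  apply: le_trans aA; rewrite (bigD1_seq k)//= ?mem_index_iota ?iota_uniq//.
  by rewrite lerDl sumr_ge0.
by rewrite -mulr_suml ler_wpM2r ?powR_ge0.
Qed.

End powers_and_series.

(** * Sums along a geometrically decaying sequence *)

Section decaying_chain.
Context {R : realType}.
Implicit Types (K th a b : R) (z phi : nat -> R).

(** The value [m = n] stands for the case where no index below [n] has [z < 1]. *)
Lemma first_below z n : exists m, [/\ (m <= n)%N,
  forall j, (j < m)%N -> (1 <= z j)%R & (m < n)%N -> (z m < 1)%R].
Proof.
elim: n => [|n [m [mn ge1 lt1]]]; first by exists 0%N.
have [mn'|nm] := ltnP m n.
  by exists m; split=> //; [exact: leqW|move=> _; exact: lt1].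
have mE : m = n by apply/eqP; rewrite eqn_leq mn nm.
subst m; have [zn|zn] := ltP (z n) 1%R; first by exists n.
exists n.+1; split=> //; last by rewrite ltnn.
by move=> j; rewrite ltnS leq_eqVlt => /predU1P[->//|/ge1].
Qed.

(* Before the first index with [z < 1] the bound [z ^ -b] is summed backwards,
   after it the bound [z ^ a] forwards. *)
Lemma chain_sum_le K th a b : (1 <= K)%R -> (0 < th < 1)%R -> (0 < a)%R -> (0 < b)%R ->
  exists2 S : R, (0 < S)%R & forall z phi n,
    (forall j, 0 < z j)%R ->
    (forall i j, (i <= j)%N -> z j <= K * th ^+ (j - i) * z i)%R ->
    (forall j, 0 <= phi j <= z j `^ a)%R ->
    (forall j, phi j <= z j `^ (- b))%R ->
    (\sum_(0 <= j < n) phi j <= S)%R.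
Proof.
move=> K1 th01 a0 b0; have /andP[th0 th1] := th01.
have K0 : (0 < K)%R by rewrite (lt_le_trans _ K1).
have /andP[ta0 ta1] := powR_lt1 th01 a0; have /andP[tb0 tb1] := powR_lt1 th01 b0.
have Sa : (0 < K `^ a / (1 - th `^ a))%R by rewrite divr_gt0 ?powR_gt0 ?subr_gt0.
have Sb : (0 < K `^ b / (1 - th `^ b))%R by rewrite divr_gt0 ?powR_gt0 ?subr_gt0.
exists (K `^ b / (1 - th `^ b) + K `^ a / (1 - th `^ a))%R; first exact: addr_gt0.
move=> z phi n z0 zK phia phib.
have [m [mn ge1 lt1]] := first_below z n.
rewrite (big_cat_nat (leq0n m) mn)/=; apply: lerD.
  have [->|m0] := posnP m; first by rewrite big_geq// ltW.
  rewrite big_nat_rev/= add0n.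
  apply: (@le_trans _ _ (\sum_(0 <= j < m) K `^ b * (th `^ b) ^+ j)%R).
    rewrite big_nat [leRHS]big_nat; apply: ler_sum => j /andP[_ jm].
    apply: (le_trans (phib _)).
    have zl : (1 <= z m.-1)%R by apply: ge1; rewrite prednK.
    have jm1 : (m - j.+1 <= m.-1)%N by rewrite -subn1 leq_sub2l.
    have := le_trans zl (zK _ _ jm1).
    have -> : (m.-1 - (m - j.+1) = j)%N.
      by rewrite -{1}(subnKC jm) addSn/= addnK.
    move=> h; rewrite -powR_exp ?(ltW th0)// -powRM ?exprn_ge0 ?(ltW th0) ?(ltW K0)//.
    rewrite powRN -[leLHS]mul1r ler_pdivrMr ?powR_gt0//.
    rewrite -powRM ?mulr_ge0 ?exprn_ge0 ?(ltW th0) ?(ltW K0) ?(ltW (z0 _))//.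
    by have := powR_le (ltW b0) ler01 h; rewrite powR1.
  rewrite -mulr_sumr ler_wpM2l ?powR_ge0//.
  apply: (le_trans (geometric_sum_le 0 m _)); first by rewrite tb0.
  by rewrite expr0 mul1r.
have [nm|mn'] := leqP n m; first by rewrite big_geq// ltW.
apply: (@le_trans _ _ (\sum_(m <= j < n) K `^ a * (th `^ a) ^+ (j - m))%R).
  rewrite big_nat [leRHS]big_nat; apply: ler_sum => j /andP[mj _].
  have /andP[_ /le_trans] := phia j; apply.
  rewrite -powR_exp ?(ltW th0)// -powRM ?exprn_ge0 ?(ltW th0) ?(ltW K0)//.
  apply: powR_le; rewrite ?(ltW a0) ?(ltW (z0 _))//.
  apply: (le_trans (zK _ _ mj)).
  by rewrite -[leRHS]mulr1 ler_wpM2l ?mulr_ge0 ?exprn_ge0 ?(ltW th0) ?(ltW K0)// ltW// lt1.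
rewrite -mulr_sumr ler_wpM2l ?powR_ge0//.
rewrite -{1}(add0n m) big_addn.
under eq_bigr do rewrite addnK.
apply: (le_trans (geometric_sum_le 0 (n - m) _)); first by rewrite ta0.
by rewrite expr0 mul1r.
Qed.

End decaying_chain.

(** * Step functions and tails of series *)

Section step_functions.
Context d (T : measurableType d) (R : realType) (m : {measure set T -> \bar R}).
Variables (E : set T) (mE : measurable E).

(** Every set of naturals is measurable, so [F] is arbitrary. Coefficients computed with [mu] thus
    give [nu]-measurable functions once they are indexed by the net. *)
Lemma measurable_step d' (T' : measurableType d') (c : T -> nat) (F : nat -> T') :
  measurable_fun E c -> measurable_fun E (fun x => F (c x)).
Proof.
by move=> mc; apply: (@measurableT_comp _ _ _ _ _ _ F) => // _ B mB; exact: I.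
Qed.

Lemma measurable_piece (c : T -> nat) i : measurable_fun E c ->
  measurable (E `&` [set x | c x = i]).
Proof. by move=> mc; exact: (mc mE [set i] I). Qed.

Lemma integral_step (c : T -> nat) n (F : nat -> \bar R) :
  measurable_fun E c -> (forall x, E x -> (c x < n)%N) -> (forall i, 0 <= F i) ->
  \int[m]_(x in E) F (c x) = \sum_(0 <= i < n) F i * m (E `&` [set x | c x = i]).
Proof.
move=> mc cn F0.
have EE : E = \big[setU/set0]_(i <- index_iota 0 n) (E `&` [set x | c x = i]).
  rewrite -bigcup_seq; apply/seteqP; split => x.
    by move=> Ex; exists (c x) => //=; rewrite mem_index_iota cn.
  by case=> i _ [].
rewrite [in LHS]EE ge0_integral_bigsetU//.
- apply: eq_bigr => i _; rewrite -integral_cst; last exact: measurable_piece.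
  by apply: eq_integral => x; rewrite inE/= => -[_ ->].
- by move=> i; exact: measurable_piece.
- exact: iota_uniq.
- by move=> i j _ _ [x [[_ <-] [_ <-]]].
- by rewrite -EE; exact: measurable_step.
Qed.

Lemma measurable_nneseries (h : nat -> T -> R) k :
  (forall j, measurable_fun E (h j)) -> (forall j x, 0 <= h j x)%R ->
  measurable_fun E (fun x => \sum_(k <= j <oo) (h j x)%:E).
Proof.
move=> mh h0.
rewrite (_ : (fun x => _) = (fun x => \sum_(0 <= j <oo | j \in xpredT) (h (j + k)%N x)%:E)).
  apply: ge0_emeasurable_sum => [j x _ _|j _]; first by rewrite lee_fin.
  exact/measurable_EFinP.
apply/funext => x; rewrite -(nneseries_addn (f := fun j => (h j x)%:E) k)//.
by move=> i; rewrite lee_fin.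
Qed.

(** The square in the hypothesis is a reserve: one factor [th ^+ j] pays for the weight in
    [powR_series_le], the other leaves a geometric series whose tail is of order [th ^+ k]. *)
Lemma integral_tail_le (q th : R) : (0 < q)%R -> (0 < th < 1)%R ->
  exists2 W : R, (0 < W)%R & forall (h : nat -> T -> R) (A : R),
    (forall j, measurable_fun E (h j)) -> (forall j x, 0 <= h j x)%R ->
    (0 <= A)%R ->
    (forall j, \int[m]_(x in E) (h j x `^ q)%:E <= (A * (th ^+ j) ^+ 2)%:E) ->
    forall k, \int[m]_(x in E) ((\sum_(k <= j <oo) (h j x)%:E) `^ q) <=
      (W * A * th ^+ k)%:E.
Proof.
move=> q0 th01; have /andP[th0 th1] := th01.
have [W0 W0gt0 HW] := powR_series_le q0 th01.
exists (W0 / (1 - th))%R; first by rewrite divr_gt0// subr_gt0.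
move=> h A mh h0 A0 hA k.
have g0 j x : (0 <= h j x `^ q / th ^+ j)%R.
  by rewrite divr_ge0 ?powR_ge0 ?exprn_ge0 ?ltW.
have mg j : measurable_fun E (fun x => h j x `^ q / th ^+ j)%R.
  apply: measurable_funM => //.
  by apply: (@measurableT_comp _ _ _ _ _ _ (@powR R ^~ q)).
have mS := measurable_nneseries k mg g0.
have S0 x : 0 <= \sum_(k <= j <oo) (h j x `^ q / th ^+ j)%:E.
  by apply: nneseries_ge0 => j _ _; rewrite lee_fin.
apply: (@le_trans _ _ (\int[m]_(x in E)
    (W0%:E * \sum_(k <= j <oo) (h j x `^ q / th ^+ j)%:E))).
  apply: ge0_le_integral => //.
  - by move=> x _; exact: poweR_ge0.
  - apply: (@measurableT_comp _ _ _ _ _ _ (@poweR R ^~ q)) => //.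
      exact: measurable_poweR.
    exact: measurable_nneseries.
  - exact: emeasurable_funM.
  - by move=> x _; exact: HW.
rewrite ge0_integralZl_EFin ?(ltW W0gt0)//.
have -> : (W0 / (1 - th) * A * th ^+ k)%:E = W0%:E * (A * (th ^+ k / (1 - th)))%:E.
  by rewrite -EFinM; congr EFin; rewrite -!mulrA; congr (_ * _)%R; lra.
rewrite lee_pmul2l ?lte_fin//.
apply: le_trans (geometric_nneseries_le k th01 A0).
under eq_integral => x _.
  rewrite -(nneseries_addn (f := fun j => (h j x `^ q / th ^+ j)%:E) k).
    over.
  by move=> i; rewrite lee_fin.
rewrite integral_nneseries//; last 2 first.
- by move=> n; exact/measurable_EFinP.
- by move=> n x _; rewrite lee_fin.
rewrite -(nneseries_addn (f := fun j => (A * th ^+ j)%:E) k); last first.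
  by move=> i; rewrite lee_fin mulr_ge0// exprn_ge0// ltW.
apply: lee_nneseries => [n _ _|n _].
  by apply: integral_ge0 => x _; rewrite lee_fin.
under eq_integral do rewrite mulrC EFinM.
have tk : (0 < th ^+ (n + k))%R by rewrite exprn_gt0.
rewrite ge0_integralZl_EFin//; last 3 first.
- by move=> x _; rewrite lee_fin powR_ge0.
- apply/measurable_EFinP.
  by apply: (@measurableT_comp _ _ _ _ _ _ (@powR R ^~ q)).
- by rewrite invr_ge0 ltW.
apply: (@le_trans _ _ ((th ^+ (n + k))^-1%:E * (A * (th ^+ (n + k)) ^+ 2)%:E)).
  by rewrite lee_pmul2l ?lte_fin ?invr_gt0.
by rewrite -EFinM lee_fin mulrCA expr2 mulKf ?gt_eqF.
Qed.

End step_functions.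

(** * Telescoping along a chain *)

Section telescoping.
Context {R : realType}.
Implicit Types (f h : nat -> R) (K : R).

Lemma telescope_le f h K : (0 <= K)%R -> (forall j, 0 <= h j)%R ->
  (forall j, `|f j.+1 - f j| <= K * h j)%R ->
  forall k j, (k <= j)%N -> (`|f j - f k|%:E <= K%:E * \sum_(k <= i <oo) (h i)%:E).
Proof.
move=> K0 h0 fh k j kj.
apply: (@le_trans _ _ (K * \sum_(k <= i < j) h i)%:E).
  rewrite lee_fin -telescope_sumr// (le_trans (ler_norm_sum _ _ _))// mulr_sumr.
  exact: ler_sum.
rewrite EFinM -sumEFin; apply: lee_wpmul2l; first by rewrite lee_fin.
by apply: nneseries_lim_ge => n _ _; rewrite lee_fin.
Qed.

Lemma telescope_cvg f h K : (0 <= K)%R -> (forall j, 0 <= h j)%R ->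
  (forall j, `|f j.+1 - f j| <= K * h j)%R ->
  \sum_(0 <= j <oo) (h j)%:E < +oo -> cvgn f.
Proof.
move=> K0 h0 fh hoo.
set u := fun j => (f j.+1 - f j)%R.
have -> : f = (fun n => f 0%N + series u n)%R.
  by apply/funext => n; rewrite /series/= telescope_sumr// addrC subrK.
apply: is_cvgD; first exact: is_cvg_cst.
apply: normed_cvg; apply: nondecreasing_is_cvgn.
  apply/nondecreasing_seqP => n; rewrite -subr_ge0 seriesSB.
  exact: normr_ge0.
have [s sE] : exists s : R, \sum_(0 <= j <oo) (h j)%:E = s%:E.
  exists (fine (\sum_(0 <= j <oo) (h j)%:E)); rewrite fineK// ge0_fin_numE//.
  by apply: nneseries_ge0 => j _ _; rewrite lee_fin.
exists (K * s)%R => _ [n _ <-].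
rewrite (_ : [normed series u] n = \sum_(0 <= j < n) `|u j|)%R//.
apply: (@le_trans _ _ (\sum_(0 <= j < n) K * h j)%R).
  by apply: ler_sum => j _; exact: fh.
rewrite -mulr_sumr ler_wpM2l// -lee_fin -sE -sumEFin.
by apply: nneseries_lim_ge => i _ _; rewrite lee_fin.
Qed.

Lemma telescope_lim_le f h K : (0 <= K)%R -> (forall j, 0 <= h j)%R ->
  (forall j, `|f j.+1 - f j| <= K * h j)%R ->
  \sum_(0 <= j <oo) (h j)%:E < +oo ->
  forall k, (`|limn f - f k|%:E <= K%:E * \sum_(k <= i <oo) (h i)%:E).
Proof.
move=> K0 h0 fh hoo k.
have cf := telescope_cvg K0 h0 fh hoo.
have cn : (fun n => `|f n - f k|%R) @ \oo --> `|limn f - f k|%R.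
  by apply: cvg_norm; apply: cvgB => //; exact: cvg_cst.
have S0 : 0 <= K%:E * \sum_(k <= i <oo) (h i)%:E.
  by rewrite mule_ge0 ?lee_fin// nneseries_ge0// => j _ _; rewrite lee_fin.
case ES : (K%:E * _) => [s| |]; last 2 first.
- by rewrite leey.
- by move: S0; rewrite ES.
rewrite lee_fin -(cvg_lim _ cn)//; apply: limr_le; first by apply/cvg_ex; eexists; exact: cn.
by exists k => // n/= kn; rewrite -lee_fin -ES; exact: telescope_le.
Qed.

End telescoping.

(** * Mean values and oscillation *)

Section mean_values.
Context d (T : measurableType d) (R : realType) (m : {measure set T -> \bar R}).
Implicit Types (B : set T) (u v : T -> R) (c : R).

(** Real-valued counterparts of [avg] and [mean_osc], with which they agree for integrable [u] on
    sets of positive finite measure ([avg_mean], [mean_osc_osc]). *)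
Definition mean B u : R := ((fine (m B))^-1 * \int[m]_(x in B) u x)%R.
Definition osc B u : R := mean B (fun x => `|u x - mean B u|)%R.

Lemma integrable_cst B c : measurable B -> m B < +oo -> m.-integrable B (EFin \o cst c).
Proof.
move=> mB Bfin; apply/integrableP; split.
  by apply/measurable_EFinP; exact: measurable_cst.
under eq_integral do rewrite /=.
by rewrite integral_cst// lte_mul_pinfty.
Qed.

Lemma integrable_subc B u c : measurable B -> m B < +oo ->
  m.-integrable B (EFin \o u) -> m.-integrable B (EFin \o (fun x => u x - c)%R).
Proof.
move=> mB Bfin iu; have := integrableB mB iu (integrable_cst c mB Bfin).
by apply: eq_integrable.
Qed.

Lemma integrable_shift B u c : measurable B -> m B < +oo ->
  m.-integrable B (EFin \o u) ->
  m.-integrable B (EFin \o (fun x => `|u x - c|)%R).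
Proof.
move=> mB Bfin iu.
have := integrable_abse (integrable_subc c mB Bfin iu).
by apply: eq_integrable.
Qed.

Variable B : set T.
Hypotheses (mB : measurable B) (B_gt0 : 0 < m B) (B_fin : m B < +oo).

Lemma fine_mass_gt0 : (0 < fine (m B))%R.
Proof. by rewrite fine_gt0// B_gt0 B_fin. Qed.

Lemma mean_cst c : mean B (cst c) = c.
Proof.
by rewrite /mean Rintegral_cst// mulrC mulfK// gt_eqF// fine_mass_gt0.
Qed.

Lemma le_mean u v : m.-integrable B (EFin \o u) -> m.-integrable B (EFin \o v) ->
  (forall x, B x -> u x <= v x)%R -> (mean B u <= mean B v)%R.
Proof.
move=> iu iv uv; rewrite ler_wpM2l ?invr_ge0 ?(ltW fine_mass_gt0)//.
exact: le_Rintegral.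
Qed.

Lemma meanB u c : m.-integrable B (EFin \o u) ->
  (mean B (fun x => u x - c) = mean B u - c)%R.
Proof.
move=> iu; rewrite -[in RHS](mean_cst c) /mean RintegralB ?mulrBr//.
exact: integrable_cst.
Qed.

Lemma le_norm_meanB u c : m.-integrable B (EFin \o u) ->
  (`|mean B u - c| <= mean B (fun x => `|u x - c|))%R.
Proof.
move=> iu; rewrite -meanB// normrM ger0_norm ?invr_ge0 ?(ltW fine_mass_gt0)//.
rewrite ler_wpM2l ?invr_ge0 ?(ltW fine_mass_gt0)//.
apply: le_normr_Rintegral => //.
exact: integrable_subc.
Qed.

Lemma mean_shift_le u c : m.-integrable B (EFin \o u) ->
  (mean B (fun x => `|u x - c|) <= osc B u + `|mean B u - c|)%R.
Proof.
move=> iu; rewrite -[X in (_ + X)%R](mean_cst `|mean B u - c|%R) -mulrDr -RintegralD//.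
- apply: le_mean.
  + exact: integrable_shift.
  + have := integrableD mB (integrable_shift (mean B u) mB B_fin iu)
      (integrable_cst `|mean B u - c|%R mB B_fin).
    by apply: eq_integrable.
  + move=> x _ /=; rewrite (le_trans _ (ler_normD _ _))//.
    by rewrite addrA subrK.
- exact: integrable_shift.
- exact: integrable_cst.
Qed.

Lemma norm_mean_le u : m.-integrable B (EFin \o u) ->
  (mean B (fun x => `|u x|) <= osc B u + `|mean B u|)%R.
Proof.
move=> iu; have := mean_shift_le 0%R iu.
by rewrite subr0; under [X in mean B X]eq_fun do rewrite subr0.
Qed.

(* On comparable nested balls the oscillation over the larger controls the jump
   of the mean value. *)
Lemma mean_sub_le B' u K : measurable B' -> 0 < m B' -> B' `<=` B ->
  m B <= K%:E * m B' -> m.-integrable B (EFin \o u) ->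
  (`|mean B' u - mean B u| <= K * osc B u)%R.
Proof.
move=> mB' B'0 B'B BK iu.
have B'fin : m B' < +oo by rewrite (le_lt_trans _ B_fin)// le_measure// inE.
have f'0 : (0 < fine (m B'))%R by rewrite fine_gt0// B'0.
have iu' : m.-integrable B' (EFin \o u) by exact: integrableS iu.
have fK : (fine (m B) <= K * fine (m B'))%R.
  by rewrite -lee_fin EFinM !fineK// ge0_fin_numE// ltW.
have h : (`|mean B' u - mean B u| <=
    (fine (m B'))^-1 * \int[m]_(x in B') `|u x - mean B u|)%R.
  rewrite -[X in (`|_ - X|)%R](_ : (fine (m B'))^-1 * \int[m]_(x in B') (mean B u) = _)%R; last first.
    by rewrite Rintegral_cst// mulrC mulfK// gt_eqF.
  rewrite /mean -mulrBr -RintegralB//; last exact: integrable_cst.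
  rewrite normrM ger0_norm ?invr_ge0 ?(ltW f'0)// ler_wpM2l ?invr_ge0 ?(ltW f'0)//.
  apply: le_normr_Rintegral => //.
  exact: integrable_subc.
apply: (le_trans h); rewrite /osc [X in (_ <= _ * X)%R]/mean mulrA.
have ish := integrable_shift (mean B u) mB B_fin iu.
apply: ler_pM.
- by rewrite invr_ge0 ltW.
- exact: Rintegral_ge0.
- rewrite ler_pdivlMr ?fine_mass_gt0// mulrC ler_pdivrMr//.
- apply: fine_le; last apply: ge0_subset_integral => //.
  + by apply: integrable_fin_num => //; exact: integrableS ish.
  + exact: integrable_fin_num.
  + by case/integrableP: ish.
Qed.

End mean_values.

(** * Metric balls and averages over them *)

Section metric_balls.
Context {R : realType} {X : pointedMetricType R}.
Implicit Types (x y : X) (r s : R).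

Lemma ball_mdist x r y : ball x r y <-> (mdist x y < r)%R.
Proof. by rewrite ballEmdist. Qed.

Lemma sub_ball x y r s : (mdist x y + r <= s)%R -> ball y r `<=` ball x s.
Proof.
move=> h z /ball_mdist yz; apply/ball_mdist.
by rewrite (le_lt_trans (metric_triangle _ y _))// (lt_le_trans _ h)// ltrD2l.
Qed.

Lemma open_mball x r : open (ball x r).
Proof.
rewrite openE => y /ball_mdist xy; rewrite /interior -nbhs_ballE.
exists (r - mdist x y)%R; first by rewrite /= subr_gt0.
by apply: sub_ball; rewrite addrCA subrr addr0.
Qed.

Lemma diam_ball_ge0 x r : (0 < r)%R -> (0 <= diam (ball x r))%R.
Proof.
move=> r0; rewrite /diam; apply: sup_ubound.
  exists (2 * r)%R => _ [y /ball_mdist xy [z /ball_mdist xz <-]].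
  rewrite (le_trans (metric_triangle _ x _))// [mdist y x]metric_sym mulr2n mulrDl mul1r.
  by rewrite lerD// ltW.
have xx : ball x r x by apply/ball_mdist; rewrite mdistxx.
by exists x => //; exists x; rewrite ?mdistxx.
Qed.

Lemma diam_ball_le x r : (0 < r)%R -> (diam (ball x r) <= 2 * r)%R.
Proof.
move=> r0; rewrite /diam; apply: ge_sup.
  have xx : ball x r x by apply/ball_mdist; rewrite mdistxx.
  by exists 0%R, x => //; exists x; rewrite ?mdistxx.
move=> _ [y /ball_mdist xy [z /ball_mdist xz <-]].
rewrite (le_trans (metric_triangle _ x _))// [mdist y x]metric_sym mulr2n mulrDl mul1r.
by rewrite lerD// ltW.
Qed.

End metric_balls.

Section averages.
Context {R : realType} {X : pointedMetricType R} (mu : complete_borel_measure X).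
Local Notation T := (g_sigma_algebraType (cb_sets mu)).

Lemma measurable_mball x r : measurable (ball x r : set T).
Proof. exact: cb_borel (@open_mball _ _ x r). Qed.

Variable B : set X.
Hypotheses (mB : measurable (B : set T)) (B_gt0 : 0 < mu B) (B_fin : mu B < +oo).

Lemma inv_mass : (mu B)^-1 = ((fine (mu B))^-1)%:E.
Proof.
have : mu B = (fine (mu B))%:E by rewrite fineK// ge0_fin_numE// ltW.
move=> ->; rewrite inver /= gt_eqF//; exact: fine_mass_gt0.
Qed.

Lemma avg_mean (u : X -> R) : mu.-integrable (B : set T) (EFin \o u : T -> _) ->
  avg mu B (EFin \o u) = (mean mu B u)%:E.
Proof.
move=> iu; rewrite /avg inv_mass /mean EFinM; congr (_ * _).
by rewrite /Rintegral fineK//; exact: (integrable_fin_num mB iu).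
Qed.

Lemma mean_osc_osc (u : X -> R) : mu.-integrable (B : set T) (EFin \o u : T -> _) ->
  mean_osc mu B u = (osc mu B u)%:E.
Proof.
move=> iu; rewrite /mean_osc avg_mean//.
rewrite -(avg_mean (u := fun x => `|u x - mean mu B u|%R))//.
exact: (@integrable_shift _ T).
Qed.

Lemma avg_Lp_fine (p : R) (g : X -> R) :
  \int[mu]_(x in (B : set T)) (g x `^ p)%:E < +oo ->
  avg_Lp mu p B g =
  ((fine (\int[mu]_(x in (B : set T)) (g x `^ p)%:E) / fine (mu B)) `^ p^-1)%:E.
Proof.
move=> gp; rewrite /avg_Lp /avg inv_mass -poweR_EFin; congr (_ `^ _).
rewrite mulrC EFinM fineK// ge0_fin_numE//.
by apply: integral_ge0 => x _; rewrite lee_fin powR_ge0.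
Qed.

End averages.

(** * Nets *)

Section nets.
Context {R : realType} {X : pointedMetricType R} (nu : complete_borel_measure X).
Local Notation T := (g_sigma_algebraType (cb_sets nu)).
Implicit Types (E : set X) (r : nat -> R).

(* [idx k x] is the first [i] such that [x] lies in [ball (node k i) (r k)];
   [dom] is [E] deprived of the null pieces [idx k = i]. *)
Record net E r := Net {
  node : nat -> nat -> X;
  card_net : nat -> nat;
  idx : nat -> X -> nat;
  dom : set X;
  node_in : forall k i, E (node k i);
  dom_meas : measurable (dom : set T);
  dom_sub : dom `<=` E;
  dom_full : nu (E `\` dom) = 0;
  idx_lt : forall k x, dom x -> (idx k x < card_net k)%N;
  idx_ball : forall k x, dom x -> ball (node k (idx k x)) (r k) x;
  idx_meas : forall k, measurable_fun (dom : set T) (idx k : T -> nat);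
  idx_gt0 : forall k x, dom x -> 0 < nu (dom `&` [set y | idx k y = idx k x])
}.

(** Total boundedness supplies centres anywhere in [X], whereas doubling and the Poincare inequality
    hold at centres in [E]. A centre is moved to a point of [E] in its ball of radius [e / 2], which
    doubles the radius. *)
Lemma finite_net E (e : R) : totally_bounded E -> E !=set0 -> (0 < e)%R ->
  exists (na : nat * (nat -> X)), (forall i, E (na.2 i)) /\
    forall x, E x -> exists2 i, (i < na.1)%N & ball (na.2 i) e x.
Proof.
move=> Etb [x0 Ex0] e0.
have [A /finite_seqP[s ->] EA] := Etb (e / 2)%R (divr_gt0 e0 (ltr0Sn _ 1)).
have [b bP] : exists b : X -> X, forall c, E (b c) /\
    (forall x, E x -> ball c (e / 2)%R x -> ball c (e / 2)%R (b c)).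
  suff /choice[b bP] : forall c : X, exists y, E y /\
    (forall x, E x -> ball c (e / 2)%R x -> ball c (e / 2)%R y) by exists b.
  move=> c.
  have [[y [Ey cy]]|h] := pselect (exists y, E y /\ ball c (e / 2)%R y).
    by exists y.
  (* A ball that misses [E] covers no point of [E], so any point serves as its new centre. *)
  by exists x0; split=> // x Ex cx; case: h; exists x.
exists (size s, fun i => b (nth x0 s i)); split => [i|x Ex] /=; first exact: (bP _).1.
have [c /= cs cx] := EA x Ex.
exists (index c s); rewrite ?index_mem// nth_index//.
apply: (@ball_split _ _ c) => //; apply: ball_sym.
exact: (bP c).2 cx.
Qed.

(** The null pieces are dropped because the [L^1(E, nu)] norm gives no control over the coefficient
    of a null cell. They are countably many, so only a null set is lost. *)
Lemma net_exists E r : measurable (E : set T) -> totally_bounded E -> E !=set0 ->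
  (forall k, 0 < r k)%R -> inhabited (net E r).
Proof.
move=> mE Etb E0 r0.
have [na naP] := choice (fun k => finite_net Etb E0 (r0 k)).
pose node k i := (na k).2 i; pose n k := (na k).1.
pose hit k x i := `[< ball (node k i) (r k) x >].
pose idx k x : nat := if pselect (exists i, hit k x i) is left h then ex_minn h else 0%N.
have idxP k x : E x -> [/\ (idx k x < n k)%N, hit k x (idx k x) &
    forall i, hit k x i -> (idx k x <= i)%N].
  move=> Ex; have [i ik xi] := (naP k).2 x Ex.
  have hi : hit k x i by apply/asboolP.
  rewrite /idx; case: pselect => [h|[]]; last by exists i.
  case: ex_minnP => j hj jmin; split=> //.
  exact: leq_ltn_trans (jmin _ hi) ik.
(* Being the first index of a covering ball is a condition on differences of balls, which are
   Borel. *)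
have mpiece k i : measurable (E `&` [set x | idx k x = i] : set T).
  rewrite (_ : _ `&` _ = E `&` (ball (node k i) (r k) `\`
      \bigcup_(j in [set j | (j < i)%N]) ball (node k j) (r k))).
    apply: measurableI => //; apply: measurableD; first exact: measurable_mball.
    by apply: bigcup_measurable => j _; exact: measurable_mball.
  apply/seteqP; split => x [Ex]/=; have [_ h hmin] := idxP k x Ex.
    move=> <-; split=> //; split; first exact/asboolP.
    by move=> [j /= ji /asboolP/hmin]; rewrite leqNgt ji.
  move=> [/asboolP/hmin ile nj]; split=> //; apply/eqP; rewrite eqn_leq ile/= leqNgt.
  by apply/negP => ilt; apply: nj; exists (idx k x) => //; exact/asboolP.
pose null k i := nu (E `&` [set x | idx k x = i]) = 0.
pose bad k := \bigcup_(i in [set i | null k i]) (E `&` [set x | idx k x = i]).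
have mbad k : measurable (bad k : set T) by apply: bigcup_measurable => i _.
have nbad k : nu (bad k) = 0.
  rewrite measure_bigcup//.
    by apply: eseries0 => i _; rewrite inE.
  by move=> i j _ _ [x [[_ <-] [_ <-]]].
pose D := E `\` \bigcup_k bad k.
have mD : measurable (D : set T).
  by apply: measurableD => //; exact: bigcupT_measurable.
have ED : nu (E `\` D) = 0.
  apply: (@subset_measure0 _ T _ nu _ (\bigcup_k (bad k : set T))).
  - exact: measurableD.
  - exact: bigcupT_measurable.
  - by move=> x [Ex /not_andP[//|/contrapT]].
  - apply/eqP; rewrite eq_le measure_ge0 andbT.
    apply: (le_trans (measure_sigma_subadditive nu mbad _ _)) => //.
      exact: bigcupT_measurable.
    by rewrite eseries0// => k _ _; exact: nbad.
split; apply: (@Net E r node n idx D) => //.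
- by move=> k i; exact: (naP k).1.
- by move=> x [].
- by move=> k x [Ex _]; case: (idxP k x Ex).
- by move=> k x [Ex _]; case: (idxP k x Ex) => _ /asboolP.
- move=> k _ Y _; rewrite (_ : _ `&` _ =
      D `&` \bigcup_(i in Y) (E `&` [set x | idx k x = i])).
    by apply: measurableI => //; apply: bigcup_measurable => i _.
  apply/seteqP; split => x [Dx] /=.
    by move=> Yx; split=> //; exists (idx k x) => //; split=> //; case: Dx.
  by move=> [i Yi [_ /= ki]]; split=> //; rewrite ki.
(* The piece of [x] has positive mass in [E], and [E] minus [D] is null, so it keeps positive mass
   in [D]. *)
- move=> k x Dx; have [Ex nbx] := Dx.
  have : nu (E `&` [set y | idx k y = idx k x]) != 0.
    apply/eqP => h; apply: nbx; exists k => //; exists (idx k x) => //.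
  apply: contra_neqT; rewrite -leNgt => h.
  have mp : measurable (D `&` [set y | idx k y = idx k x] : set T).
    rewrite (_ : D `&` _ = D `&` (E `&` [set y | idx k y = idx k x])).
      exact: measurableI.
    by apply/seteqP; split => y [Dy]/=; [move=> <-; split=> //; case: Dy|case].
  apply/eqP; rewrite eq_le measure_ge0 andbT.
  apply: (@le_trans _ _ (nu (E `\` D) + nu (D `&` [set y | idx k y = idx k x]))).
    rewrite -measureU//; last 2 first.
    + exact: measurableD.
    + by apply/seteqP; split=> // y [[_ nDy] [Dy _]].
    apply: le_measure; rewrite ?inE//.
      by apply: measurableU => //; exact: measurableD.
    move=> y [Ey yx]; have [Dy|nDy] := pselect (D y); first by right.
    by left.
  by rewrite ED add0e.
Qed.

End nets.

(** * Doubling pairs of measures *)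

Section setting.
Context {R : realType} {X : pointedMetricType R}.

Record doubling_pair (mu nu : complete_borel_measure X) (E : set X)
    (p q alpha lambda r0 C delta : R) : Prop := DoublingPair {
  dp_p : (1 <= p)%R; dp_pq : (p < q)%R; dp_alpha : (0 < alpha)%R;
  dp_lambda : (1 <= lambda)%R; dp_r0 : (0 < r0)%R; dp_C : (0 < C)%R;
  dp_delta : (0 < delta)%R;
  dp_mu : forall (x : X) (r : R), E x -> (0 < r <= r0)%R ->
      [/\ 0 < mu (ball x (2 * r)%R),
          mu (ball x (2 * r)%R) <= C%:E * mu (ball x r) &
          C%:E * mu (ball x r) < +oo];
  dp_nu : forall (x : X) (r : R), E x -> (0 < r <= r0)%R ->
      [/\ 0 < nu (ball x (2 * r)%R),
          nu (ball x (2 * r)%R) <= C%:E * nu (ball x r) &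
          C%:E * nu (ball x r) < +oo];
  dp_ratio : forall (x : X) (r' r : R), E x -> (0 < r')%R -> (r' < r <= r0)%R ->
      nu (ball x r') / nu (ball x r) <= (C * (r' / r) `^ delta)%:E }.

(** Positivity comes from the doubling hypothesis at radius [r / 2], finiteness from the one at
    radius [r]. *)
Lemma ball_mass_bounds (mu : complete_borel_measure X) (E : set X) (r0 C : R) :
  (0 < C)%R ->
  (forall (x : X) (r : R), E x -> (0 < r <= r0)%R ->
      [/\ 0 < mu (ball x (2 * r)%R),
          mu (ball x (2 * r)%R) <= C%:E * mu (ball x r) &
          C%:E * mu (ball x r) < +oo]) ->
  forall x r, E x -> (0 < r <= r0)%R -> 0 < mu (ball x r) /\ mu (ball x r) < +oo.
Proof.
move=> C0 dbl x r Ex /andP[r_gt0 rr0]; split.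
  have [] := dbl x (r / 2)%R Ex; last by rewrite mulrCA divff// mulr1.
  by apply/andP; split; lra.
have [_ _] := dbl x r Ex (introT andP (conj r_gt0 rr0)).
rewrite !ltey; apply: contra_neq => ->.
by rewrite gt0_muley// lte_fin.
Qed.

Variables (mu nu : complete_borel_measure X) (E : set X).
Variables (p q alpha lambda r0 C delta : R).
Hypothesis H : doubling_pair mu nu E p q alpha lambda r0 C delta.

(* The factor 64 makes the largest balls in use, of radius [16 lambda scale k], admissible
   with room for two doublings. *)
Definition scale (k : nat) : R := (r0 / (64 * lambda) * 2^-1 ^+ k)%R.

Lemma lambda_gt0 : (0 < lambda)%R.
Proof. by rewrite (lt_le_trans ltr01)// (dp_lambda H). Qed.

Lemma p_gt0 : (0 < p)%R.
Proof. by rewrite (lt_le_trans ltr01)// (dp_p H). Qed.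

Lemma q_gt0 : (0 < q)%R.
Proof. by rewrite (lt_trans p_gt0)// (dp_pq H). Qed.

Lemma scale_gt0 k : (0 < scale k)%R.
Proof.
rewrite mulr_gt0 ?exprn_gt0 ?invr_gt0 ?ltr0n// divr_gt0 ?(dp_r0 H)// mulr_gt0 ?ltr0n//.
exact: lambda_gt0.
Qed.

Lemma scaleS k : scale k = (2 * scale k.+1)%R.
Proof. by rewrite /scale exprS; lra. Qed.

Lemma scale_nincr i j : (i <= j)%N -> (scale j <= scale i)%R.
Proof.
move=> ij; rewrite ler_wpM2l//.
  by rewrite divr_ge0 ?(ltW (dp_r0 H))// mulr_ge0 ?ler0n// ltW// lambda_gt0.
by rewrite ler_wiXn2l// ?invr_ge0 ?ler0n// invf_le1 ?ltr0n// ler1n.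
Qed.

Lemma lscale_ge k : (scale k <= lambda * scale k)%R.
Proof. by rewrite ler_peMl ?(ltW (scale_gt0 k))// (dp_lambda H). Qed.

Lemma lscale_le k : (64 * (lambda * scale k) <= r0)%R.
Proof.
apply: (@le_trans _ _ (64 * (lambda * scale 0))%R).
  by rewrite ler_wpM2l// ler_wpM2l ?(ltW lambda_gt0)// scale_nincr.
rewrite /scale expr0 mulr1 mulrA mulrC divfK// gt_eqF// mulr_gt0 ?ltr0n//.
exact: lambda_gt0.
Qed.

Lemma scale_le_r0 k c : (c <= 64)%R -> (c * scale k <= r0)%R.
Proof.
move=> c64; apply: le_trans (lscale_le k); have := lscale_ge k; have := scale_gt0 k.
move=> s0 ls; apply: (@le_trans _ _ (64 * scale k)%R); first by rewrite ler_wpM2r// ltW.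
by rewrite ler_wpM2l.
Qed.

Lemma mu_bounds x r : E x -> (0 < r <= r0)%R -> 0 < mu (ball x r) /\ mu (ball x r) < +oo.
Proof. exact: (ball_mass_bounds (dp_C H) (dp_mu H)). Qed.

Lemma nu_bounds x r : E x -> (0 < r <= r0)%R -> 0 < nu (ball x r) /\ nu (ball x r) < +oo.
Proof. exact: (ball_mass_bounds (dp_C H) (dp_nu H)). Qed.

Lemma mu_doubling_iter n x r : E x -> (0 < r)%R -> (2 ^+ n * r <= r0)%R ->
  mu (ball x (2 ^+ n * r)%R) <= (C ^+ n)%:E * mu (ball x r).
Proof.
move=> Ex r_gt0; elim: n => [|n IH] h; first by rewrite expr0 mul1r expr0 mul1e.
have h' : (2 ^+ n * r <= r0)%R.
  apply: le_trans h; rewrite exprS -mulrA ler_peMl ?ler1n// mulr_ge0 ?exprn_ge0 ?ltW//.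
rewrite exprS -mulrA.
have [] := @dp_mu _ _ _ _ _ _ _ _ _ _ H x (2 ^+ n * r)%R Ex.
  by rewrite h' mulr_gt0// exprn_gt0.
move=> _ /le_trans + _; apply; rewrite exprS EFinM -muleA lee_wpmul2l ?lee_fin ?(ltW (dp_C H))//.
exact: IH.
Qed.

Variable S : net nu E scale.

(** The factor 4 makes the balls met by a point nested from scale to scale. [lbal] is the dilated
    ball carrying the gradient in the Poincare inequality. If two balls [lbal] meet, the finer one
    having index [k] and the coarser one [l], a cell of the finer lies within [lambda * (4 * scale k
    + 4 * scale l) + scale k <= 9 * lambda * scale l] of the coarser node; 16 is the next multiple
    that doublings reach from 4. *)
Definition bal k i : set X := ball (node S k i) (4 * scale k)%R.
Definition lbal k i : set X := ball (node S k i) (lambda * (4 * scale k))%R.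
Definition vbal k i : set X := ball (node S k i) (16 * (lambda * scale k))%R.
Definition cell k i : set X := dom S `&` [set x | idx S k x = i].

Lemma node_dist k x : dom S x -> (mdist (node S k (idx S k x)) x < scale k)%R.
Proof. by move=> Sx; apply/ball_mdist; exact: idx_ball. Qed.

Lemma node_dist_lt k l x : dom S x ->
  (mdist (node S k (idx S k x)) (node S l (idx S l x)) < scale k + scale l)%R.
Proof.
move=> Sx; rewrite (le_lt_trans (metric_triangle _ x _))//.
by rewrite ltrD ?node_dist// metric_sym node_dist.
Qed.

Lemma bal_nested k x : dom S x -> bal k.+1 (idx S k.+1 x) `<=` bal k (idx S k x).
Proof.
move=> Sx; apply: sub_ball; have := node_dist_lt k k.+1 Sx.
have := scaleS k; have := scale_gt0 k.+1; lra.
Qed.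

Lemma mu_bal k i : 0 < mu (bal k i) /\ mu (bal k i) < +oo.
Proof.
apply: mu_bounds; first exact: node_in.
by rewrite mulr_gt0 ?scale_gt0//= scale_le_r0// ler_nat.
Qed.

Lemma lbal_radius k : (0 < lambda * (4 * scale k) <= r0)%R.
Proof.
have := lscale_le k; have := scale_gt0 k; have l0 := lambda_gt0 => s0 ls.
have ls0 : (0 < lambda * scale k)%R by rewrite mulr_gt0.
by apply/andP; split; lra.
Qed.

Lemma vbal_radius k : (0 < 16 * (lambda * scale k) <= r0)%R.
Proof.
have := lscale_le k; have := scale_gt0 k; have l0 := lambda_gt0 => s0 ls.
have ls0 : (0 < lambda * scale k)%R by rewrite mulr_gt0.
by apply/andP; split; lra.
Qed.

Lemma mu_lbal k i : 0 < mu (lbal k i) /\ mu (lbal k i) < +oo.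
Proof. by apply: mu_bounds; [exact: node_in|exact: lbal_radius]. Qed.

Lemma mu_vbal k i : 0 < mu (vbal k i) /\ mu (vbal k i) < +oo.
Proof. by apply: mu_bounds; [exact: node_in|exact: vbal_radius]. Qed.

Lemma nu_vbal k i : 0 < nu (vbal k i) /\ nu (vbal k i) < +oo.
Proof. by apply: nu_bounds; [exact: node_in|exact: vbal_radius]. Qed.

Lemma mu_bal_step k x : dom S x ->
  mu (bal k (idx S k x)) <= (C ^+ 4)%:E * mu (bal k.+1 (idx S k.+1 x)).
Proof.
move=> Sx; apply: le_trans (@mu_doubling_iter 4 _ _ _ _ _); last 3 first.
- exact: node_in.
- by rewrite mulr_gt0// scale_gt0.
- by rewrite mulrA scale_le_r0//; lra.
apply: le_measure; rewrite ?inE; [exact: measurable_mball|exact: measurable_mball|].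
apply: sub_ball; have := node_dist_lt k.+1 k Sx.
have := scaleS k; have := scale_gt0 k.+1; lra.
Qed.

Lemma ball_sub_bal k x r : dom S x -> (r <= scale k)%R -> ball x r `<=` bal k (idx S k x).
Proof.
move=> Sx rk; apply: sub_ball; have := node_dist k Sx; have := scale_gt0 k; lra.
Qed.

(** Four doublings give [16 * r >= 8 * scale k], while the net ball lies within [5 * scale k] of
    [x]. The constant in [mu_bal_step] is the same, so that both kinds of jump obey one bound. *)
Lemma mu_bal_ball k x r : dom S x -> (scale k.+1 <= r <= scale k)%R ->
  mu (bal k (idx S k x)) <= (C ^+ 4)%:E * mu (ball x r).
Proof.
move=> Sx /andP[kr rk]; have s0 := scale_gt0 k.+1; have sk := scaleS k.
apply: le_trans (@mu_doubling_iter 4 _ _ _ _ _); last 3 first.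
- exact: dom_sub Sx.
- by rewrite (lt_le_trans s0).
- apply: (@le_trans _ _ (16 * scale k)%R); last by rewrite scale_le_r0//; lra.
  by lra.
apply: le_measure; rewrite ?inE; [exact: measurable_mball|exact: measurable_mball|].
apply: sub_ball; have := node_dist k Sx; rewrite metric_sym; lra.
Qed.

Lemma mu_vbal_lbal k i : mu (vbal k i) <= (C ^+ 2)%:E * mu (lbal k i).
Proof.
have -> : vbal k i = ball (node S k i) (2 ^+ 2 * (lambda * (4 * scale k)))%R.
  by rewrite /vbal; congr ball; lra.
apply: mu_doubling_iter; first exact: node_in.
  by case/andP: (lbal_radius k).
by have /andP[_] := vbal_radius k; lra.
Qed.

Lemma cell_sub_vbal k i j y : lbal k i y -> lbal k j y -> cell k j `<=` vbal k i.
Proof.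
move=> /ball_mdist iy /ball_mdist jy x [Sx /= xj]; apply/ball_mdist.
have := node_dist k Sx; rewrite xj => jx; have := lscale_ge k.
have := metric_triangle (node S k i) y x.
have := metric_triangle y (node S k j) x; rewrite [mdist y (node _ _ _)]metric_sym.
have := scale_gt0 k; lra.
Qed.

Lemma vbal_cover k i l j x : (l <= k)%N -> ball (node S k i) (scale k) x ->
  lbal k i `&` lbal l j !=set0 -> vbal l j x.
Proof.
move=> lk /ball_mdist ix [y [/ball_mdist iy /ball_mdist jy]]; apply/ball_mdist.
have := lscale_ge l.
have := metric_triangle (node S l j) y x.
have := metric_triangle y (node S k i) x; rewrite [mdist y (node _ _ _)]metric_sym.
have := scale_gt0 l; have kl := scale_nincr lk.
have : (lambda * (4 * scale k) <= lambda * (4 * scale l))%R.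
  by rewrite ler_wpM2l ?(ltW lambda_gt0)// ler_wpM2l.
lra.
Qed.

Definition vmass k i : R := fine (nu (vbal k i)).

Lemma vmass_gt0 k i : (0 < vmass k i)%R.
Proof. by apply: fine_gt0; apply/andP; exact: nu_vbal. Qed.

Lemma vmassE k i : nu (vbal k i) = (vmass k i)%:E.
Proof. by rewrite fineK// ge0_fin_numE//; case: (nu_vbal k i). Qed.

(** The hypothesis [dp_ratio] compares concentric balls of distinct radii, but the balls of a chain
    have different centres: [vbal i] is first shrunk to a ball of half its radius about the node of
    scale [j]. This costs a factor [2 ^ delta], which is the [th^-1] in the constant; the [+ 1]
    covers [j = i] and [j = i + 1]. *)
Lemma vmass_decay : exists2 K : R, (1 <= K)%R &
  forall x, dom S x -> forall i j, (i <= j)%N ->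
  (vmass j (idx S j x) <= K * (2^-1 `^ delta) ^+ (j - i) * vmass i (idx S i x))%R.
Proof.
have d0 := dp_delta H; have C0 := dp_C H; have l0 := lambda_gt0.
set th := (2^-1 `^ delta)%R.
have h01 : (0 < (2^-1 : R) < 1)%R by rewrite invr_gt0 ltr0n/= invf_lt1 ?ltr0n// ltr1n.
have /andP[th0 th1] : (0 < th < 1)%R by exact: powR_lt1.
have tV : (1 <= th^-1)%R by rewrite invf_ge1// ltW.
have K1 : (1 <= (C + 1) * th^-1)%R.
  by rewrite -[leLHS]mulr1 ler_pM// lerDr ltW.
exists ((C + 1) * th^-1)%R => // x Sx i j ij.
have [->|ij'] := eqVneq i j.
  by rewrite subnn expr0 mulr1 ler_peMl// ltW// vmass_gt0.
have {ij'}ij : (i < j)%N by rewrite ltn_neqAle ij' ij.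
have sij := scale_nincr ij; have sS := scaleS i; have sj := scale_gt0 j.
have lsij : (lambda * scale j <= lambda * scale i.+1)%R by rewrite ler_wpM2l// ltW.
have lsS : (lambda * scale i = 2 * (lambda * scale i.+1))%R by rewrite sS; lra.
(* Half the radius of [vbal i]: the remaining half absorbs the distance between the two nodes. *)
set a := node S j (idx S j x); set r := (8 * (lambda * scale i))%R.
have aE : E a by exact: node_in.
have lsi : (0 < lambda * scale i)%R by rewrite mulr_gt0// scale_gt0.
have lsj : (0 < lambda * scale j)%R by rewrite mulr_gt0// scale_gt0.
have r0_ : (0 < r <= r0)%R.
  by apply/andP; split; rewrite /r; have := lscale_le i; lra.
have [nr0 nroo] := nu_bounds aE r0_.
have bi : (fine (nu (ball a r)) <= vmass i (idx S i x))%R.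
  rewrite fine_le ?ge0_fin_numE//; first by case: (nu_vbal i (idx S i x)).
  apply: le_measure; rewrite ?inE; [exact: measurable_mball|exact: measurable_mball|].
  apply: sub_ball; have := node_dist_lt i j Sx; rewrite -/a.
  by have := lscale_ge i; rewrite /r; have := scale_gt0 i; lra.
(* For [j = i + 1] the two radii coincide and [dp_ratio] does not apply; inclusion of the balls is
   enough. *)
have [ij1|ij1] := eqVneq j i.+1.
  rewrite ij1 subSnn expr1 divfK ?gt_eqF//.
  apply: (@le_trans _ _ (vmass i (idx S i x))); last first.
    by rewrite ler_peMl ?lerDr ?(ltW C0)// ltW// vmass_gt0.
  apply: le_trans bi; rewrite /vmass -ij1 /vbal -/a.
  by rewrite (_ : 16 * (lambda * scale j) = r)%R// /r lsS -ij1; lra.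
have ij2 : (i.+2 <= j)%N by rewrite ltn_neqAle eq_sym ij1.
have sij2 := scale_nincr ij2; have sS2 := scaleS i.+1.
have lsij2 : (lambda * scale j <= lambda * scale i.+2)%R by rewrite ler_wpM2l// ltW.
have lsS2 : (lambda * scale i.+1 = 2 * (lambda * scale i.+2))%R by rewrite sS2; lra.
set r' := (16 * (lambda * scale j))%R.
have r'r : (r' < r <= r0)%R.
  by case/andP: r0_ => _ ->; rewrite andbT /r' /r; lra.
have r'0 : (0 < r')%R by rewrite /r'; lra.
have := dp_ratio H aE r'0 r'r.
have nE : nu (ball a r) = (fine (nu (ball a r)))%:E by rewrite fineK// ge0_fin_numE// ltW.
have f0 : (0 < fine (nu (ball a r)))%R by rewrite fine_gt0// nr0.
rewrite -[nu (ball a r')]/(nu (vbal j (idx S j x))) vmassE nE inver gt_eqF// -EFinM lee_fin.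
rewrite ler_pdivrMr// => /le_trans; apply.
have -> : (r' / r = 2 * 2^-1 ^+ (j - i))%R.
  rewrite /r' /r /scale -{1}(subnKC (ltnW ij)) exprD.
  have e0 : (2^-1 ^+ i != 0 :> R)%R by rewrite expf_neq0// invr_neq0// pnatr_eq0.
  have b0 : (r0 / (64 * lambda) != 0)%R.
    by rewrite gt_eqF// divr_gt0 ?(dp_r0 H)// mulr_gt0.
  have ln0 : (lambda != 0)%R by rewrite gt_eqF.
  set e := (2^-1 ^+ i)%R in e0 *; set b := (r0 / _)%R in b0 *; set u := (2^-1 ^+ (j - i))%R.
  rewrite (_ : 16 * _ = 2 * u * (8 * (lambda * (b * e))))%R; last by lra.
  by rewrite mulfK// mulf_neq0// mulf_neq0// mulf_neq0.
rewrite powRM ?exprn_ge0 ?invr_ge0 ?ler0n//.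
have -> : ((2 : R) `^ delta = th^-1)%R.
  apply: (mulIf (lt0r_neq0 th0)); rewrite mulVf ?gt_eqF// -powRM// ?invr_ge0//.
  by rewrite divff// powR1.
rewrite powR_exp ?invr_ge0 ?ler0n// -/th.
rewrite -!mulrA ler_pM ?(ltW C0)//.
- by rewrite !mulr_ge0// ?invr_ge0 ?exprn_ge0 ?ltW.
- by rewrite lerDl.
- by rewrite ler_wpM2l ?invr_ge0 ?(ltW th0)// ler_wpM2l ?exprn_ge0// ltW.
Qed.

End setting.

(** * Slopes *)

Section poincare_pairs.
Context {R : realType} {X : pointedMetricType R}.
Variables (mu nu : complete_borel_measure X) (E : set X).
Variables (p q alpha lambda r0 C delta : R).
Local Notation Tm := (g_sigma_algebraType (cb_sets mu)).
Local Notation Tn := (g_sigma_algebraType (cb_sets nu)).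

(** The common form of a function of the space, with [Cp = 1], and of its truncations, with
    [Cp = Ct * 2 ^ alpha]. *)
Record poincare_pair (Cp : R) (w g : X -> R) : Prop := PoincarePair {
  pp_Cp : (0 <= Cp)%R;
  pp_int : forall x r, E x -> (0 < r <= r0)%R ->
    mu.-integrable (ball x r : set Tm) (EFin \o w : Tm -> _);
  pp_g0 : forall x, (0 <= g x)%R;
  pp_gm : measurable_fun setT (g : Tm -> R);
  pp_gp : \int[mu]_x (g x `^ p)%:E < +oo;
  pp_ineq : forall x r, E x -> (0 < r <= r0)%R ->
    mean_osc mu (ball x r) w <=
      (Cp * r `^ alpha)%:E * avg_Lp mu p (ball x (lambda * r)) g }.

Hypothesis H : doubling_pair mu nu E p q alpha lambda r0 C delta.
Variable S : net nu E (scale lambda r0).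
Local Notation scale := (scale lambda r0).
Local Notation bal := (bal S).
Local Notation lbal := (lbal S).
Local Notation vbal := (vbal S).
Local Notation vmass := (vmass S).

Definition energy (g : X -> R) k i : R :=
  fine (\int[mu]_(x in (lbal k i : set Tm)) (g x `^ p)%:E).

Definition slope (g : X -> R) k i : R :=
  ((4 * scale k) `^ alpha * (energy g k i / fine (mu (lbal k i))) `^ p^-1)%R.

Lemma measurable_powRp (g : X -> R) : measurable_fun setT (g : Tm -> R) ->
  measurable_fun setT ((fun x => (g x `^ p)%:E) : Tm -> _).
Proof.
move=> mg; apply/measurable_EFinP.
by apply: (@measurableT_comp _ _ _ _ _ _ (@powR R ^~ p)).
Qed.

Lemma energyE (g : X -> R) k i : measurable_fun setT (g : Tm -> R) ->
  \int[mu]_x (g x `^ p)%:E < +oo ->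
  \int[mu]_(x in (lbal k i : set Tm)) (g x `^ p)%:E = (energy g k i)%:E.
Proof.
move=> mg gp; rewrite fineK// ge0_fin_numE; last first.
  by apply: integral_ge0 => x _; rewrite lee_fin powR_ge0.
apply: le_lt_trans gp; apply: ge0_subset_integral => //.
- exact: measurable_mball.
- exact: measurable_powRp.
- by move=> x _; rewrite lee_fin powR_ge0.
Qed.

Lemma energy_ge0 (g : X -> R) k i : (0 <= energy g k i)%R.
Proof. by apply: fine_ge0; apply: integral_ge0 => x _; rewrite lee_fin powR_ge0. Qed.

Lemma slope_ge0 (g : X -> R) k i : (0 <= slope g k i)%R.
Proof. by rewrite mulr_ge0 ?powR_ge0. Qed.

Lemma bal_radius k : (0 < 4 * scale k <= r0)%R.
Proof. by rewrite mulr_gt0 ?(scale_gt0 H)//= (scale_le_r0 H)//; lra. Qed.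

Lemma osc_slope Cp w g k i : poincare_pair Cp w g ->
  (osc mu (bal k i : set Tm) w <= Cp * slope g k i)%R.
Proof.
move=> P; have [b0 boo] := mu_bal H S k i.
have mb : measurable (bal k i : set Tm) by exact: measurable_mball.
rewrite -lee_fin -mean_osc_osc//; last first.
  by apply: (pp_int P); [exact: node_in|exact: bal_radius].
apply: (le_trans (pp_ineq P (node_in S k i) (bal_radius k))).
have [l0 loo] := mu_lbal H S k i.
have ml : measurable (lbal k i : set Tm) by exact: measurable_mball.
rewrite -[ball _ (lambda * _)]/(lbal k i) avg_Lp_fine//.
  by rewrite -EFinM /slope mulrA.
by rewrite (energyE _ _ (pp_gm P) (pp_gp P)) ltry.
Qed.

Lemma jump_bal Cp w g k x : poincare_pair Cp w g -> dom S x ->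
  (`|mean mu (bal k.+1 (idx S k.+1 x) : set Tm) w -
     mean mu (bal k (idx S k x) : set Tm) w| <= C ^+ 4 * Cp * slope g k (idx S k x))%R.
Proof.
move=> P Sx; have [b0 boo] := mu_bal H S k (idx S k x).
apply: (@le_trans _ _ (C ^+ 4 * osc mu (bal k (idx S k x) : set Tm) w)%R); last first.
  by rewrite -mulrA ler_wpM2l ?exprn_ge0 ?(ltW (dp_C H))// osc_slope.
apply: mean_sub_le => //.
- exact: measurable_mball.
- exact: measurable_mball.
- by case: (mu_bal H S k.+1 (idx S k.+1 x)).
- exact: (bal_nested H).
- exact: (mu_bal_step H).
- by apply: (pp_int P); [exact: node_in|exact: bal_radius].
Qed.

(** This bridges the net and [ubar], a limsup over all radii of means on balls centred at the point
    itself. *)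
Lemma jump_ball Cp w g k x r : poincare_pair Cp w g -> dom S x ->
  (scale k.+1 <= r <= scale k)%R ->
  (`|mean mu (ball x r : set Tm) w - mean mu (bal k (idx S k x) : set Tm) w| <=
     C ^+ 4 * Cp * slope g k (idx S k x))%R.
Proof.
move=> P Sx kr; have [b0 boo] := mu_bal H S k (idx S k x).
apply: (@le_trans _ _ (C ^+ 4 * osc mu (bal k (idx S k x) : set Tm) w)%R); last first.
  by rewrite -mulrA ler_wpM2l ?exprn_ge0 ?(ltW (dp_C H))// osc_slope.
apply: mean_sub_le => //.
- exact: measurable_mball.
- exact: measurable_mball.
- case/andP: kr => kr rk; have rr0 : (0 < r <= r0)%R.
    rewrite (lt_le_trans (scale_gt0 H _) kr)/= (le_trans rk)// -[leLHS]mul1r.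
    by rewrite (scale_le_r0 H)//; lra.
  by case: (mu_bounds H (dom_sub Sx) rr0).
- by apply: (ball_sub_bal H) => //; case/andP: kr.
- exact: (mu_bal_ball H).
- by apply: (pp_int P); [exact: node_in|exact: bal_radius].
Qed.

(* The exponent condition in scale-invariant form; the critical exponent is [eps = 0]. *)
Definition balanced (K eps : R) : Prop := (0 < K)%R /\ (0 <= eps)%R /\
  forall x r, E x -> (0 < r <= r0)%R ->
  (r `^ alpha * fine (nu (ball x r)) `^ q^-1 <=
     K * r `^ eps * fine (mu (ball x r)) `^ p^-1)%R.

(** [balanced] is applied to [vbal], whose radius [16 * lambda * scale k] equals [r0 / 4 * 2^-k].
    Two doublings lead back to the mass of [lbal] in the slope and produce the factor
    [(C ^ 2) ^ (1/p)]. *)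
Lemma slope_le K eps g k i : balanced K eps ->
  (slope g k i * vmass k i `^ q^-1 <=
   (C ^+ 2) `^ p^-1 * K * (r0 / 4 * 2^-1 ^+ k) `^ eps * energy g k i `^ p^-1)%R.
Proof.
move=> [K0 [e0 bK]]; have p0 := p_gt0 H; have l0 := lambda_gt0 H.
have pV : (0 <= p^-1)%R by rewrite invr_ge0 ltW.
have [m0 moo] := mu_lbal H S k i; have [M0 Moo] := mu_vbal H S k i.
have fm0 : (0 < fine (mu (lbal k i)))%R by rewrite fine_gt0// m0.
have fM0 : (0 < fine (mu (vbal k i)))%R by rewrite fine_gt0// M0.
have MC : (fine (mu (vbal k i)) <= C ^+ 2 * fine (mu (lbal k i)))%R.
  rewrite -lee_fin EFinM !fineK ?ge0_fin_numE//.
  exact: (mu_vbal_lbal H).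
have /andP[v0 vr] := vbal_radius H k.
have -> : (r0 / 4 * 2^-1 ^+ k = 16 * (lambda * scale k))%R.
  have cE : (r0 / (64 * lambda) * (64 * lambda) = r0)%R.
    by rewrite divfK// gt_eqF// mulr_gt0.
  rewrite /(scale _); set c := (r0 / (64 * lambda))%R in cE *.
  by rewrite -{1}cE; lra.
set rad := (16 * _)%R in v0 vr *.
have := bK _ _ (node_in S k i) (introT andP (conj v0 vr)).
rewrite -/(vbal k i) -/(vmass k i) => bK'.
have sr : ((4 * scale k) `^ alpha <= rad `^ alpha)%R.
  apply: powR_le; rewrite ?(ltW (dp_alpha H))//; first by case/andP: (bal_radius k) => /ltW.
  by rewrite /rad; have := lscale_ge H k; have := scale_gt0 H k; lra.
rewrite /slope powR_div ?energy_ge0 ?(ltW fm0)//.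
set I := (energy _ _ _ `^ _)%R.
have I0 : (0 <= I)%R by exact: powR_ge0.
set N := (vmass k i `^ _)%R in bK' *.
set mp := (fine (mu (lbal k i)) `^ p^-1)%R.
have mp0 : (0 < mp)%R by rewrite powR_gt0.
have Mp : (fine (mu (vbal k i)) `^ p^-1 <= (C ^+ 2) `^ p^-1 * mp)%R.
  rewrite -powRM ?exprn_ge0 ?(ltW (dp_C H)) ?(ltW fm0)//.
  by apply: powR_le; rewrite // ltW.
have -> : ((4 * scale k) `^ alpha * (I / mp) * N = I / mp * ((4 * scale k) `^ alpha * N))%R.
  by lra.
have -> : ((C ^+ 2) `^ p^-1 * K * rad `^ eps * I =
    I / mp * (K * rad `^ eps * ((C ^+ 2) `^ p^-1 * mp)))%R.
  have : (mp^-1 * mp = 1)%R by rewrite mulVf// gt_eqF.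
  set mi := (mp^-1)%R => mm.
  rewrite [RHS](_ : _ = I * K * rad `^ eps * (C ^+ 2) `^ p^-1 * (mi * mp))%R; last by lra.
  by rewrite mm; lra.
rewrite ler_wpM2l ?divr_ge0 ?(ltW mp0)//.
apply: (le_trans (ler_wpM2r (powR_ge0 _ _) sr)); apply: (le_trans bK').
by rewrite ler_wpM2l// mulr_ge0 ?powR_ge0// ltW.
Qed.

(* Tonelli for a finite sum: all the cells [j] with [y] in [lbal k j] lie in
   each single [vbal k i] with [y] in [lbal k i], so that the weights sum to at most 1. *)
Lemma cells_energy_le g k : measurable_fun setT (g : Tm -> R) ->
  \int[mu]_x (g x `^ p)%:E < +oo ->
  \sum_(0 <= i < card_net S k) (energy g k i / vmass k i)%:E * nu (cell S k i) <=
  \int[mu]_x (g x `^ p)%:E.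
Proof.
move=> mg gp; set n := card_net S k.
have mcell i : measurable (cell S k i : set Tn).
  by apply: measurable_piece; [exact: dom_meas|exact: idx_meas].
have fin_cell i : nu (cell S k i) < +oo.
  have [v0 voo] := nu_vbal H S k i; apply: le_lt_trans voo.
  apply: le_measure; rewrite ?inE//; first exact: measurable_mball.
  by apply: (@cell_sub_vbal _ _ _ _ _ _ _ _ _ _ _ _ H S k i i (node S k i));
    apply: ballxx; case/andP: (lbal_radius H k).
pose b i : R := (fine (nu (cell S k i)) / vmass k i)%R.
have b0 i : (0 <= b i)%R by rewrite divr_ge0 ?fine_ge0 ?(ltW (vmass_gt0 H S _ _)).
have wt (y : X) : (\sum_(0 <= i < n) b i * \1_(lbal k i) y <= 1)%R.
  pose Q i := if `[< lbal k i y >] then cell S k i else set0.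
  have mQ i : measurable (Q i : set Tn) by rewrite /Q; case: ifP.
  have tQ : trivIset setT Q.
    move=> i j _ _ [x []]; rewrite /Q; case: ifP => // _ [_ /= <-].
    by case: ifP => // _ [_ /= <-].
  pose U := fine (nu (\big[setU/set0]_(i < n) Q i)).
  have Qfin i : nu (Q i) \is a fin_num.
    by rewrite /Q; case: ifP => _; [rewrite ge0_fin_numE|rewrite measure0].
  have Ufin : nu (\big[setU/set0]_(i < n) Q i) \is a fin_num.
    rewrite (measure_bigsetU nu mQ tQ) sum_fin_num; apply/allP => z /mapP[i _ ->].
    exact: Qfin.
  have UE : (U = \sum_(0 <= i < n) fine (nu (cell S k i)) * \1_(lbal k i) y)%R.
    rewrite /U (measure_bigsetU nu mQ tQ) -sum_fine; last by move=> i _; exact: Qfin.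
    rewrite big_mkord; apply: eq_bigr => i _; rewrite /Q indicE.
    case: ifPn => [/asboolP iy|/asboolP iy]; first by rewrite mem_set// mulr1.
    by rewrite memNset// mulr0 measure0.
  have UN i : lbal k i y -> (U <= vmass k i)%R.
    move=> iy; apply: fine_le => //.
      by rewrite ge0_fin_numE//; case: (nu_vbal H S k i).
    apply: le_measure; rewrite ?inE//; first exact: bigsetU_measurable.
      exact: measurable_mball.
    rewrite -bigcup_mkord => x [j _]; rewrite /Q; case: ifP => // /asboolP jy.
    exact: (@cell_sub_vbal _ _ _ _ _ _ _ _ _ _ _ _ H S k i j y).
  have U0 : (0 <= U)%R by exact: fine_ge0.
  (* If the cells whose [lbal] contains [y] have total mass zero, all the weights at [y] vanish;
     otherwise one may divide by [U]. *)
  have [UZ|UZ] := eqVneq U 0%R.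
    rewrite big1_seq// => i /andP[_ iin].
    have : (fine (nu (cell S k i)) * \1_(lbal k i) y <= 0)%R.
      by rewrite -UZ UE (bigD1_seq i)//= ?iota_uniq// lerDl sumr_ge0.
    rewrite /b mulrAC => h; apply/eqP; rewrite mulf_eq0; apply/orP; left.
    by rewrite eq_le h mulr_ge0// fine_ge0.
  have Upos : (0 < U)%R by rewrite lt_neqAle eq_sym UZ.
  apply: (@le_trans _ _ (\sum_(0 <= i < n) fine (nu (cell S k i)) * \1_(lbal k i) y / U)%R).
    apply: ler_sum => i _; rewrite /b indicE.
    have [iy|iy] := pselect (lbal k i y); last by rewrite memNset// !mulr0 mul0r.
    rewrite mem_set// !mulr1 ler_wpM2l ?fine_ge0//.
    by rewrite lef_pV2 ?posrE ?(vmass_gt0 H)// UN.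
  by rewrite -mulr_suml -UE divff.
have term i : (energy g k i / vmass k i)%:E * nu (cell S k i) =
    \int[mu]_x (b i * \1_(lbal k i) x * (g x `^ p))%:E.
  have cE : nu (cell S k i) = (fine (nu (cell S k i)))%:E by rewrite fineK// ge0_fin_numE.
  have -> : (energy g k i / vmass k i)%:E * nu (cell S k i) = (b i)%:E * (energy g k i)%:E.
    by rewrite cE -!EFinM; congr EFin; rewrite /b; lra.
  rewrite -energyE// integral_mkcond -ge0_integralZl_EFin//.
  - apply: eq_integral => x _; rewrite patchE indicE.
    by case: (x \in lbal k i); rewrite -?EFinM ?mule0 ?mulr1 ?mulr0 ?mul0r.
  - by move=> x _; rewrite patchE; case: ifP => // _; rewrite lee_fin powR_ge0.
  - apply/(measurable_restrictT _ _).1; first exact: measurable_mball.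
    exact: measurable_funTS (measurable_powRp mg).
under eq_bigr do rewrite term.
rewrite -ge0_integral_sum//; last 2 first.
- move=> i; apply/measurable_EFinP; apply: measurable_funM;
    last by apply/measurable_EFinP; exact: measurable_powRp.
  apply: measurable_funM => //; apply: measurable_indic; exact: measurable_mball.
- by move=> i x _; rewrite lee_fin mulr_ge0 ?powR_ge0// mulr_ge0.
apply: ge0_le_integral => //.
- by move=> x _; apply: sume_ge0 => i _; rewrite lee_fin mulr_ge0 ?powR_ge0// mulr_ge0.
- apply: emeasurable_sum => i; apply/measurable_EFinP.
  apply: measurable_funM; last by apply/measurable_EFinP; exact: measurable_powRp.
  apply: measurable_funM => //; apply: measurable_indic; exact: measurable_mball.
- exact: measurable_powRp.
- move=> x _; rewrite sumEFin lee_fin -mulr_suml -[leRHS]mul1r.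
  by rewrite ler_wpM2r ?powR_ge0.
Qed.

End poincare_pairs.

(* Greedy selection, in the order of [rank]. *)
Lemma vitali_list (I : eqType) (X : Type) (B : I -> set X) (rank : I -> nat) (l : seq I) :
  (forall i, B i !=set0) ->
  exists s : seq I, [/\ uniq s, {subset s <= l}, trivIset [set` s] B &
    forall i, i \in l -> exists2 j, j \in s & (rank j <= rank i)%N /\ B i `&` B j !=set0].
Proof.
move=> B0.
suff Hs : forall l', pairwise (fun i j => (rank i <= rank j)%N) l' ->
  exists s : seq I, [/\ uniq s, {subset s <= l'}, trivIset [set` s] B &
    forall i, i \in l' -> exists2 j, j \in s & (rank j <= rank i)%N /\ B i `&` B j !=set0].
  have [|s [us sl ts sc]] := Hs (sort (fun i j => (rank i <= rank j)%N) l).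
    rewrite -sorted_pairwise; last by move=> i j k; exact: leq_trans.
    by apply: sort_sorted => i j; exact: leq_total.
  exists s; split=> // [i|i il]; first by move=> /sl; rewrite mem_sort.
  by apply: sc; rewrite mem_sort.
(* In the sorted list the last element has the largest rank, so whatever it meets among the earlier
   selected ones has rank at most its own. *)
elim/last_ind => [_|l' b IH]; first by exists [::]; split.
rewrite pairwise_rcons => /andP[/allP lb /IH[s [us sl ts sc]]].
have [[c cs bc]|nb] := pselect (exists2 c, c \in s & B b `&` B c !=set0).
  exists s; split=> // [i /sl il|i].
    by rewrite mem_rcons in_cons il orbT.
  rewrite mem_rcons in_cons => /predU1P[->|/sc//].
  by exists c => //; split=> //; exact: lb (sl _ cs).
have bns : b \notin s.
  apply/negP => bs; apply: nb; exists b => //; rewrite setIid; exact: B0.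
exists (b :: s); split=> [|i|i j|i].
- by rewrite /= bns.
- by rewrite in_cons mem_rcons in_cons => /predU1P[->|/sl ->]; rewrite ?eqxx ?orbT.
- rewrite /= !in_cons => /predU1P[->|si] /predU1P[->|sj] // [y [yi yj]].
  + by exfalso; apply: nb; exists j => //; exists y.
  + by exfalso; apply: nb; exists i => //; exists y.
  + by apply: ts => //; exists y.
- rewrite mem_rcons in_cons => /predU1P[->|/sc[j js jP]].
    by exists b; rewrite ?mem_head// setIid; split.
  by exists j => //; rewrite in_cons js orbT.
Qed.

(** * Integrals of slopes and level sets of the energy *)

Section slope_estimates.
Context {R : realType} {X : pointedMetricType R}.
Variables (mu nu : complete_borel_measure X) (E : set X).
Variables (p q alpha lambda r0 C delta : R).
Local Notation Tm := (g_sigma_algebraType (cb_sets mu)).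
Local Notation Tn := (g_sigma_algebraType (cb_sets nu)).
Hypothesis H : doubling_pair mu nu E p q alpha lambda r0 C delta.
Variable S : net nu E (scale lambda r0).
Local Notation scale := (scale lambda r0).
Local Notation lbal := (lbal S).
Local Notation vbal := (vbal S).
Local Notation vmass := (vmass S).
Local Notation slope := (slope mu p alpha S).
Local Notation energy := (energy mu p S).
Local Notation balanced := (balanced mu nu E p q alpha r0).
Variables (K eps : R) (bK : balanced K eps).

Definition admissible_gradient (g : X -> R) (G : R) : Prop :=
  [/\ forall x, (0 <= g x)%R, measurable_fun setT (g : Tm -> R), (0 <= G)%R &
    \int[mu]_x (g x `^ p)%:E <= G%:E].

Lemma admissible_fin g G : admissible_gradient g G -> \int[mu]_x (g x `^ p)%:E < +oo.
Proof. by case=> _ _ _ /le_lt_trans; apply; rewrite ltry. Qed.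

Lemma energy_le g G k i : admissible_gradient g G -> (energy g k i <= G)%R.
Proof.
move=> gG; have [_ mg _ gle] := gG; rewrite -lee_fin -energyE//; last exact: admissible_fin gG.
apply: le_trans gle; apply: ge0_subset_integral => //.
- exact: measurable_mball.
- exact: measurable_powRp.
- by move=> x _; rewrite lee_fin powR_ge0.
Qed.

(** As [p < q], the power [q / p] of the energy splits into one factor, which is additive enough to
    be summed over the cells, and the power [q / p - 1], which is bounded through [G]. *)
Lemma slope_powq_le g G k i : admissible_gradient g G ->
  (slope g k i `^ q <= ((C ^+ 2) `^ p^-1 * K) `^ q * (r0 / 4 * 2^-1 ^+ k) `^ (eps * q) *
     G `^ (q / p - 1) * (energy g k i / vmass k i))%R.
Proof.
move=> gG; have p0 := p_gt0 H; have q0 := q_gt0 H; have K0 := bK.1.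
have [_ _ G0 _] := gG.
have := slope_le H S g k i bK.
set A := ((C ^+ 2) `^ p^-1 * K)%R; set rad := (r0 / 4 * _)%R => h.
have A0 : (0 <= A)%R by rewrite mulr_ge0 ?powR_ge0// ltW.
have I0 := @energy_ge0 _ _ mu nu E p lambda r0 S g k i.
have v0 := vmass_gt0 H S k i.
have s0 := @slope_ge0 _ _ mu nu E p alpha lambda r0 S g k i.
have := powR_le (ltW q0) (mulr_ge0 s0 (powR_ge0 _ _)) h.
rewrite (powRM _ s0 (powR_ge0 _ _)) powRVK ?(gt_eqF q0)// ?(ltW v0)//.
rewrite (powRM _ (mulr_ge0 A0 (powR_ge0 _ _)) (powR_ge0 _ _)).
rewrite (powRM _ A0 (powR_ge0 _ _)).
rewrite -!powRrM mulrA => h'; rewrite ler_pdivlMr//; apply: (le_trans h').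
rewrite -!mulrA ler_wpM2l ?powR_ge0// ler_wpM2l ?powR_ge0//.
have qp : (1 <= q / p)%R by rewrite ler_pdivlMr// mul1r ltW// (dp_pq H).
have -> : (p^-1 * q = q / p)%R by rewrite mulrC.
rewrite -(mulr_powRB1 I0) ?(lt_le_trans ltr01)// mulrC ler_wpM2r//.
by apply: powR_le; rewrite ?subr_ge0//; exact: energy_le gG.
Qed.

(** Half of the available exponent: the slope integrals then decay like [th^(2 k)], the form that
    [integral_tail_le] asks for. *)
Let th := (2^-1 `^ (eps * q / 2))%R.

(** The integral is a finite sum over cells. There [cells_energy_le] turns the energies weighted by
    [nu(cell) / vmass] into a single factor [G], which completes [G ^ (q/p - 1)]. *)
Lemma slope_integral_le g G k : admissible_gradient g G ->
  \int[nu]_(x in (dom S : set Tn)) (slope g k (idx S k x) `^ q)%:E <=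
  (((C ^+ 2) `^ p^-1 * K) `^ q * (r0 / 4) `^ (eps * q) * G `^ (q / p) * (th ^+ k) ^+ 2)%:E.
Proof.
move=> gG; have q0 := q_gt0 H; have p0 := p_gt0 H.
have [_ mg G0 gle] := gG; have gfin := admissible_fin gG.
rewrite (@integral_step _ Tn _ nu (dom S) (dom_meas S) (idx S k) (card_net S k)
  (fun i => (slope g k i `^ q)%:E)); last 3 first.
- exact: idx_meas.
- by move=> x Sx; exact: idx_lt.
- by move=> i; rewrite lee_fin powR_ge0.
set c := (((C ^+ 2) `^ p^-1 * K) `^ q * (r0 / 4 * 2^-1 ^+ k) `^ (eps * q) *
     G `^ (q / p - 1))%R.
have c0 : (0 <= c)%R by rewrite !mulr_ge0 ?powR_ge0.
apply: (@le_trans _ _ (c%:E * (\sum_(0 <= i < card_net S k)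
    (energy g k i / vmass k i)%:E * nu (cell S k i)))).
  rewrite ge0_sume_distrr; last first.
    move=> i _; rewrite mule_ge0 ?lee_fin ?divr_ge0 ?energy_ge0//.
    by rewrite ltW// (vmass_gt0 H).
  apply: lee_sum => i _; rewrite muleA lee_wpmul2r// -EFinM lee_fin.
  exact: slope_powq_le.
apply: (@le_trans _ _ (c%:E * G%:E)).
  rewrite lee_wpmul2l ?lee_fin//; apply: le_trans gle; exact: (cells_energy_le H).
rewrite -EFinM lee_fin /c.
have r4 : (0 <= r0 / 4)%R by rewrite divr_ge0 ?(ltW (dp_r0 H)).
rewrite [X in (_ * X * _ * _ <= _)%R]powRM ?exprn_ge0//.
have -> : ((2^-1 ^+ k) `^ (eps * q) = (th ^+ k) ^+ 2)%R.
  rewrite powR_exp// /th -!exprM mulnC exprM; congr (_ ^+ _)%R.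
  by rewrite -powR_mulrn ?powR_ge0// -powRrM divfK.
have qp : (0 < q / p)%R by rewrite divr_gt0.
rewrite -[in leRHS](mulr_powRB1 G0 qp).
set a := (_ `^ q)%R; set b := (_ `^ (eps * q))%R; set d := (G `^ _)%R.
by rewrite le_eqVlt; apply/orP; left; apply/eqP; lra.
Qed.

Lemma measurable_slope g k :
  measurable_fun (dom S : set Tn) ((fun x => slope g k (idx S k x)) : Tn -> R).
Proof.
apply: (@measurable_step _ Tn (dom S : set Tn) _ _ (idx S k) (slope g k)).
exact: idx_meas.
Qed.

(** A weak-type bound for the maximal function of [energy / vmass]. The rank in the Vitali selection
    is the scale index: a point of a discarded ball lies in [vbal] of a selected ball of the same or
    a coarser scale. Each selected [vbal] has mass at most [energy / tau], and the energies add up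
    to at most [G] since the selected [lbal] are disjoint. Restricting to [k < n] keeps the family
    finite. *)
Lemma level_measure_le g G tau n : admissible_gradient g G -> (0 < tau)%R ->
  nu (\bigcup_(k in [set k | (k < n)%N])
       [set x | dom S x /\ (tau * vmass k (idx S k x) < energy g k (idx S k x))%R]) <=
  (G / tau)%:E.
Proof.
move=> gG tau0; have [_ mg G0 gle] := gG; have gfin := admissible_fin gG.
set F := \bigcup_(k in _) _.
pose bad (c : nat * nat) := (tau * vmass c.1 c.2 < energy g c.1 c.2)%R.
pose l := [seq c <- [seq (k, i) | k <- iota 0 n, i <- iota 0 (card_net S k)] | bad c].
pose B (c : nat * nat) := lbal c.1 c.2.
have B0 c : B c !=set0.
  by exists (node S c.1 c.2); apply: ballxx; case/andP: (lbal_radius H c.1).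
have [s [us sl ts sc]] := vitali_list fst l B0.
have FV : F `<=` \bigcup_(c in [set` s]) vbal c.1 c.2.
  move=> x [k /= kn [Sx xbad]].
  have : (k, idx S k x) \in l.
    rewrite mem_filter /bad /= xbad/=; apply/allpairsPdep.
    by exists k, (idx S k x); rewrite !mem_iota !add0n kn (idx_lt _ Sx).
  move=> /sc[[k' i'] cs [/= k'k meet]]; exists (k', i') => //=.
  exact: (vbal_cover H k'k (idx_ball k Sx) meet).
have mF : measurable (F : set Tn).
  apply: bigcup_measurable => k _.
  have mi : measurable_fun (dom S : set Tn) (idx S k : Tn -> nat) by exact: idx_meas.
  exact: (mi (dom_meas S) [set i | (tau * vmass k i < energy g k i)%R] I).
have mV : measurable (\bigcup_(c in [set` s]) vbal c.1 c.2 : set Tn).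
  apply: fin_bigcup_measurable => // c _; exact: measurable_mball.
apply: (@le_trans _ _ (nu (\bigcup_(c in [set` s]) vbal c.1 c.2))).
  by apply: le_measure; rewrite ?inE.
apply: (@le_trans _ _ (\sum_(c <- s) nu (vbal c.1 c.2))).
  clear -us; elim: s us => [|c s IH] us.
    by rewrite big_nil (_ : \bigcup_(c in _) _ = set0) ?measure0//; apply/seteqP; split=> // x [c].
  have -> : \bigcup_(c0 in [set` c :: s]) vbal c0.1 c0.2 =
      vbal c.1 c.2 `|` \bigcup_(c0 in [set` s]) vbal c0.1 c0.2.
    apply/seteqP; split => x.
      move=> [c' /=]; rewrite in_cons => /predU1P[->|c's] xc'; first by left.
      by right; exists c'.
    case=> [xc|[c' /= c's xc']]; first by exists c => //=; rewrite mem_head.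
    by exists c' => //=; rewrite in_cons c's orbT.
  rewrite big_cons; apply: le_trans (leeD2l _ (IH _)); last by case/andP: us.
  apply: measureU2; first exact: measurable_mball.
  by apply: fin_bigcup_measurable => // c' _; exact: measurable_mball.
apply: (@le_trans _ _ (\sum_(c <- s) (tau^-1)%:E * \int[mu]_(x in (B c : set Tm)) (g x `^ p)%:E)).
  rewrite big_seq [leRHS]big_seq; apply: lee_sum => c cs.
  have : bad c by move: (sl _ cs); rewrite mem_filter => /andP[].
  rewrite /bad => cbad; rewrite (vmassE H) /B energyE// -EFinM lee_fin.
  by rewrite mulrC ler_pdivlMr// mulrC ltW.
rewrite -ge0_sume_distrr; last first.
  by move=> c _; apply: integral_ge0 => x _; rewrite lee_fin powR_ge0.
rewrite mulrC EFinM lee_pmul2l ?lte_fin ?invr_gt0//; apply: le_trans gle.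
rewrite -(@ge0_integral_bigsetU _ Tm _ mu _ B)//.
- apply: ge0_subset_integral => //.
  + by apply: bigsetU_measurable => c _; exact: measurable_mball.
  + exact: measurable_powRp.
  + by move=> x _; rewrite lee_fin powR_ge0.
- by move=> c; exact: measurable_mball.
- by apply: measurable_funTS; exact: measurable_powRp.
- by move=> x _; rewrite lee_fin powR_ge0.
Qed.

End slope_estimates.

(** * The weak-type estimate *)

Section weak_estimate.
Context {R : realType} {X : pointedMetricType R}.
Variables (mu nu : complete_borel_measure X) (E : set X).
Variables (p q alpha lambda r0 C delta : R).
Local Notation Tm := (g_sigma_algebraType (cb_sets mu)).
Local Notation Tn := (g_sigma_algebraType (cb_sets nu)).
Hypothesis H : doubling_pair mu nu E p q alpha lambda r0 C delta.
Variable S : net nu E (scale lambda r0).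
Local Notation vmass := (vmass S).
Local Notation slope := (slope mu p alpha S).
Local Notation energy := (energy mu p S).
Variables (K eps : R) (bK : balanced mu nu E p q alpha r0 K eps).

Lemma all_levels_measure_le g G tau : admissible_gradient mu p g G -> (0 < tau)%R ->
  measurable ([set x | dom S x /\ exists k,
     (tau * vmass k (idx S k x) < energy g k (idx S k x))%R] : set Tn) /\
  nu [set x | dom S x /\ exists k,
     (tau * vmass k (idx S k x) < energy g k (idx S k x))%R] <= (G / tau)%:E.
Proof.
move=> gG tau0.
pose A k := [set x | dom S x /\ (tau * vmass k (idx S k x) < energy g k (idx S k x))%R].
pose F n := \bigcup_(k in [set k | (k < n)%N]) A k.
have mA k : measurable (A k : set Tn).
  have mi : measurable_fun (dom S : set Tn) (idx S k : Tn -> nat) by exact: idx_meas.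
  exact: (mi (dom_meas S) [set i | (tau * vmass k i < energy g k i)%R] I).
have mF n : measurable (F n : set Tn) by apply: bigcup_measurable => k _.
have -> : [set x | dom S x /\ exists k,
    (tau * vmass k (idx S k x) < energy g k (idx S k x))%R] = \bigcup_n F n.
  apply/seteqP; split => x.
    by move=> [Sx [k xk]]; exists k.+1 => //; exists k => //=.
  by move=> [n _ [k _ [Sx xk]]]; split=> //; exists k.
have mFF : measurable (\bigcup_n F n : set Tn) by exact: bigcupT_measurable.
split=> //.
have ndF : {homo F : n m / (n <= m)%N >-> (n <= m)%O}.
  move=> n m nm; apply/subsetPset => x [k /= kn Akx]; exists k => //=.
  exact: leq_trans nm.
have cF := nondecreasing_cvg_mu (mu := nu) mF mFF ndF.
rewrite -(cvg_lim _ cF)//; apply: lime_le; first by apply/cvg_ex; eexists; exact: cF.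
by apply: nearW => n; exact: (level_measure_le H).
Qed.

(** Hedberg's argument. The bound [energy <= tau * vmass] controls the slope by a positive power of
    [vmass], the bound [energy <= G] by a negative one, and they agree at [vmass = G / tau].
    Measured in this unit [vmass] is the sequence [z] of [chain_sum_le], and [vmass_decay] is its
    decay. *)
Lemma slope_chain_le : exists2 S0 : R, (0 < S0)%R & forall g G tau,
  admissible_gradient mu p g G -> (0 < G)%R -> (0 < tau)%R -> forall x, dom S x ->
  (forall k, energy g k (idx S k x) <= tau * vmass k (idx S k x))%R ->
  \sum_(0 <= j <oo) (slope g j (idx S j x))%:E <=
    (S0 * (G `^ p^-1 * (tau / G) `^ q^-1))%:E.
Proof.
have p0 := p_gt0 H; have q0 := q_gt0 H; have [K0 [e0 _]] := bK.
have [Kz Kz1 decay] := vmass_decay H S.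
have ab : (0 < p^-1 - q^-1)%R by rewrite subr_gt0 ltf_pV2 ?posrE// (dp_pq H).
have h01 : (0 < (2^-1 : R) < 1)%R by rewrite invr_gt0 ltr0n/= invf_lt1 ?ltr0n// ltr1n.
have th01 := powR_lt1 h01 (dp_delta H).
have qV0 : (0 < q^-1)%R by rewrite invr_gt0.
have pV0 : (0 < p^-1)%R by rewrite invr_gt0.
have [S1 S10 HS] := chain_sum_le Kz1 th01 ab qV0.
have r4 : (0 < r0 / 4)%R by rewrite divr_gt0 ?(dp_r0 H).
(* The factor [(2^-k) ^ eps] is bounded by 1, so the estimate does not degenerate at [eps = 0]. *)
set K2 := ((C ^+ 2) `^ p^-1 * K * (r0 / 4) `^ eps)%R.
have K20 : (0 < K2)%R.
  by rewrite mulr_gt0 ?powR_gt0// mulr_gt0// powR_gt0// exprn_gt0// (dp_C H).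
have slK g k i : (slope g k i * vmass k i `^ q^-1 <= K2 * energy g k i `^ p^-1)%R.
  apply: (le_trans (slope_le H S g k i bK)).
  rewrite ler_wpM2r ?powR_ge0// ler_wpM2l ?mulr_ge0 ?powR_ge0 ?(ltW K0)//.
  apply: powR_le => //; first by rewrite mulr_ge0 ?exprn_ge0 ?invr_ge0 ?(ltW r4).
  rewrite -[leRHS]mulr1 ler_wpM2l ?(ltW r4)// exprn_ile1//.
  by case/andP: h01 => _ /ltW.
exists (S1 * K2)%R; first exact: mulr_gt0.
move=> g G tau gG G0 tau0 x Sx small.
set u := (tau / G)%R; have u0 : (0 < u)%R by rewrite divr_gt0.
set c0 := (K2 * (G `^ p^-1 * u `^ q^-1))%R.
have c00 : (0 < c0)%R by rewrite mulr_gt0// mulr_gt0// powR_gt0.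
pose z j := (vmass j (idx S j x) * u)%R.
have v0 j := vmass_gt0 H S j (idx S j x).
have z0 j : (0 < z j)%R by rewrite mulr_gt0.
apply: nneseries_le => [j|n]; first by rewrite lee_fin slope_ge0.
rewrite sumEFin lee_fin -mulrA -/c0.
rewrite -ler_pdivrMr// mulr_suml; apply: (HS z) => // [i j ij|j|j].
- by rewrite /z mulrA ler_wpM2r ?(ltW u0)//; exact: decay.
- rewrite divr_ge0 ?slope_ge0 ?(ltW c00)//=.
  rewrite ler_pdivrMr//.
  have Nq : (0 < vmass j (idx S j x) `^ q^-1)%R by rewrite powR_gt0.
  rewrite -(ler_pM2r Nq); apply: (le_trans (slK _ _ _)).
  have h : (energy g j (idx S j x) `^ p^-1 <= tau `^ p^-1 * vmass j (idx S j x) `^ p^-1)%R.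
    rewrite -powRM ?(ltW tau0) ?(ltW (v0 _))//; apply: powR_le => //; first exact: ltW.
    exact: energy_ge0.
  apply: (le_trans (ler_wpM2l (ltW K20) h)).
  rewrite powRB ?(gt_eqF (z0 j)) ?implybT// /z.
  rewrite !(powRM _ (ltW (v0 j)) (ltW u0)) /c0.
  have -> : (tau `^ p^-1 = G `^ p^-1 * u `^ p^-1)%R.
    by rewrite -powRM ?(ltW G0) ?(ltW u0)// mulrC divfK// gt_eqF.
  have uq : (0 < u `^ q^-1)%R by rewrite powR_gt0.
  set a := (u `^ q^-1)%R in uq *; set b := (_ `^ q^-1)%R in Nq *.
  set s := (vmass _ _ `^ p^-1)%R; set s' := (u `^ p^-1)%R; set s'' := (G `^ p^-1)%R.
  rewrite (_ : s * s' / (b * a) * (K2 * (s'' * a)) * b =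
      K2 * (s'' * s' * s) * ((b * a)^-1 * (b * a)))%R; last by lra.
  by rewrite mulVf ?mulr1// gt_eqF// mulr_gt0.
- rewrite ler_pdivrMr//.
  have Nq : (0 < vmass j (idx S j x) `^ q^-1)%R by rewrite powR_gt0.
  rewrite -(ler_pM2r Nq); apply: (le_trans (slK _ _ _)).
  have h : (energy g j (idx S j x) `^ p^-1 <= G `^ p^-1)%R.
    apply: powR_le; [exact: ltW|exact: energy_ge0|exact: (energy_le S j _ gG)].
  apply: (le_trans (ler_wpM2l (ltW K20) h)).
  rewrite powRN /z (powRM _ (ltW (v0 j)) (ltW u0)) /c0.
  have uq : (0 < u `^ q^-1)%R by rewrite powR_gt0.
  set a := (u `^ q^-1)%R in uq *; set b := (_ `^ q^-1)%R in Nq *.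
  set s'' := (G `^ p^-1)%R.
  rewrite (_ : (b * a)^-1 * (K2 * (s'' * a)) * b =
      K2 * s'' * ((b * a)^-1 * (b * a)))%R; last by lra.
  by rewrite mulVf ?mulr1// gt_eqF// mulr_gt0.
Qed.

Lemma measurable_slope_sum g k : measurable_fun (dom S : set Tn)
  ((fun x => \sum_(k <= j <oo) (slope g j (idx S j x))%:E) : Tn -> _).
Proof.
apply: (@measurable_nneseries _ Tn R (dom S) (fun j x => slope g j (idx S j x))) => j.
  exact: measurable_slope.
by move=> x; exact: slope_ge0.
Qed.

Lemma measurable_slope_gt g (t : R) : measurable
  ([set x | dom S x /\ t%:E < \sum_(0 <= j <oo) (slope g j (idx S j x))%:E] : set Tn).
Proof.
rewrite (_ : [set x | _] = dom S `&`
    (fun x => \sum_(0 <= j <oo) (slope g j (idx S j x))%:E) @^-1` [set` `]t%:E, +oo[]).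
  have mS := measurable_slope_sum g 0.
  exact: (mS (dom_meas S) _ (emeasurable_itv `]t%:E, +oo[)).
by apply/seteqP; split => x [Sx]/=; rewrite in_itv/= andbT.
Qed.

(** Where the slope sum exceeds [t], the contrapositive of [slope_chain_le] finds a scale with
    [energy > tau * vmass], and such points were measured in [all_levels_measure_le]. *)
Lemma slope_weak_le : exists2 W : R, (0 < W)%R & forall g G t,
  admissible_gradient mu p g G -> (0 < t)%R ->
  nu [set x | dom S x /\ t%:E < \sum_(0 <= j <oo) (slope g j (idx S j x))%:E] <=
    (W * (G `^ p^-1 / t) `^ q)%:E.
Proof.
have p0 := p_gt0 H; have q0 := q_gt0 H.
have [S0 S00 HS] := slope_chain_le.
exists (S0 `^ q)%R; first by rewrite powR_gt0.
move=> g G t gG t0.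
have [_ mg G0 gle] := gG; have gfin := admissible_fin gG.
(* With [G = 0] every slope vanishes and the level set is empty; afterwards [tau / G] makes
   sense. *)
have [GZ|GZ] := eqVneq G 0%R.
  rewrite (_ : [set x | _] = set0) ?measure0 ?lee_fin ?mulr_ge0 ?powR_ge0//.
  apply/seteqP; split=> // x [Sx]; rewrite eseries0 ?lte_fin ?ltNge ?ltW// => j _ _.
  have : (energy g j (idx S j x) <= 0)%R by rewrite -[X in (_ <= X)%R]GZ; exact: (energy_le _ _ _ gG).
  rewrite le_eqVlt ltNge energy_ge0 orbF => /eqP eZ.
  by rewrite /(slope _ _ _) eZ mul0r powR0 ?mulr0// invr_neq0// gt_eqF.
have Gpos : (0 < G)%R by rewrite lt_neqAle eq_sym GZ.
have Gp : (0 < G `^ p^-1)%R by rewrite powR_gt0.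
have c0 : (0 < S0 * G `^ p^-1)%R by rewrite mulr_gt0.
(* The solution of [S0 * (G ^ (1/p) * (tau / G) ^ (1/q)) = t]. *)
set tau := (G * (t / (S0 * G `^ p^-1)) `^ q)%R.
have v0 : (0 < t / (S0 * G `^ p^-1))%R by rewrite divr_gt0.
have tau0 : (0 < tau)%R by rewrite mulr_gt0// powR_gt0.
have [mA Ale] := all_levels_measure_le gG tau0.
have -> : (S0 `^ q * (G `^ p^-1 / t) `^ q = G / tau)%R.
  rewrite -powRM ?(ltW S00) ?divr_ge0 ?(ltW t0) ?(ltW Gp)//.
  rewrite /tau invfM mulVKf// mulrA -invf_div -[X in (X `^ q)%R = _]mul1r.
  by rewrite powR_div ?(ltW v0)// powR1 mul1r.
apply: le_trans Ale.
have sub : [set x | dom S x /\ t%:E < \sum_(0 <= j <oo) (slope g j (idx S j x))%:E] `<=`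
    [set x | dom S x /\ exists k, (tau * vmass k (idx S k x) < energy g k (idx S k x))%R].
  move=> x [Sx xt]; split=> //; apply: contrapT => /forallNP nk.
  have small k : (energy g k (idx S k x) <= tau * vmass k (idx S k x))%R.
    by rewrite leNgt; apply/negP; exact: nk.
  have := HS g G tau gG Gpos tau0 x Sx small.
  have -> : (S0 * (G `^ p^-1 * (tau / G) `^ q^-1) = t)%R.
    rewrite /tau [(G * _)%R]mulrC mulfK ?gt_eqF// powRK ?gt_eqF ?(ltW v0)//.
    by rewrite mulrA mulrC divfK// gt_eqF.
  by rewrite leNgt xt.
apply: le_measure => //; rewrite inE//.
exact: measurable_slope_gt.
Qed.

End weak_estimate.

Lemma limf_esup_eq (R : realType) (F : set_system R) (f : R -> \bar R) (l : R) :
  ProperFilter F ->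
  (forall e : R, (0 < e)%R -> F [set x | (l - e)%:E <= f x <= (l + e)%:E]) ->
  limf_esup f F = l%:E.
Proof.
move=> FF fl; apply/eqP; rewrite eq_le; apply/andP; split.
  apply/lee_addgt0Pr => e e0; rewrite limf_esupE.
  apply: (@le_trans _ _ (ereal_sup (f @` [set x | (l - e)%:E <= f x <= (l + e)%:E]))).
    by apply: ereal_inf_lbound; exists [set x | (l - e)%:E <= f x <= (l + e)%:E] => //; exact: fl.
  by apply: ge_ereal_sup => _ [x /= /andP[_ xl] <-].
rewrite limf_esupE; apply: le_ereal_inf_tmp => _ [V FV <-].
apply/lee_subgt0Pr => e e0.
have [x [/andP[lx _] Vx]] := filter_ex (filterI (fl e e0) FV).
by rewrite -EFinB (le_trans lx)//; apply: ereal_sup_ubound; exists x.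
Qed.

(** * The representative as a limit of means *)

Section good_points.
Context {R : realType} {X : pointedMetricType R}.
Variables (mu nu : complete_borel_measure X) (E : set X).
Variables (p q alpha lambda r0 C delta : R).
Local Notation Tm := (g_sigma_algebraType (cb_sets mu)).
Local Notation Tn := (g_sigma_algebraType (cb_sets nu)).
Hypothesis H : doubling_pair mu nu E p q alpha lambda r0 C delta.
Variable S : net nu E (scale lambda r0).
Local Notation scale := (scale lambda r0).
Local Notation bal := (bal S).
Local Notation slope := (slope mu p alpha S).
Local Notation slope_sum g k x := (\sum_(k <= j <oo) (slope g j (idx S j x))%:E).

Definition good (g : X -> R) : set X := [set x | dom S x /\ slope_sum g 0%N x < +oo].

Definition discrete_mean (w : X -> R) k x : R := mean mu (bal k (idx S k x) : set Tm) w.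

Definition precise (w : X -> R) x : R := limn (fun k => discrete_mean w k x).

Lemma measurable_good g : measurable (good g : set Tn).
Proof.
have mS : measurable_fun (dom S : set Tn) ((fun x => slope_sum g 0%N x) : Tn -> _).
  exact: measurable_slope_sum.
rewrite (_ : good g =
  dom S `&` (fun x => slope_sum g 0%N x) @^-1` [set` Interval (BRight -oo%E) (BLeft +oo%E)]).
  exact: (mS (dom_meas S) _ (emeasurable_itv (Interval (BRight -oo%E) (BLeft +oo%E)))).
apply/seteqP; split => x [Sx]/=; rewrite in_itv/=; last by case/andP.
move=> ->; rewrite andbT; split=> //.
by rewrite (@lt_le_trans _ _ 0) ?ltNyr// nneseries_ge0// => j _ _; rewrite lee_fin slope_ge0.
Qed.

Lemma good_sub g : good g `<=` E.
Proof. by move=> x [Sx _]; exact: dom_sub Sx. Qed.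

(** The points of divergence lie in every level set of [slope_weak_le], whose measure tends to 0 as
    [t] grows. This covers [eps = 0] too. *)
Lemma dom_good K eps g G : balanced mu nu E p q alpha r0 K eps ->
  admissible_gradient mu p g G -> nu (dom S `\` good g) = 0.
Proof.
move=> bK gG; have [W W0 HW] := slope_weak_le H S bK; have q0 := q_gt0 H.
have [_ _ G0 _] := gG.
apply/eqP; rewrite eq_le measure_ge0 andbT; apply/lee_addgt0Pr => e e0; rewrite add0e.
(* The level [t] is [a / s]; the [+ 1] keeps it positive when [G = 0]. *)
set a := (G `^ p^-1 + 1)%R; have a0 : (0 < a)%R by rewrite ltr_wpDl ?powR_ge0.
set s := ((e / W) `^ q^-1)%R; have s0 : (0 < s)%R by rewrite powR_gt0// divr_gt0.
have t0 : (0 < a / s)%R by rewrite divr_gt0.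
have We : (W * (G `^ p^-1 / (a / s)) `^ q <= e)%R.
  rewrite -ler_pdivlMl// [leRHS]mulrC -(@powRVK _ (e / W)%R q) ?gt_eqF// ?divr_ge0 ?(ltW e0) ?(ltW W0)//.
  apply: powR_le; [exact: ltW|by rewrite divr_ge0 ?powR_ge0// ltW|].
  by rewrite -/s ler_pdivrMr// mulrC divfK ?gt_eqF// lerDl.
apply: (@le_trans _ _ (W * (G `^ p^-1 / (a / s)) `^ q)%:E); last by rewrite lee_fin.
apply: le_trans (HW g G (a / s)%R gG t0).
apply: le_measure; rewrite ?inE.
- by apply: measurableD; [exact: dom_meas|exact: measurable_good].
- exact: measurable_slope_gt.
move=> x [Sx ngx]; split=> //; apply: (@lt_le_trans _ _ +oo); first exact: ltry.
by rewrite leNgt; apply/negP => xoo; apply: ngx.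
Qed.

Lemma good_full K eps g G : balanced mu nu E p q alpha r0 K eps ->
  measurable (E : set Tn) -> admissible_gradient mu p g G -> nu (E `\` good g) = 0.
Proof.
move=> bK mE gG; apply/eqP; rewrite eq_le measure_ge0 andbT.
have mg := measurable_good g; have mS := dom_meas S.
apply: (@le_trans _ _ (nu ((E `\` dom S) `|` (dom S `\` good g)))).
  apply: le_measure; rewrite ?inE.
  - exact: measurableD.
  - by apply: measurableU; exact: measurableD.
  - move=> x [Ex ngx]; have [Sx|nSx] := pselect (dom S x); first by right.
    by left.
apply: (@le_trans _ _ (nu (E `\` dom S) + nu (dom S `\` good g))).
  by apply: measureU2; exact: measurableD.
by rewrite (dom_full S) (dom_good bK gG) add0e.
Qed.

Lemma scale_find n0 r : (0 < r < scale n0)%R ->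
  exists2 k, (n0 <= k)%N & (scale k.+1 <= r <= scale k)%R.
Proof.
move=> /andP[r_gt0 rn]; have s0 := scale_gt0 H 0.
have ex : exists k, (scale k.+1 <= r)%R.
  have e0 : (0 < r / scale 0)%R by rewrite divr_gt0.
  have [n _ hn] := near_infty_natSinv_expn_lt (PosNum e0).
  exists n; have := hn n (leqnn n); rewrite /= div1r -exprVn ltr_pdivlMr// => h.
  apply: le_trans (scale_nincr H (leqnSn n)) _; apply: ltW; apply: le_lt_trans h.
  by rewrite /(scale 0) expr0 mulr1 mulrC.
case: (ex_minnP ex) => k kr kmin.
have n0k : (n0 <= k)%N.
  rewrite leqNgt; apply/negP => kn; have := le_lt_trans kr rn.
  by rewrite ltNge (scale_nincr H kn).
exists k => //; rewrite kr/=; case: k n0k kr kmin => [|k] n0k kr kmin.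
  by move: n0k; rewrite leqn0 => /eqP n00; rewrite n00 in rn; exact: ltW.
by rewrite leNgt; apply/negP => /ltW/kmin; rewrite ltnn.
Qed.

Section pointwise.
Variables (Cp : R) (w g : X -> R).
Hypothesis P : poincare_pair mu E p alpha lambda r0 Cp w g.

Let jc_ge0 : (0 <= C ^+ 4 * Cp)%R.
Proof. by rewrite mulr_ge0 ?(pp_Cp P)// exprn_ge0// (ltW (dp_C H)). Qed.

Let s_ge0 x j : (0 <= slope g j (idx S j x))%R.
Proof. exact: slope_ge0. Qed.

Lemma discrete_mean_le x k : dom S x ->
  (`|discrete_mean w k.+1 x - discrete_mean w k x| <=
   C ^+ 4 * Cp * slope g k (idx S k x))%R.
Proof. by move=> Sx; exact: (jump_bal H _ P). Qed.

Lemma precise_cvg x : good g x -> discrete_mean w ^~ x @ \oo --> precise w x.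
Proof.
move=> [Sx goo].
exact: (telescope_cvg jc_ge0 (s_ge0 x) (fun k => discrete_mean_le k Sx) goo).
Qed.

Lemma precise_le x k : good g x ->
  `|precise w x - discrete_mean w k x|%:E <= (C ^+ 4 * Cp)%:E * slope_sum g k x.
Proof.
move=> [Sx goo].
exact: (telescope_lim_le jc_ge0 (s_ge0 x) (fun k => discrete_mean_le k Sx) goo).
Qed.

Lemma slope_cvg0 x : good g x -> (fun k => slope g k (idx S k x)) @ \oo --> 0%R.
Proof.
move=> [Sx goo]; have := nneseries_tail_cvg goo (fun k _ => s_ge0 x k).
move=> /fine_cvgP[fin_tail /cvgrPdist_lt h]; apply/cvgrPdist_lt => e e0.
near=> k; rewrite sub0r normrN ger0_norm//.
have tfin : slope_sum g k x \is a fin_num by near: k; exact: fin_tail.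
have : (`|0 - fine (slope_sum g k x)| < e)%R by near: k; exact: h.
rewrite sub0r normrN ger0_norm; last first.
  by apply: fine_ge0; apply: nneseries_ge0 => j _ _; rewrite lee_fin.
apply: le_lt_trans; rewrite -lee_fin fineK//.
by apply: (@le_nneseries_term _ (fun j => (slope g j (idx S j x))%:E)) => // j; rewrite lee_fin.
Unshelve. all: by end_near. Qed.

(** A small radius [r] lies between two consecutive scales. The mean over [ball x r] differs from
    the discrete mean there by a multiple of a slope, which tends to 0 as a term of a convergent
    series. So the limsup is a limit at every good point. *)
Lemma ubar_precise x : good g x -> ubar mu w x = (precise w x)%:E.
Proof.
move=> gx; have [Sx goo] := gx; apply: limf_esup_eq => e e0.
have e2 : (0 < e / 2)%R by rewrite divr_gt0.
(* The [+ 1] allows division also when [Cp = 0]. *)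
have D0 : (0 < C ^+ 4 * Cp + 1)%R by rewrite ltr_wpDl.
have /cvgrPdist_lt /(_ _ e2) [n1 _ h1] := precise_cvg gx.
have /cvgrPdist_lt /(_ _ (divr_gt0 e2 D0)) [n2 _ h2] := slope_cvg0 gx.
set n := maxn n1 n2.
near=> r.
have r_gt0 : (0 < r)%R by near: r; exact: nbhs_right_gt.
have rn : (r < scale n)%R by near: r; apply: nbhs_right_lt; exact: (scale_gt0 H).
have [k nk kr] := scale_find (introT andP (conj r_gt0 rn)).
have rr0 : (0 < r <= r0)%R.
  rewrite r_gt0/=; case/andP: kr => _ /le_trans; apply.
  by rewrite -[leLHS]mul1r (scale_le_r0 H)//; lra.
have [b0 boo] := mu_bounds H (dom_sub Sx) rr0.
rewrite /= avg_mean//; last 2 first.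
- exact: measurable_mball.
- by apply: (pp_int P) => //; exact: dom_sub Sx.
have k1 : (n1 <= k)%N by rewrite (leq_trans _ nk)// leq_maxl.
have k2 : (n2 <= k)%N by rewrite (leq_trans _ nk)// leq_maxr.
have := h1 k k1; have := h2 k k2; have := jump_ball H P Sx kr.
rewrite /= -/(discrete_mean w k x) sub0r normrN ltr_pdivlMr// !lee_fin.
set m := mean _ _ _; set s := slope _ _ _; set D := (C ^+ 4 * Cp)%R.
set f := discrete_mean _ _ _; set L := precise _ _ => hm hs hL.
have s0 : (0 <= s)%R by exact: s_ge0.
rewrite (ger0_norm s0) in hs.
have hm' : (`|m - f| <= s * (D + 1))%R.
  by apply: (le_trans hm); rewrite mulrC ler_wpM2l// lerDl.
have : (`|m - L| < e)%R.
  have := ler_normD (m - f)%R (f - L)%R; rewrite addrA subrK (distrC f).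
  by move: hm' hs hL; rewrite -/D; set a := `|m - f|%R; set b := `|L - f|%R; lra.
by rewrite ltr_norml; lra.
Unshelve. all: by end_near. Qed.

Lemma measurable_discrete_mean k :
  measurable_fun (dom S : set Tn) (discrete_mean w k : Tn -> R).
Proof.
apply: (@measurable_step _ Tn (dom S) _ _ (idx S k) (fun i => mean mu (bal k i : set Tm) w)).
exact: idx_meas.
Qed.

Lemma measurable_precise : measurable_fun (good g : set Tn) (precise w : Tn -> R).
Proof.
apply: (@measurable_fun_cvg _ Tn R (good g) (fun k => discrete_mean w k : Tn -> R)).
  move=> k; apply: measurable_funS (measurable_discrete_mean k).
    exact: dom_meas.
  by move=> x [].
by move=> x gx; exact: precise_cvg.
Qed.

End pointwise.
End good_points.

(** * Functions known up to a null set *)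

Section complete_measure.
Context {R : realType} {X : pointedMetricType R} (nu : complete_borel_measure X).
Local Notation Tn := (g_sigma_algebraType (cb_sets nu)).

(** Completeness enters here: on [E] minus [A] nothing is known of [f], but each of its preimages
    there lies in a null set. *)
Lemma measurable_fun_complete (A E : set X) (f : X -> \bar R) :
  measurable (A : set Tn) -> measurable (E : set Tn) -> A `<=` E -> nu (E `\` A) = 0 ->
  measurable_fun (A : set Tn) (f : Tn -> \bar R) ->
  measurable_fun (E : set Tn) (f : Tn -> \bar R).
Proof.
move=> mA mE AE EA0 mf _ Y mY.
rewrite (_ : E `&` _ = (A `&` f @^-1` Y) `|` ((E `\` A) `&` f @^-1` Y)).
  apply: measurableU; first exact: mf.
  apply: cb_complete; exists (E `\` A); split=> //; first exact: measurableD.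
apply/seteqP; split => x.
  by move=> [Ex fx]; have [Ax|nAx] := pselect (A x); [left|right].
by case=> -[Ax fx]; split=> //; [exact: AE|case: Ax].
Qed.

Lemma integral_full (A E : set X) (f : X -> \bar R) :
  measurable (A : set Tn) -> measurable (E : set Tn) -> A `<=` E -> nu (E `\` A) = 0 ->
  measurable_fun (E : set Tn) (f : Tn -> \bar R) -> (forall x, 0 <= f x) ->
  \int[nu]_(x in (E : set Tn)) f x = \int[nu]_(x in (A : set Tn)) f x.
Proof.
move=> mA mE AE EA0 mf f0.
rewrite (@ge0_negligible_integral _ Tn R nu E (E `\` A))//; last exact: measurableD.
by rewrite setDD setIidr.
Qed.

Lemma norm_LpE (E : set X) (q : R) (f : X -> \bar R) : (0 < q)%R ->
  measurable (E : set Tn) ->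
  norm_Lp nu E q f = (\int[nu]_(x in (E : set Tn)) (`|f x| `^ q)) `^ q^-1.
Proof.
move=> q0 mE; rewrite /norm_Lp unlock; congr (_ `^ _).
rewrite [RHS]integral_mkcond; apply: eq_integral => x _; rewrite !patchE.
by case: ifP => //; rewrite abse0 poweR0r// gt_eqF.
Qed.

End complete_measure.

(** * Consequences of a bound on the norm *)

Section data.
Context {R : realType} {X : pointedMetricType R}.
Variables (mu nu : complete_borel_measure X) (E : set X).
Variables (p q alpha lambda r0 C delta : R).
Local Notation Tm := (g_sigma_algebraType (cb_sets mu)).
Local Notation Tn := (g_sigma_algebraType (cb_sets nu)).

Definition L1_part (t : L1_term) (u : X -> R) : \bar R :=
  match t with
  | L1_on_E => norm_Lp nu E 1 (ubar mu u)
  | L1_on_X => norm_Lp mu setT 1 (EFin \o u)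
  end.

Definition datum t (M : R) (u g : X -> R) : Prop :=
  [/\ poincare_pair mu E p alpha lambda r0 1 u g,
      admissible_gradient mu p g (M `^ p), L1loc mu u & L1_part t u <= M%:E].

Lemma L1loc_measurable u : L1loc mu u -> measurable_fun setT (u : Tm -> R).
Proof.
move=> iu.
rewrite (_ : setT = \bigcup_n ball (point : X) n.+1%:R); last first.
  apply/seteqP; split => // x _.
  by exists (Num.trunc (mdist (point : X) x)) => //; apply/ball_mdist; exact: truncnS_gt.
apply/(measurable_fun_bigcup (u : Tm -> R)) => [n|n]; first exact: measurable_mball.
by apply/measurable_EFinP; case/integrableP: (iu point n.+1%:R (ltr0Sn _ _)).
Qed.

Hypothesis H : doubling_pair mu nu E p q alpha lambda r0 C delta.

Lemma datum_of_norm t M (G : (X -> R) -> X -> R) u : (0 <= M)%R ->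
  L1loc mu u -> poincare_gradient mu E alpha p lambda r0 u (G u) ->
  Y_norm t mu nu E p G u <= M%:E -> datum t M u (G u).
Proof.
move=> M0 iu [g0 [mg gfin] Pg] NM; have p0 := p_gt0 H.
have mg' : measurable_fun setT (G u : Tm -> R) by exact/measurable_EFinP.
have L0 : 0 <= L1_part t u by rewrite /L1_part; case: t {NM} => //; exact: Lnorm_ge0.
have n0 : 0 <= norm_Lp mu setT p (EFin \o G u) by exact: Lnorm_ge0.
have LM : L1_part t u <= M%:E by apply: le_trans NM; rewrite leeDl.
have gM : norm_Lp mu setT p (EFin \o G u) <= M%:E by apply: le_trans NM; rewrite leeDr.
have gE : \int[mu]_(x in (setT : set Tm)) (`|(EFin \o G u) x| `^ p) =
    \int[mu]_x (G u x `^ p)%:E.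
  by apply: eq_integral => x _ /=; rewrite ger0_norm.
have gp : \int[mu]_x (G u x `^ p)%:E <= (M `^ p)%:E.
  have I0 : 0 <= \int[mu]_x (G u x `^ p)%:E.
    by apply: integral_ge0 => x _; rewrite lee_fin powR_ge0.
  rewrite (norm_LpE _ p0 (@measurableT _ Tm)) gE in gM.
  have := poweR_le (ltW p0) (poweR_ge0 _ _) gM.
  by rewrite -poweRrM (mulVf (lt0r_neq0 p0)) (poweRe1 I0).
split; [|by split; [exact: g0|exact: mg'|exact: powR_ge0|exact: gp]|exact: iu|exact: LM].
split; [exact: ler01| |exact: g0|exact: mg'| |].
- by move=> x r _ /andP[r_gt0 _]; exact: iu.
- by apply: le_lt_trans gp _; rewrite ltry.
- by move=> x r Ex rr; rewrite mul1r; exact: Pg.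
Qed.

Variable S : net nu E (scale lambda r0).
Hypothesis mE : measurable (E : set Tn).
Local Notation slope := (slope mu p alpha S).
Local Notation slope_sum g k x := (\sum_(k <= j <oo) (slope g j (idx S j x))%:E).
Local Notation good := (good mu p alpha S).
Local Notation precise := (precise mu S).
Local Notation discrete_mean := (discrete_mean mu S).
Variables (K eps : R) (bK : balanced mu nu E p q alpha r0 K eps).

Lemma nu_cell_fin k i : nu (cell S k i) < +oo.
Proof.
have [v0 voo] := nu_vbal H S k i; apply: le_lt_trans voo.
apply: le_measure; rewrite ?inE//; last first.
- by apply: (@cell_sub_vbal _ _ _ _ _ _ _ _ _ _ _ _ H S k i i (node S k i));
    apply: ballxx; case/andP: (lbal_radius H k).
- exact: measurable_mball.
- by apply: measurable_piece; [exact: dom_meas|exact: idx_meas].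
Qed.

(** The cells of scale 0 are finitely many, and each lies in a ball of finite measure. *)
Lemma nu_dom_fin : nu (dom S) < +oo.
Proof.
have := @integral_step _ Tn _ nu (dom S) (dom_meas S) (idx S 0) (card_net S 0)
  (fun=> 1) (idx_meas 0) (fun x Sx => idx_lt 0 Sx) (fun=> lee01).
rewrite integral_cst ?mul1e; last exact: dom_meas.
move=> ->; apply: lte_sum_pinfty => i _; rewrite mul1e; exact: nu_cell_fin.
Qed.

Lemma measurable_ubar u g M t : datum t M u g ->
  measurable_fun (E : set Tn) (ubar mu u : Tn -> \bar R).
Proof.
move=> [P gM _ _]; have mg := measurable_good mu p alpha S g.
apply: (@measurable_fun_complete _ _ nu (good g)) => //.
- exact: good_sub.
- exact: (good_full H S bK mE gM).
apply: (@eq_measurable_fun _ _ Tn _ (good g) (EFin \o precise u : Tn -> _)).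
  by move=> x; rewrite inE => gx /=; rewrite (ubar_precise H P gx).
by apply/measurable_EFinP; apply: measurable_precise H _ _ _ _ P.
Qed.

Lemma mean_coef_bound_X k i : exists2 c : R, (0 < c)%R & forall u g M, (0 < M)%R ->
  datum L1_on_X M u g -> (`|mean mu (bal S k i : set Tm) u| <= c * M)%R.
Proof.
have [b0 boo] := mu_bal H S k i.
have mb : measurable (bal S k i : set Tm) by exact: measurable_mball.
have f0 : (0 < fine (mu (bal S k i)))%R by rewrite fine_gt0// b0.
exists (fine (mu (bal S k i)))^-1%R; first by rewrite invr_gt0.
move=> u g M M0 [P _ iu uM]; have br := bal_radius H k.
have ib : mu.-integrable (bal S k i : set Tm) (EFin \o u : Tm -> _).
  exact: (pp_int P (node_in S k i) br).
rewrite /mean normrM ger0_norm ?invr_ge0 ?(ltW f0)// ler_wpM2l ?invr_ge0 ?(ltW f0)//.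
rewrite -lee_fin EFin_normr_Rintegral//.
have mu_ := L1loc_measurable iu.
move: uM; rewrite /L1_part norm_LpE// invr1.
have i0 : 0 <= \int[mu]_(x in (setT : set Tm)) (`|(EFin \o u) x| `^ 1).
  by apply: integral_ge0 => x _; exact: poweR_ge0.
rewrite poweRe1//; apply: le_trans.
apply: le_trans (le_abse_integral _ _ _) _ => //; first by case/integrableP: ib.
under [leRHS]eq_integral do rewrite poweRe1//.
apply: ge0_subset_integral => //.
by apply: measurableT_comp => //; exact/measurable_EFinP.
Qed.

(** The means use [mu], the norm uses [nu]. Outside a set of at most half the mass of the cell the
    slope sum is at most [c1 * M], so [ubar] is within [C ^ 4 * c1 * M] of the mean. If the mean
    were large, [ubar] would be large on half of the cell, against the bound on its integral. *)
Lemma mean_coef_bound_E k i : 0 < nu (cell S k i) ->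
  exists2 c : R, (0 < c)%R & forall u g M, (0 < M)%R ->
  datum L1_on_E M u g -> (`|mean mu (bal S k i : set Tm) u| <= c * M)%R.
Proof.
move=> n0; have [W W0 HW] := slope_weak_le H S bK; have q0 := q_gt0 H.
set v := fine (nu (cell S k i)).
have vE : nu (cell S k i) = v%:E by rewrite fineK// ge0_fin_numE// nu_cell_fin.
have v0 : (0 < v)%R by rewrite fine_gt0// n0 nu_cell_fin.
(* Chosen so that the weak-type bound at level [c1 * M] equals [v / 2], half the mass of the
   cell. *)
set c1 := ((2 * W / v) `^ q^-1)%R.
have c10 : (0 < c1)%R by rewrite powR_gt0// divr_gt0// mulr_gt0.
have D0 : (0 < C ^+ 4)%R by rewrite exprn_gt0// (dp_C H).
exists (C ^+ 4 * c1 + 2 / v)%R; first exact: addr_gt0 (mulr_gt0 D0 c10) (divr_gt0 (ltr0Sn _ 1) v0).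
move=> u g M M0 Dt; have [P gM _ uM] := Dt.
have t0 : (0 < c1 * M)%R by rewrite mulr_gt0.
have := HW g (M `^ p)%R (c1 * M)%R gM t0.
rewrite powRK ?(gt_eqF (p_gt0 H)) ?(ltW M0)//.
have -> : (W * (M / (c1 * M)) `^ q = v / 2)%R.
  rewrite [(c1 * M)%R]mulrC invfM mulrA divff ?gt_eqF// powR_div ?(ltW c10)// powR1.
  rewrite /c1 powRVK ?gt_eqF ?divr_ge0 ?mulr_ge0 ?(ltW W0) ?(ltW v0)//.
  by rewrite mul1r invf_div mulrCA invfM [(W * (_ * _))%R]mulrCA mulfV ?gt_eqF// mulr1.
set A := [set x | _] => Av.
have mA : measurable (A : set Tn) by exact: measurable_slope_gt.
set Q := (cell S k i `&` good g) `\` A.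
have mcell : measurable (cell S k i : set Tn).
  by apply: measurable_piece; [exact: dom_meas|exact: idx_meas].
have mgood := measurable_good mu p alpha S g.
have mQ : measurable (Q : set Tn) by apply: measurableD => //; exact: measurableI.
have mbad : measurable (dom S `\` good g : set Tn).
  by apply: measurableD => //; exact: dom_meas.
have Qv : (v / 2)%:E <= nu Q.
  have : v%:E <= nu Q + (v / 2)%:E.
    rewrite -vE; apply: (@le_trans _ _ (nu (Q `|` (A `|` (dom S `\` good g))))).
      apply: le_measure; rewrite ?inE//.
        by apply: measurableU => //; exact: measurableU.
      move=> x cx; have [Ax|nAx] := pselect (A x); first by right; left.
      have [gx|ngx] := pselect (good g x); first by left.
      by right; right; split=> //; case: cx.
    apply: (@le_trans _ _ (nu Q + nu (A `|` (dom S `\` good g)))).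
      by apply: measureU2 => //; exact: measurableU.
    apply: leeD2l; apply: (@le_trans _ _ (nu A + nu (dom S `\` good g))).
      exact: measureU2.
    by rewrite (dom_good H S bK gM) adde0.
  by rewrite {1}(splitr v) EFinD leeD2rE.
(* [s] bounds the modulus of [ubar] from below on [Q]; only a positive [s] carries information. *)
set f := mean mu _ u; set s := (`|f| - C ^+ 4 * (c1 * M))%R.
suff : (s <= 2 / v * M)%R by rewrite /s; move: (2 / v)%R => y; lra.
have [s0|s0] := leP s 0%R.
  by apply: (le_trans s0); rewrite mulr_ge0 ?divr_ge0 ?(ltW v0) ?(ltW M0).
suff : (s * (v / 2) <= M)%R.
  by rewrite -[(2 / v)%R]invf_div [((v / 2)^-1 * M)%R]mulrC ler_pdivlMr// divr_gt0.
rewrite -lee_fin EFinM.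
apply: (@le_trans _ _ (s%:E * nu Q)); first by rewrite lee_wpmul2l// lee_fin ltW.
rewrite -integral_cst//; apply: le_trans uM.
rewrite /L1_part norm_LpE// invr1 poweRe1; last first.
  by apply: integral_ge0 => x _; exact: poweR_ge0.
have mub := measurable_ubar Dt.
under [leRHS]eq_integral do rewrite poweRe1//.
have mab : measurable_fun (E : set Tn) ((fun x => `|ubar mu u x|) : Tn -> _).
  exact: measurableT_comp.
have QE : Q `<=` E by move=> x [[_ /good_sub]].
apply: (@le_trans _ _ (\int[nu]_(x in (Q : set Tn)) `|ubar mu u x|)); last first.
  exact: ge0_subset_integral.
apply: ge0_le_integral => //.
- by move=> x _; rewrite lee_fin ltW.
- exact: measurable_funS mab.
move=> x [[cx gx] nAx]; rewrite (ubar_precise H P gx) /= lee_fin.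
have := precise_le H P k gx.
have -> : discrete_mean u k x = f by rewrite /(discrete_mean _ _ _); case: cx => _ /= ->.
have ss : slope_sum g k x <= (c1 * M)%:E.
  apply: (@le_trans _ _ (slope_sum g 0 x)).
    rewrite [leRHS](nneseries_split 0 k)//; last by move=> j _; rewrite lee_fin slope_ge0.
    by rewrite leeDr// sume_ge0// => j _; rewrite lee_fin slope_ge0.
  rewrite leNgt; apply/negP => h; apply: nAx; split=> //; by case: gx.
move=> /le_trans -/(_ ((C ^+ 4 * 1)%:E * (c1 * M)%:E)) h.
have {h} : (`|precise u x - f| <= C ^+ 4 * (c1 * M))%R.
  rewrite -lee_fin EFinM -[X in X%:E * _]mulr1; apply: h.
  by rewrite lee_wpmul2l// lee_fin mulr1 ltW.
rewrite /s distrC => h; have := ler_normD (f - precise u x)%R (precise u x).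
by rewrite subrK; lra.
Qed.

Lemma mean_coef_bound t k i : 0 < nu (cell S k i) ->
  exists2 c : R, (0 < c)%R & forall u g M, (0 < M)%R ->
  datum t M u g -> (`|mean mu (bal S k i : set Tm) u| <= c * M)%R.
Proof. by case: t => n0; [exact: mean_coef_bound_E|exact: mean_coef_bound_X]. Qed.

End data.

(** * Ultrafilter limits and sequences with summable jumps *)

Lemma ultra_bounded_cvg (R : realType) (T : Type) (U : set_system T) (a : T -> R) (b : R) :
  UltraFilter U -> (forall n, `|a n| <= b)%R -> exists l : R, a @ U --> l.
Proof.
move=> UU ab; have PU : ProperFilter U by apply: ultra_proper.
have [|l [_ cl]] := @segment_compact R (- b)%R b (a @ U) (fmap_proper_filter a PU).
  by apply: (@filterE T U) => n /=; rewrite in_itv/= -ler_norml ab.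
exists l => A nA; have [//|UnA] := in_ultra_setVsetC (a @^-1` A) UU.
by have [y [/= nAy Ay]] := cl (~` A) A UnA nA.
Qed.

Lemma filter_bounded_forall (T : Type) (F : set_system T) (P : nat -> T -> Prop) n :
  Filter F -> (forall i, F (P i)) -> F [set x | forall i, (i < n)%N -> P i x].
Proof.
move=> FF FP; elim: n => [|n IH]; first by apply: filterE => x i; rewrite ltn0.
apply: filterS (filterI IH (FP n)) => x [xn Pn] i.
by rewrite ltnS leq_eqVlt => /predU1P[->|/xn].
Qed.

Lemma powR_add3_le (R : realType) (q a b c : R) : (0 <= q)%R -> (0 <= a)%R -> (0 <= b)%R ->
  (0 <= c)%R -> ((a + b + c) `^ q <= 3 `^ q * (a `^ q + b `^ q + c `^ q))%R.
Proof.
move=> q0 a0 b0 c0; set M := Num.max a (Num.max b c).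
have M0 : (0 <= M)%R by rewrite le_max a0.
have aM : (a <= M)%R by rewrite le_max lexx.
have bM : (b <= M)%R by rewrite !le_max lexx orbT.
have cM : (c <= M)%R by rewrite !le_max lexx !orbT.
apply: (@le_trans _ _ ((3 * M) `^ q)%R).
  by apply: powR_le => //; [rewrite !addr_ge0|lra].
rewrite powRM// ler_wpM2l ?powR_ge0//.
have := powR_ge0 a q; have := powR_ge0 b q; have := powR_ge0 c q.
have : M = a \/ M = b \/ M = c.
  by rewrite /M; case: (leP b c) => _; case: leP => _; tauto.
by case=> [->|[->|->]]; move: (a `^ q)%R (b `^ q)%R (c `^ q)%R => a' b' c'; lra.
Qed.

Section summable_jumps.
Context d (T : measurableType d) (R : realType) (m : {measure set T -> \bar R}).
Variables (D : set T) (mD : measurable D) (q th : R).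
Hypotheses (q0 : (0 < q)%R) (th01 : (0 < th < 1)%R).

Definition summable_set (h : nat -> T -> R) : set T :=
  [set x | D x /\ \sum_(0 <= j <oo) (h j x)%:E < +oo].

Lemma measurable_summable_set (h : nat -> T -> R) : (forall j, measurable_fun D (h j)) ->
  (forall j x, 0 <= h j x)%R -> measurable (summable_set h).
Proof.
move=> mh h0; have mS := measurable_nneseries 0 mh h0.
rewrite (_ : summable_set h = D `&` (fun x => \sum_(0 <= j <oo) (h j x)%:E) @^-1`
    [set` Interval (BRight -oo%E) (BLeft +oo%E)]).
  exact: (mS mD _ (emeasurable_itv _)).
apply/seteqP; split => x [Dx]/=; rewrite in_itv/=; last by case/andP.
move=> ->; rewrite andbT; split=> //.
by rewrite (@lt_le_trans _ _ 0) ?ltNyr// nneseries_ge0// => j _ _; rewrite lee_fin.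
Qed.

(** Stated for abstract sequences because it serves twice: for the discrete means of a datum, and
    for their limits along an ultrafilter, which are not known to be means of any function. *)
Lemma summable_jumps : exists2 W : R, (0 < W)%R &
  forall (f h : nat -> T -> R) (A D0 : R),
  (forall j, measurable_fun D (f j)) -> (forall j, measurable_fun D (h j)) ->
  (forall j x, 0 <= h j x)%R -> (0 <= A)%R -> (0 <= D0)%R ->
  (forall j x, D x -> `|f j.+1 x - f j x| <= D0 * h j x)%R ->
  (forall j, \int[m]_(x in D) (h j x `^ q)%:E <= (A * (th ^+ j) ^+ 2)%:E) ->
  [/\ m (D `\` summable_set h) = 0,
      measurable_fun (summable_set h) (fun x => limn (f ^~ x)) &
      forall k, \int[m]_(x in summable_set h) (`|limn (f ^~ x) - f k x| `^ q)%:E <=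
        (W * D0 `^ q * A * th ^+ k)%:E].
Proof.
have [W W0 HW] := integral_tail_le m mD q0 th01; exists W => //.
move=> f h A D0 mf mh h0 A0 D00 fh hA.
have mG := measurable_summable_set mh h0.
have GD : summable_set h `<=` D by move=> x [].
have S0 k x : 0 <= \sum_(k <= j <oo) (h j x)%:E.
  by apply: nneseries_ge0 => j _ _; rewrite lee_fin.
have mSq k : measurable_fun D (fun x => (\sum_(k <= j <oo) (h j x)%:E) `^ q).
  apply: (@measurableT_comp _ _ _ _ _ _ (@poweR R ^~ q)); first exact: measurable_poweR.
  exact: measurable_nneseries.
have mlim : measurable_fun (summable_set h) (fun x => limn (f ^~ x)).
  apply: (@measurable_fun_cvg _ T R _ f).
    by move=> j; exact: measurable_funS (mf j).
  by move=> x [Dx xoo]; apply: (telescope_cvg D00 (h0 ^~ x) (fun j => fh j x Dx) xoo).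
split=> //.
- have mB : measurable (D `\` summable_set h) by exact: measurableD.
  have Bfin : \int[m]_(x in D `\` summable_set h)
      ((\sum_(0 <= j <oo) (h j x)%:E) `^ q) <= (W * A * th ^+ 0)%:E.
    apply: le_trans (HW h A mh h0 A0 hA 0%N); apply: ge0_subset_integral => //.
    by move=> x _; exact: poweR_ge0.
  (* On the complement the series is infinite, so a finite integral forces measure zero. *)
  have Binf : \int[m]_(x in D `\` summable_set h)
      ((\sum_(0 <= j <oo) (h j x)%:E) `^ q) = +oo * m (D `\` summable_set h).
    rewrite -integral_cst//; apply: eq_integral => x; rewrite inE => -[Dx nx].
    rewrite (_ : \sum_(0 <= j <oo) (h j x)%:E = +oo) ?poweRyr ?gt_eqF//.
    by apply/eqP; rewrite -leye_eq leNgt; apply/negP => xoo; apply: nx.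
  move: Bfin; rewrite Binf; have [-> //|nB] := eqVneq (m (D `\` summable_set h)) 0.
  by rewrite gt0_mulye ?lt0e ?nB ?measure_ge0// leye_eq.
move=> k.
have mSc : measurable_fun D
    (fun x => (D0 `^ q)%:E * (\sum_(k <= j <oo) (h j x)%:E) `^ q).
  exact: emeasurable_funM.
apply: (@le_trans _ _ (\int[m]_(x in D) ((D0 `^ q)%:E * (\sum_(k <= j <oo) (h j x)%:E) `^ q))).
  apply: (@le_trans _ _ (\int[m]_(x in summable_set h)
      ((D0 `^ q)%:E * (\sum_(k <= j <oo) (h j x)%:E) `^ q))); last first.
    apply: ge0_subset_integral => //.
    by move=> x _; rewrite mule_ge0 ?poweR_ge0// lee_fin powR_ge0.
  apply: ge0_le_integral => //.
  - apply/measurable_EFinP.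
    have mfk : measurable_fun (summable_set h) (f k) by exact: measurable_funS (mf k).
    apply: (@measurableT_comp _ _ _ _ _ _ (@powR R ^~ q)) => //.
    by apply: measurableT_comp => //; exact: measurable_funB.
  - exact: (measurable_funS mD GD mSc).
  - move=> x [Dx xoo]; rewrite -poweR_EFin -(poweR_EFin D0) -poweRM ?lee_fin//.
    apply: poweR_le; rewrite ?(ltW q0) ?lee_fin//.
    exact: (telescope_lim_le D00 (h0 ^~ x) (fun j => fh j x Dx) xoo).
rewrite ge0_integralZl_EFin ?powR_ge0//; last by move=> x _; exact: poweR_ge0.
have -> : (W * D0 `^ q * A * th ^+ k)%:E = (D0 `^ q)%:E * (W * A * th ^+ k)%:E.
  by rewrite -EFinM; congr EFin; lra.
by apply: lee_wpmul2l; [rewrite lee_fin powR_ge0|exact: HW].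
Qed.

End summable_jumps.

Lemma increasing_choice (P : nat -> nat -> Prop) :
  (forall j m, exists2 n, (m < n)%N & P j n) ->
  exists2 phi : nat -> nat, {homo phi : m n / (m < n)%N} & forall j, P j (phi j).
Proof.
move=> Pex.
have /choice[pick pickP] : forall c : nat * nat, exists n, (c.2 < n)%N /\ P c.1 n.
  by move=> [j m]; have [n mn Pn] := Pex j m; exists n.
pose phi := fix phi j := if j is j'.+1 then pick (j'.+1, phi j') else pick (0, 0)%N.
exists phi; last by case=> [|j]; [exact: (pickP (0, 0)%N).2|exact: (pickP (j.+1, phi j)).2].
apply: homo_ltn => [j i k|j]; first exact: ltn_trans.
exact: (pickP (j.+1, phi j)).1.
Qed.

(** * Compactness *)

Section compactness.
Context {R : realType} {X : pointedMetricType R}.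
Variables (mu nu : complete_borel_measure X) (E : set X).
Variables (p q alpha lambda r0 C delta : R).
Local Notation Tm := (g_sigma_algebraType (cb_sets mu)).
Local Notation Tn := (g_sigma_algebraType (cb_sets nu)).
Hypothesis H : doubling_pair mu nu E p q alpha lambda r0 C delta.
Variable S : net nu E (scale lambda r0).
Hypothesis mE : measurable (E : set Tn).
Local Notation slope := (slope mu p alpha S).
Local Notation good := (good mu p alpha S).
Local Notation precise := (precise mu S).
Local Notation discrete_mean := (discrete_mean mu S).
Local Notation datum := (datum mu nu E p alpha lambda r0).
Variables (K eps : R) (bK : balanced mu nu E p q alpha r0 K eps).
Hypothesis eps0 : (0 < eps)%R.

Let th := (2^-1 `^ (eps * q / 2))%R.

Let th01 : (0 < th < 1)%R.
Proof.
apply: powR_lt1; last by rewrite divr_gt0// mulr_gt0// (q_gt0 H).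
by rewrite invr_gt0 ltr0n/= invf_lt1 ?ltr0n// ltr1n.
Qed.

Let A0 := (((C ^+ 2) `^ p^-1 * K) `^ q * (r0 / 4) `^ (eps * q))%R.

Let A0_ge0 : (0 <= A0)%R.
Proof. by rewrite mulr_ge0 ?powR_ge0. Qed.

Let C4_ge0 : (0 <= C ^+ 4)%R.
Proof. by rewrite exprn_ge0// (ltW (dp_C H)). Qed.

Lemma datum_slope_integral t M u g k : (0 <= M)%R -> datum t M u g ->
  \int[nu]_(x in (dom S : set Tn)) (slope g k (idx S k x) `^ q)%:E <=
  (A0 * M `^ q * (th ^+ k) ^+ 2)%:E.
Proof.
move=> M0 [_ gM _ _]; apply: (le_trans (slope_integral_le H S bK k gM)).
by rewrite -[((M `^ p) `^ _)%R]powRrM [(p * _)%R]mulrC divfK// gt_eqF ?(p_gt0 H).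
Qed.

Lemma full_in_dom (A : set X) : measurable (A : set Tn) -> A `<=` dom S ->
  nu (dom S `\` A) = 0 -> nu (E `\` A) = 0.
Proof.
move=> mA AS SA0; apply/eqP; rewrite eq_le measure_ge0 andbT.
have mS := dom_meas S.
apply: (@le_trans _ _ (nu ((E `\` dom S) `|` (dom S `\` A)))).
  apply: le_measure; rewrite ?inE.
  - exact: measurableD.
  - by apply: measurableU; exact: measurableD.
  - move=> x [Ex nAx]; have [Sx|nSx] := pselect (dom S x); first by right.
    by left.
apply: (@le_trans _ _ (nu (E `\` dom S) + nu (dom S `\` A))).
  by apply: measureU2; exact: measurableD.
by rewrite (dom_full S) SA0 add0e.
Qed.

Lemma measurable_powR_norm (A : set X) (r : X -> R) :
  measurable_fun (A : set Tn) (r : Tn -> R) ->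
  measurable_fun (A : set Tn) ((fun x => (`|r x| `^ q)%:E) : Tn -> _).
Proof.
move=> mr; apply/measurable_EFinP.
apply: (@measurableT_comp _ _ _ _ _ _ (@powR R ^~ q)) => //.
exact: measurableT_comp.
Qed.

(** The values of [f] are known on [A] alone; null sets and completeness carry measurability and the
    norm over to [E]. *)
Lemma norm_Lp_full (A : set X) (f : X -> \bar R) (r : X -> R) :
  measurable (A : set Tn) -> A `<=` dom S -> nu (dom S `\` A) = 0 ->
  measurable_fun (A : set Tn) (r : Tn -> R) ->
  (forall x, A x -> f x = (r x)%:E) ->
  measurable_fun (E : set Tn) (f : Tn -> \bar R) /\
  norm_Lp nu E q f = (\int[nu]_(x in (A : set Tn)) (`|r x| `^ q)%:E) `^ q^-1.
Proof.
move=> mA AS SA0 mr fr; have q0 := q_gt0 H.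
have AE : A `<=` E by move=> x /AS; exact: dom_sub.
have EA0 := full_in_dom mA AS SA0.
have mf : measurable_fun (E : set Tn) (f : Tn -> \bar R).
  apply: (@measurable_fun_complete _ _ nu A) => //.
  apply: (@eq_measurable_fun _ _ Tn _ A (EFin \o r : Tn -> _)).
    by move=> x; rewrite inE => Ax /=; rewrite fr.
  exact/measurable_EFinP.
split=> //; rewrite norm_LpE// (integral_full mA mE AE EA0); last 2 first.
- apply: (@measurableT_comp _ _ _ _ _ _ (@poweR R ^~ q)); first exact: measurable_poweR.
  exact: measurableT_comp.
- by move=> x; exact: poweR_ge0.
by congr (_ `^ _); apply: eq_integral => x; rewrite inE => Ax; rewrite fr.
Qed.

Lemma integral_step_fin k (a : nat -> R) :
  \int[nu]_(x in (dom S : set Tn)) (`|a (idx S k x)| `^ q)%:E < +oo.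
Proof.
rewrite (@integral_step _ Tn _ nu (dom S) (dom_meas S) (idx S k) (card_net S k)
  (fun i => (`|a i| `^ q)%:E)); last 3 first.
- exact: idx_meas.
- by move=> x Sx; exact: idx_lt.
- by move=> i; rewrite lee_fin powR_ge0.
by apply: lte_sum_pinfty => i _; rewrite lte_mul_pinfty// ?lee_fin ?powR_ge0// (nu_cell_fin H).
Qed.

Lemma integral_add3_le (A : set X) (r a b c : X -> R) :
  measurable (A : set Tn) -> measurable_fun (A : set Tn) (r : Tn -> R) ->
  measurable_fun (A : set Tn) (a : Tn -> R) -> measurable_fun (A : set Tn) (b : Tn -> R) ->
  measurable_fun (A : set Tn) (c : Tn -> R) ->
  (forall x, A x -> `|r x| <= `|a x| + `|b x| + `|c x|)%R ->
  \int[nu]_(x in (A : set Tn)) (`|r x| `^ q)%:E <= (3 `^ q)%:E *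
   (\int[nu]_(x in (A : set Tn)) (`|a x| `^ q)%:E +
    \int[nu]_(x in (A : set Tn)) (`|b x| `^ q)%:E +
    \int[nu]_(x in (A : set Tn)) (`|c x| `^ q)%:E).
Proof.
move=> mA mr ma mb mc rabc; have q0 := q_gt0 H.
have pg (s : X -> R) x : A x -> 0 <= (`|s x| `^ q)%:E by rewrite lee_fin powR_ge0.
have mab : measurable_fun (A : set Tn)
    ((fun x => (`|a x| `^ q)%:E + (`|b x| `^ q)%:E) : Tn -> _).
  by apply: emeasurable_funD; exact: measurable_powR_norm.
have Iab : \int[nu]_(x in (A : set Tn)) ((`|a x| `^ q)%:E + (`|b x| `^ q)%:E) =
    \int[nu]_(x in (A : set Tn)) (`|a x| `^ q)%:E +
    \int[nu]_(x in (A : set Tn)) (`|b x| `^ q)%:E.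
  by apply: ge0_integralD => //; first [exact: pg|exact: measurable_powR_norm].
have Iabc : \int[nu]_(x in (A : set Tn))
      ((`|a x| `^ q)%:E + (`|b x| `^ q)%:E + (`|c x| `^ q)%:E) =
    \int[nu]_(x in (A : set Tn)) ((`|a x| `^ q)%:E + (`|b x| `^ q)%:E) +
    \int[nu]_(x in (A : set Tn)) (`|c x| `^ q)%:E.
  apply: ge0_integralD => //; first [exact: pg | exact: measurable_powR_norm |
    by move=> x Ax; rewrite adde_ge0 ?pg].
rewrite -Iab -Iabc.
have mabc : measurable_fun (A : set Tn)
    ((fun x => (`|a x| `^ q)%:E + (`|b x| `^ q)%:E + (`|c x| `^ q)%:E) : Tn -> _).
  by apply: emeasurable_funD => //; exact: measurable_powR_norm.
rewrite -ge0_integralZl_EFin ?powR_ge0//; last first.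
  by move=> x Ax; rewrite !adde_ge0 ?pg.
apply: ge0_le_integral => //.
- exact: measurable_powR_norm.
- exact: emeasurable_funM.
move=> x Ax; rewrite -!EFinD -EFinM lee_fin.
apply: (@le_trans _ _ ((`|a x| + `|b x| + `|c x|) `^ q)%R); last first.
  by apply: powR_add3_le; rewrite // ltW.
by apply: powR_le; rewrite ?rabc// ltW.
Qed.

(** A step function on the finitely many cells of scale 0 is [q]-integrable, so it suffices that the
    distance to one is finite. *)
Lemma integral_fin_of_tail (A : set X) (r : X -> R) (a : nat -> R) :
  measurable (A : set Tn) -> A `<=` dom S ->
  measurable_fun (A : set Tn) (r : Tn -> R) ->
  \int[nu]_(x in (A : set Tn)) (`|r x - a (idx S 0 x)| `^ q)%:E < +oo ->
  \int[nu]_(x in (A : set Tn)) (`|r x| `^ q)%:E < +oo.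
Proof.
move=> mA AS mr rfin; have q0 := q_gt0 H.
have ma : measurable_fun (dom S : set Tn) ((fun x => a (idx S 0 x)) : Tn -> R).
  by apply: (@measurable_step _ Tn (dom S) _ _ (idx S 0) a); exact: idx_meas.
have maA : measurable_fun (A : set Tn) ((fun x => a (idx S 0 x)) : Tn -> R).
  by apply: measurable_funS ma => //; exact: dom_meas.
apply: (le_lt_trans (@integral_add3_le A r (fun x => r x - a (idx S 0 x))%R
  (fun x => a (idx S 0 x)) (fun=> 0%R) mA mr _ maA _ _)) => //.
- exact: measurable_funB.
- by move=> x _; rewrite normr0 addr0 -{1}(subrK (a (idx S 0 x)) (r x)) ler_normD.
rewrite normr0 powR0 ?gt_eqF// integral0 adde0.
rewrite lte_mul_pinfty ?lee_fin ?powR_ge0//; apply: lte_add_pinfty; first exact: rfin.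
apply: le_lt_trans (integral_step_fin 0 a).
apply: ge0_subset_integral => //; first exact: dom_meas.
exact: measurable_powR_norm.
Qed.

Lemma slope_bound k i : exists2 b : R, (0 <= b)%R & forall t M u g, (0 <= M)%R ->
  datum t M u g -> (slope g k i <= b * M)%R.
Proof.
have p0 := p_gt0 H; have q0 := q_gt0 H; have [K0 [e0 _]] := bK.
set B := ((C ^+ 2) `^ p^-1 * K * (r0 / 4 * 2^-1 ^+ k) `^ eps)%R.
have B0 : (0 <= B)%R by rewrite mulr_ge0 ?powR_ge0// mulr_ge0 ?powR_ge0// ltW.
have N0 : (0 < vmass S k i `^ q^-1)%R by rewrite powR_gt0// (vmass_gt0 H).
exists (B / vmass S k i `^ q^-1)%R; first by rewrite divr_ge0// ltW.
move=> t M u g M0 [_ gM _ _].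
rewrite mulrAC ler_pdivlMr//; apply: (le_trans (slope_le H S g k i bK)).
rewrite ler_wpM2l// -[leRHS](@powRK _ M p) ?gt_eqF//.
by apply: powR_le; [rewrite invr_ge0 ltW|exact: energy_ge0|exact: (energy_le _ _ _ gM)].
Qed.

Lemma measurable_datum_tail t M u g k : datum t M u g ->
  measurable_fun (good g : set Tn) (precise u : Tn -> R) /\
  measurable_fun (good g : set Tn) (discrete_mean u k : Tn -> R).
Proof.
move=> [P gM _ _]; split; first by apply: measurable_precise H _ _ _ _ P.
have mk : measurable_fun (dom S : set Tn) (discrete_mean u k : Tn -> R).
  exact: measurable_discrete_mean.
by apply: measurable_funS mk; [exact: dom_meas|move=> x []].
Qed.

Lemma datum_tail : exists2 W : R, (0 < W)%R & forall t M u g k, (0 <= M)%R -> datum t M u g ->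
  \int[nu]_(x in (good g : set Tn)) (`|precise u x - discrete_mean u k x| `^ q)%:E <=
  (W * M `^ q * th ^+ k)%:E.
Proof.
have [W W0 HW] := summable_jumps nu (dom_meas S) (q_gt0 H) th01.
exists (W * (C ^+ 4) `^ q * (A0 + 1))%R.
  by rewrite !mulr_gt0 ?powR_gt0 ?exprn_gt0 ?(dp_C H)// ltr_wpDl.
move=> t M u g k M0 Dt; have [P gM _ _] := Dt.
have jump j x : dom S x ->
    (`|discrete_mean u j.+1 x - discrete_mean u j x| <= C ^+ 4 * slope g j (idx S j x))%R.
  by move=> Sx; have := discrete_mean_le H P j Sx; rewrite mulr1.
have [_ _ /(_ k)] := HW (discrete_mean u) (fun j x => slope g j (idx S j x))
  (A0 * M `^ q)%R (C ^+ 4)%R (fun j => measurable_discrete_mean mu u j)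
  (fun j => measurable_slope mu p alpha g j)
  (fun j x => slope_ge0 mu p alpha S g j (idx S j x)) (mulr_ge0 A0_ge0 (powR_ge0 _ _)) C4_ge0
  jump (fun j => datum_slope_integral j M0 Dt).
move=> /le_trans; apply; rewrite lee_fin.
have [Mq0 thk] : (0 <= M `^ q)%R /\ (0 <= th ^+ k)%R.
  by split; [exact: powR_ge0|rewrite exprn_ge0//; case/andP: th01 => /ltW].
rewrite ler_wpM2r// -[leRHS]mulrA ler_wpM2l ?mulr_ge0 ?powR_ge0 ?(ltW W0)//.
by rewrite ler_wpM2r// lerDl.
Qed.

Lemma datum_in_Lp t M u g : (0 <= M)%R -> datum t M u g -> in_Lp nu E q (ubar mu u).
Proof.
move=> M0 Dt; have [P gM _ _] := Dt; have [W W0 HW] := datum_tail.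
have mg := measurable_good mu p alpha S g.
have gS : good g `<=` dom S by move=> x [].
have [mp _] := measurable_datum_tail 0 Dt.
have ug x : good g x -> ubar mu u x = (precise u x)%:E by exact: (ubar_precise H P).
have [mf nE] := norm_Lp_full mg gS (dom_good H S bK gM) mp ug.
split=> //; rewrite nE poweR_lty//.
apply: (@integral_fin_of_tail _ _ (fun i => mean mu (bal S 0 i : set Tm) u)) => //.
by apply: le_lt_trans (HW t M u g 0%N M0 Dt) _; rewrite ltry.
Qed.

(* The limits, along an ultrafilter, of the coefficients of the discrete means and of
   the slopes satisfy again the hypotheses of [summable_jumps], which yields the limit
   function. *)
Lemma datum_limit t M (u g : nat -> X -> R) (U : set_system nat) :
  (0 < M)%R -> UltraFilter U -> (forall n, datum t M (u n) (g n)) ->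
  exists (v : X -> R) (A : set X), [/\ measurable (A : set Tn) /\ A `<=` dom S,
    nu (dom S `\` A) = 0, measurable_fun (A : set Tn) (v : Tn -> R),
    \int[nu]_(x in (A : set Tn)) (`|v x| `^ q)%:E < +oo &
    forall e : R, (0 < e)%R -> U [set n |
      \int[nu]_(x in (good (g n) `&` A : set Tn))
        (`|precise (u n) x - v x| `^ q)%:E <= e%:E]].
Proof.
move=> M0 UU Dt; have PU : ProperFilter U by apply: ultra_proper.
have q0 := q_gt0 H; have mS := dom_meas S.
(* On a null cell the means need not be bounded in [n], hence the default 0. It is never seen:
   points of [dom S] belong to cells of positive measure. *)
pose F n k i : R := if 0 < nu (cell S k i) then mean mu (bal S k i : set Tm) (u n) else 0%R.
have /choice[f fP] : forall c : nat * nat, exists l : R, (fun n => F n c.1 c.2) @ U --> l.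
  move=> [k i].
  suff [b Fb] : exists b : R, forall n, (`|F n k i| <= b)%R.
    exact: (ultra_bounded_cvg UU Fb).
  rewrite /F; have [n0|_] := boolP (0 < nu (cell S k i)); last first.
    by exists 0%R => n; rewrite normr0.
  have [c c0 Hc] := mean_coef_bound H mE bK t n0.
  by exists (c * M)%R => n; exact: Hc (Dt n).
have /choice[h hP] : forall c : nat * nat, exists l : R,
    (fun n => slope (g n) c.1 c.2) @ U --> l.
  move=> [k i]; have [b b0 sb] := slope_bound k i.
  apply: (ultra_bounded_cvg (b := (b * M)%R) UU) => n /=.
  by rewrite ger0_norm ?slope_ge0//; exact: sb (ltW M0) (Dt n).
pose fx k x : R := f (k, idx S k x); pose hx k x : R := h (k, idx S k x).
have h0 c : (0 <= h c)%R.
  apply: (ler_cvg_to (cvg_cst 0%R : _ @ U --> _) (hP c)).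
  by apply: nearW => n; exact: slope_ge0.
have FE n k x : dom S x -> F n k (idx S k x) = discrete_mean (u n) k x.
  by move=> Sx; rewrite /F (idx_gt0 k Sx).
have jump k x : dom S x -> (`|fx k.+1 x - fx k x| <= C ^+ 4 * hx k x)%R.
  move=> Sx.
  have l1 : (fun n => `|F n k.+1 (idx S k.+1 x) - F n k (idx S k x)|%R) @ U -->
      `|fx k.+1 x - fx k x|%R.
    apply: cvg_norm; apply: cvgB; first exact: (fP (k.+1, idx S k.+1 x)).
    exact: (fP (k, idx S k x)).
  have l2 : (fun n => C ^+ 4 * slope (g n) k (idx S k x))%R @ U --> (C ^+ 4 * hx k x)%R.
    by apply: cvgM; [exact: cvg_cst|exact: (hP (k, idx S k x))].
  apply: (ler_cvg_to l1 l2); apply: nearW => n; rewrite !FE//.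
  by have [P _ _ _] := Dt n; have := discrete_mean_le H P k Sx; rewrite mulr1.
have mfx k : measurable_fun (dom S : set Tn) (fx k : Tn -> R).
  by apply: (@measurable_step _ Tn (dom S) _ _ (idx S k) (fun i => f (k, i))); exact: idx_meas.
have mhx k : measurable_fun (dom S : set Tn) (hx k : Tn -> R).
  by apply: (@measurable_step _ Tn (dom S) _ _ (idx S k) (fun i => h (k, i))); exact: idx_meas.
have step_int k (a : nat -> R) : \int[nu]_(x in (dom S : set Tn)) (a (idx S k x) `^ q)%:E =
    \sum_(0 <= i < card_net S k) (a i `^ q)%:E * nu (cell S k i).
  rewrite (@integral_step _ Tn _ nu (dom S) mS (idx S k) (card_net S k)
    (fun i => (a i `^ q)%:E))//.
  - exact: idx_meas.
  - by move=> x Sx; exact: idx_lt.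
  - by move=> i; rewrite lee_fin powR_ge0.
(* A scale has finitely many cells, so one [n] satisfies [h / 2 <= slope] on all of them at once.
   The integral bound for that datum passes to the limit up to the factor [2 ^ q]. *)
have hint k : \int[nu]_(x in (dom S : set Tn)) (hx k x `^ q)%:E <=
    (2 `^ q * (A0 * M `^ q) * (th ^+ k) ^+ 2)%:E.
  have [n hn] : exists n, forall i, (i < card_net S k)%N -> (h (k, i) / 2 <= slope (g n) k i)%R.
    apply: (@filter_ex _ U); apply: filter_bounded_forall => i.
    have [hi|hi] := leP (h (k, i)) 0%R.
      apply: filterE => n; apply: (@le_trans _ _ 0%R); last exact: slope_ge0.
      by rewrite pmulr_lle0.
    have hlt : (h (k, i) / 2 < h (k, i))%R by rewrite ltr_pdivrMr// ltr_pMr// ltr1n.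
    exact: (cvgr_ge _ (hP (k, i)) _ hlt).
  rewrite (step_int k (fun i => h (k, i))).
  apply: (@le_trans _ _ ((2 `^ q)%:E * \int[nu]_(x in (dom S : set Tn))
      (slope (g n) k (idx S k x) `^ q)%:E)); last first.
    rewrite -[X in (_ <= X%:E)]mulrA EFinM lee_wpmul2l ?lee_fin ?powR_ge0//.
    by apply: datum_slope_integral (Dt n); exact: ltW.
  rewrite (step_int k (slope (g n) k)) ge0_sume_distrr; last first.
    by move=> i _; rewrite mule_ge0// lee_fin powR_ge0.
  rewrite big_nat [leRHS]big_nat; apply: lee_sum => i /andP[_ ik].
  rewrite muleA lee_wpmul2r// -EFinM lee_fin -powRM ?slope_ge0//.
  by apply: powR_le; rewrite ?(ltW q0)// mulrC -ler_pdivrMr// hn.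
have B0 : (0 <= 2 `^ q * (A0 * M `^ q))%R by rewrite !mulr_ge0 ?powR_ge0.
have [W W0 HW] := summable_jumps nu mS q0 th01.
have [full mv tail] := HW fx hx _ _ mfx mhx (fun j x => h0 (j, idx S j x)) B0 C4_ge0 jump hint.
have [W' W'0 HW'] := datum_tail.
set A := @summable_set _ Tn R (dom S) hx in full mv tail *.
set v := fun x : X => limn (fx ^~ x) in mv tail *.
have mA : measurable (A : set Tn).
  by apply: measurable_summable_set => // j x; exact: h0.
have AS : A `<=` dom S by move=> x [].
exists v, A; split=> //.
  apply: (@integral_fin_of_tail _ _ (fun i => f (0%N, i))) => //.
  by apply: le_lt_trans (tail 0%N) _; rewrite ltry.
move=> e e0.
have q3 : (0 < 3 `^ q :> R)%R by rewrite powR_gt0.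
(* The distance splits into two tails and a difference of step functions; with the factor [3 ^ q] of
   [integral_add3_le] each may cost [e1]. *)
set e1 := (e / 3 `^ q / 3)%R; have e10 : (0 < e1)%R by rewrite !divr_gt0.
set V := fine (nu (dom S)).
have VE : nu (dom S) = V%:E by rewrite fineK// ge0_fin_numE// (nu_dom_fin H).
have V0 : (0 <= V)%R by exact: fine_ge0.
have [k [k1 k2]] : exists k, (W' * M `^ q * th ^+ k <= e1)%R /\
    (W * (C ^+ 4) `^ q * (2 `^ q * (A0 * M `^ q)) * th ^+ k <= e1)%R.
  have small c : (0 <= c)%R -> \forall k \near \oo, (c * th ^+ k <= e1)%R.
    move=> c0; have : geometric c th @ \oo --> 0%R.
      by apply: cvg_geometric; case/andP: th01 => th0 th1; rewrite ger0_norm// ltW.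
    move=> /cvgrPdist_le /(_ _ e10); apply: filterS => k.
    rewrite sub0r normrN ger0_norm//= mulr_ge0// exprn_ge0//.
    by case/andP: th01 => /ltW.
  apply: (@filter_ex _ (\oo : set_system nat)); apply: filterI; apply: small.
    by rewrite mulr_ge0 ?powR_ge0// ltW.
  by rewrite mulr_ge0// mulr_ge0 ?powR_ge0// ltW.
set eta := ((e1 / (V + 1)) `^ q^-1)%R.
have V1 : (0 < V + 1)%R by rewrite ltr_wpDl.
have eta0 : (0 < eta)%R by rewrite powR_gt0// divr_gt0.
(* Here total boundedness produces compactness: at the fixed scale [k] finitely many coefficients
   converge, hence uniformly along the ultrafilter. *)
have close : U [set n | forall i, (i < card_net S k)%N -> (`|F n k i - f (k, i)| <= eta)%R].
  apply: filter_bounded_forall => i.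
  have /cvgrPdist_le /(_ _ eta0) := fP (k, i).
  by apply: filterS => n; rewrite distrC.
apply: filterS close => n hn /=.
have mgn := measurable_good mu p alpha S (g n).
have mGA : measurable (good (g n) `&` A : set Tn) by exact: measurableI.
have [mp mk] := measurable_datum_tail k (Dt n).
have GAS : good (g n) `&` A `<=` dom S by move=> x [[]].
have sub1 (r : X -> R) : measurable_fun (good (g n) : set Tn) (r : Tn -> R) ->
    measurable_fun (good (g n) `&` A : set Tn) (r : Tn -> R).
  by move=> mr; apply: measurable_funS mr => // x [].
have sub2 (r : X -> R) : measurable_fun (A : set Tn) (r : Tn -> R) ->
    measurable_fun (good (g n) `&` A : set Tn) (r : Tn -> R).
  by move=> mr; apply: measurable_funS mr => // x [].
have mfk : measurable_fun (A : set Tn) (fx k : Tn -> R).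
  by apply: measurable_funS (mfx k).
pose a x := (precise (u n) x - discrete_mean (u n) k x)%R.
pose b x := (discrete_mean (u n) k x - fx k x)%R.
pose c x := (v x - fx k x)%R.
have ma : measurable_fun (good (g n) : set Tn) (a : Tn -> R) by exact: measurable_funB.
have mc : measurable_fun (A : set Tn) (c : Tn -> R) by exact: measurable_funB.
have mdm : measurable_fun (dom S : set Tn) (discrete_mean (u n) k : Tn -> R).
  exact: measurable_discrete_mean.
have mb : measurable_fun (dom S : set Tn) (b : Tn -> R) by exact: measurable_funB.
have mbGA : measurable_fun (good (g n) `&` A : set Tn) (b : Tn -> R).
  by apply: measurable_funS mb.
have mr : measurable_fun (good (g n) `&` A : set Tn)
    ((fun x => precise (u n) x - v x)%R : Tn -> R).
  by apply: measurable_funB; [exact: sub1|exact: sub2].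
have tri x : (good (g n) `&` A) x ->
    (`|precise (u n) x - v x| <= `|a x| + `|b x| + `|c x|)%R.
  move=> _; rewrite /a /b /c (distrC (v x) (fx k x)).
  move: (precise _ _) (discrete_mean _ _ _) (fx k x) (v x) => y z w s.
  have -> : (y - s = (y - z) + (z - w) + (w - s))%R by lra.
  by rewrite (le_trans (ler_normD _ _))// lerD2r ler_normD.
have := integral_add3_le mGA mr (sub1 _ ma) mbGA (sub2 _ mc) tri.
move=> /le_trans; apply.
have Ia : \int[nu]_(x in (good (g n) `&` A : set Tn)) (`|a x| `^ q)%:E <= e1%:E.
  apply: (@le_trans _ _ (\int[nu]_(x in (good (g n) : set Tn)) (`|a x| `^ q)%:E)).
    by apply: ge0_subset_integral => //; exact: measurable_powR_norm.
  apply: (le_trans (HW' t M (u n) (g n) k (ltW M0) (Dt n))).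
  by rewrite lee_fin.
have Ic : \int[nu]_(x in (good (g n) `&` A : set Tn)) (`|c x| `^ q)%:E <= e1%:E.
  apply: (@le_trans _ _ (\int[nu]_(x in (A : set Tn)) (`|c x| `^ q)%:E)).
    by apply: ge0_subset_integral => //; exact: measurable_powR_norm.
  by apply: (le_trans (tail k)); rewrite lee_fin.
have Ib : \int[nu]_(x in (good (g n) `&` A : set Tn)) (`|b x| `^ q)%:E <= e1%:E.
  apply: (@le_trans _ _ (\int[nu]_(x in (dom S : set Tn)) (cst (e1 / (V + 1))%:E x))).
    apply: (@le_trans _ _ (\int[nu]_(x in (dom S : set Tn)) (`|b x| `^ q)%:E)).
      apply: ge0_subset_integral => //; exact: measurable_powR_norm.
    apply: ge0_le_integral => //.
    - exact: measurable_powR_norm.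
    - have e1V : (0 <= e1 / (V + 1))%R := divr_ge0 (ltW e10) (ltW V1).
      move=> x Sx; rewrite lee_fin -[leRHS](powRVK (lt0r_neq0 q0) e1V).
      apply: powR_le; rewrite ?(ltW q0)// /b -FE//.
      exact: hn (idx_lt k Sx).
  rewrite (@integral_cst _ Tn R nu _ mS) VE -EFinM lee_fin mulrAC ler_pdivrMr//.
  by rewrite ler_wpM2l ?(ltW e10)// lerDl.
apply: (@le_trans _ _ ((3 `^ q)%:E * (e1%:E + e1%:E + e1%:E))).
  apply: lee_wpmul2l; first by rewrite lee_fin ltW.
  by apply: leeD Ic; exact: leeD Ia Ib.
rewrite -!EFinD -EFinM lee_fin.
have -> : (e1 + e1 + e1 = e / 3 `^ q)%R by rewrite /e1; move: (e / 3 `^ q)%R => z; lra.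
by rewrite mulrC divfK// gt_eqF.
Qed.

Lemma datum_compact t M (u g : nat -> X -> R) : (0 < M)%R ->
  (forall n, datum t M (u n) (g n)) ->
  exists phi : nat -> nat, exists v : X -> R,
      [/\ {homo phi : m n / (m < n)%N}, in_Lp nu E q (EFin \o v) &
          (fun n => norm_Lp nu E q
             (fun x => ubar mu (u (phi n)) x - (v x)%:E)) @ \oo --> 0].
Proof.
move=> M0 Dt; have q0 := q_gt0 H; have mS := dom_meas S.
(* The ultrafilter refines the filter at infinity, so each of its sets contains arbitrarily large
   indices and a strictly increasing [phi] can be chosen. *)
have [U [UU UF]] := ultraFilterLemma (F := \oo : set_system nat) _.
have [v [A [[mA AS] A0' mv vfin close]]] := datum_limit M0 UU Dt.
have [mvE nvE] := norm_Lp_full mA AS A0' mv (fun x _ => erefl : (EFin \o v) x = (v x)%:E).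
have dist n : norm_Lp nu E q (fun x => ubar mu (u n) x - (v x)%:E) =
    (\int[nu]_(x in (good (g n) `&` A : set Tn)) (`|precise (u n) x - v x| `^ q)%:E) `^ q^-1.
  have [P gM _ _] := Dt n; have mgn := measurable_good mu p alpha S (g n).
  have [mp _] := measurable_datum_tail 0 (Dt n).
  apply: (norm_Lp_full _ _ _ _ _).2.
  - exact: measurableI.
  - by move=> x [[]].
  - apply/eqP; rewrite eq_le measure_ge0 andbT.
    apply: (@le_trans _ _ (nu ((dom S `\` good (g n)) `|` (dom S `\` A)))).
      apply: le_measure; rewrite ?inE.
      + by apply: measurableD => //; exact: measurableI.
      + by apply: measurableU; exact: measurableD.
      + by move=> x [Sx /not_andP[ngx|nAx]]; [left|right].
    apply: (@le_trans _ _ (nu (dom S `\` good (g n)) + nu (dom S `\` A))).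
      by apply: measureU2; exact: measurableD.
    by rewrite (dom_good H S bK gM) A0' add0e.
  - apply: measurable_funB.
      by apply: measurable_funS mp => // x [].
    by apply: measurable_funS mv => // x [].
  - by move=> x [gx _]; rewrite (ubar_precise H P gx).
have Pex (j m : nat) : exists2 n, (m < n)%N &
    norm_Lp nu E q (fun x => ubar mu (u n) x - (v x)%:E) <= (j.+1%:R^-1)%:E.
  have j0 : (0 < j.+1%:R^-1 :> R)%R by rewrite invr_gt0.
  have e0 : (0 < j.+1%:R^-1 `^ q :> R)%R by rewrite powR_gt0.
  have Um : U [set n | (m < n)%N] by apply: UF; exists m.+1.
  have PU : ProperFilter U by apply: ultra_proper.
  have [n [/= dn mn]] := filter_ex (filterI (close _ e0) Um).
  exists n => //; rewrite dist.
  have -> : (j.+1%:R^-1)%:E = (j.+1%:R^-1 `^ q)%:E `^ q^-1 :> \bar R.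
    by rewrite poweR_EFin powRK ?gt_eqF// ltW.
  apply: poweR_le => //; first by rewrite invr_ge0 ltW.
  by apply: integral_ge0 => x _; rewrite lee_fin powR_ge0.
have [phi phi_incr phiP] := increasing_choice Pex.
exists phi, v; split=> //; first by split=> //; rewrite nvE poweR_lty.
apply: (@squeeze_cvge _ _ _ _ (cst 0) _ (EFin \o harmonic)).
- apply: nearW => n; rewrite phiP andbT; exact: Lnorm_ge0.
- exact: cvg_cst.
- by apply: cvg_EFin; [exact: nearW|exact: cvg_harmonic].
Qed.

End compactness.

(** * Truncation *)

Section truncation.
Context {R : realType} {X : pointedMetricType R}.
Variables (mu nu : complete_borel_measure X) (E : set X).
Variables (p q alpha lambda r0 C delta : R).
Local Notation Tm := (g_sigma_algebraType (cb_sets mu)).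
Local Notation Tn := (g_sigma_algebraType (cb_sets nu)).
Hypothesis H : doubling_pair mu nu E p q alpha lambda r0 C delta.
Variable S : net nu E (scale lambda r0).
Hypothesis mE : measurable (E : set Tn).
Local Notation slope := (slope mu p alpha S).
Local Notation slope_sum g k x := (\sum_(k <= j <oo) (slope g j (idx S j x))%:E).
Local Notation good := (good mu p alpha S).
Local Notation precise := (precise mu S).
Local Notation discrete_mean := (discrete_mean mu S).
Local Notation datum := (datum mu nu E p alpha lambda r0).
Variables (K eps : R) (bK : balanced mu nu E p q alpha r0 K eps).

(** The operation of [trunc] on values, so that it also applies to [precise u x]. *)
Definition truncate (l k y : R) : R := Num.max l (Num.min y k).

Lemma truncate_lip l k y z : (l <= k)%R ->
  (`|truncate l k y - truncate l k z| <= `|y - z|)%R.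
Proof.
move=> lk; have h1 := ler_norm (y - z)%R; have := ler_norm (z - y)%R; rewrite distrC => h2.
rewrite ler_norml /truncate; move: `|y - z|%R h1 h2 => n h1 h2.
case: (leP y k) => yk; case: (leP z k) => zk;
  case: (leP l y) => ly; case: (leP l z) => lz; try case: (leP l k) => lk';
  apply/andP; split; lra.
Qed.

Lemma truncate_le l k y : (0 <= l < k)%R -> (truncate l k y <= l + `|y|)%R.
Proof.
move=> /andP[l0 lk]; have yn := ler_norm y; have := normr_ge0 y.
rewrite /truncate; move: `|y|%R yn => n yn n0.
case: (leP y k) => yk; last by rewrite (max_idPr (ltW lk)); lra.
by case: (leP l y) => ly; lra.
Qed.

Lemma truncate_ge l k y : (l < k <= 0)%R -> (k - `|y| <= truncate l k y)%R.
Proof.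
move=> /andP[lk k0]; have := ler_norm (- y)%R; rewrite normrN => yn; have := normr_ge0 y.
rewrite /truncate; move: `|y|%R yn => n yn n0.
case: (leP y k) => yk; last by rewrite (max_idPr (ltW lk)); lra.
by case: (leP l y) => ly; lra.
Qed.

Definition trunc_gradient (u g : X -> R) (l k : R) : X -> R :=
  fun y => (g y * \1_[set z | (l < u z < k)%R] y)%R.

Definition truncation_bound (Ct : R) (u g : X -> R) : Prop :=
  forall l k : R, (l < k)%R -> forall x r, E x -> (0 < r <= r0)%R ->
    mean_osc mu (ball x r) (trunc l k u) <=
      (Ct * diam (ball x r) `^ alpha)%:E *
      avg_Lp mu p (ball x (lambda * r)) (trunc_gradient u g l k).

Lemma measurable_strip (u : X -> R) l k : measurable_fun setT (u : Tm -> R) ->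
  measurable ([set z | (l < u z < k)%R] : set Tm).
Proof.
move=> mu_; rewrite (_ : [set z | _] = setT `&` u @^-1` [set` `]l, k[]).
  exact: (mu_ measurableT _ (measurable_itv `]l, k[)).
by rewrite setTI; apply/seteqP; split => z /=; rewrite in_itv.
Qed.

Lemma trunc_gradient_powR (u g : X -> R) l k y : (0 < p)%R -> (0 <= g y)%R ->
  (trunc_gradient u g l k y `^ p = g y `^ p * \1_[set z | (l < u z < k)%R] y)%R.
Proof.
move=> p0 g0; rewrite /trunc_gradient powRM// indicE.
by case: (y \in _); rewrite ?powR1 ?powR0 ?gt_eqF.
Qed.

Lemma trunc_admissible (u g : X -> R) (M l k : R) : measurable_fun setT (u : Tm -> R) ->
  admissible_gradient mu p g M ->
  let Gk := fine (\int[mu]_(x in ([set z | (l < u z < k)%R] : set Tm)) (g x `^ p)%:E) in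
  admissible_gradient mu p (trunc_gradient u g l k) Gk /\
  \int[mu]_(x in ([set z | (l < u z < k)%R] : set Tm)) (g x `^ p)%:E = Gk%:E.
Proof.
move=> mu_ gM Gk; have [g0 mg M0 gle] := gM; have p0 := p_gt0 H.
have mstrip := measurable_strip l k mu_.
have I0 : 0 <= \int[mu]_(x in ([set z | (l < u z < k)%R] : set Tm)) (g x `^ p)%:E.
  by apply: integral_ge0 => x _; rewrite lee_fin powR_ge0.
have IE : \int[mu]_(x in ([set z | (l < u z < k)%R] : set Tm)) (g x `^ p)%:E = Gk%:E.
  rewrite fineK// ge0_fin_numE//; apply: le_lt_trans (admissible_fin gM).
  apply: ge0_subset_integral => //; first exact: measurable_powRp.
  by move=> x _; rewrite lee_fin powR_ge0.
split=> //; split.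
- by move=> x; rewrite mulr_ge0.
- by apply: measurable_funM => //; exact: measurable_indic.
- exact: fine_ge0.
rewrite -IE [leRHS]integral_mkcond le_eqVlt; apply/orP; left; apply/eqP.
apply: eq_integral => x _; rewrite trunc_gradient_powR// patchE indicE.
by case: (x \in _); rewrite ?mulr1 ?mulr0.
Qed.

(** A truncation is bounded, hence integrable on the balls in use, and [diam (ball x r) <= 2 * r]
    brings the truncation property to the form of a Poincare inequality. *)
Lemma trunc_pair Ct t M u g l k : (0 < Ct)%R -> datum t M u g ->
  truncation_bound Ct u g -> (l < k)%R ->
  poincare_pair mu E p alpha lambda r0 (Ct * 2 `^ alpha) (trunc l k u) (trunc_gradient u g l k).
Proof.
move=> Ct0 [P gM iu _] Tb lk; have mu_ := L1loc_measurable iu.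
have [[tg0 mtg _ tgle] _] := trunc_admissible l k mu_ gM.
have mt : measurable_fun setT (trunc l k u : Tm -> R).
  apply: measurable_maxr => //; exact: measurable_minr.
split=> //.
- by rewrite mulr_ge0 ?powR_ge0// ltW.
- move=> x r Ex rr; have [_ boo] := mu_bounds H Ex rr.
  have mb : measurable (ball x r : set Tm) by exact: measurable_mball.
  have ic : mu.-integrable (ball x r : set Tm) (EFin \o cst (`|l| + `|k|)%R : Tm -> _).
    exact: integrable_cst.
  apply: le_integrable ic => //.
    by apply/measurable_EFinP; exact: measurable_funTS mt.
  move=> y _; rewrite /= lee_fin [leRHS]ger0_norm ?addr_ge0//.
  have := ler_norm l; have := ler_norm (- l)%R; have := ler_norm k.
  have := ler_norm (- k)%R; rewrite !normrN ler_norml /trunc => h1 h2 h3 h4.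
  by case: (leP (u y) k) => uk; [case: (leP l (u y)) => lu|case: (leP l k) => lk'];
    apply/andP; split; lra.
- by apply: le_lt_trans tgle _; rewrite ltry.
move=> x r Ex rr; apply: (le_trans (Tb l k lk x r Ex rr)).
apply: lee_wpmul2r; first exact: poweR_ge0.
have r_gt0 : (0 < r)%R by case/andP: rr.
rewrite lee_fin -mulrA ler_wpM2l ?(ltW Ct0)// -powRM ?(ltW r_gt0)//.
apply: powR_le; [exact: ltW (dp_alpha H)|exact: diam_ball_ge0|exact: diam_ball_le].
Qed.

(** The exceptional set must not depend on the levels, so the point is good for [g] itself. There
    the mean of [|u - precise u x|] over the chain tends to 0. As truncation is 1-Lipschitz, the
    means of the truncated function tend to the truncated value, and they telescope with the slopes
    of the truncated gradient. *)
Lemma trunc_precise_le Ct t M u g l k x : (0 < Ct)%R -> datum t M u g ->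
  truncation_bound Ct u g -> (l < k)%R -> good g x ->
  `|truncate l k (precise u x) - discrete_mean (trunc l k u) 0 x|%:E <=
  (C ^+ 4 * (Ct * 2 `^ alpha))%:E * slope_sum (trunc_gradient u g l k) 0 x.
Proof.
move=> Ct0 Dt Tb lk gx; have [P gM iu _] := Dt; have [Sx goo] := gx.
have Pt := trunc_pair Ct0 Dt Tb lk.
set D := (C ^+ 4 * _)%R.
have D0 : (0 <= D)%R.
  by rewrite mulr_ge0 ?exprn_ge0 ?(ltW (dp_C H))// mulr_ge0 ?powR_ge0// ltW.
set w := trunc l k u in Pt *; set gk := trunc_gradient u g l k in Pt *.
have close j : (`|discrete_mean w j x - truncate l k (precise u x)| <=
    slope g j (idx S j x) + `|discrete_mean u j x - precise u x|)%R.
  have [b0 boo] := mu_bal H S j (idx S j x); have br := bal_radius H j.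
  have mb : measurable (bal S j (idx S j x) : set Tm) by exact: measurable_mball.
  have iw := pp_int Pt (node_in S j (idx S j x)) br.
  have iu' := pp_int P (node_in S j (idx S j x)) br.
  apply: le_trans (le_norm_meanB mb b0 boo (truncate l k (precise u x)) iw) _.
  apply: (@le_trans _ _ (mean mu (bal S j (idx S j x) : set Tm)
      (fun y => `|u y - precise u x|%R))).
    apply: le_mean => //; [exact: integrable_shift|exact: integrable_shift|].
    by move=> y _; apply: truncate_lip; exact: ltW.
  apply: le_trans (mean_shift_le mb b0 boo (precise u x) iu') _.
  by rewrite lerD2r; have := osc_slope H S j (idx S j x) P; rewrite mul1r.
have cw : (fun j => discrete_mean w j x) @ \oo --> truncate l k (precise u x).
  have c1 := slope_cvg0 gx; have c2 := precise_cvg H P gx.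
  have c3 : (fun j => slope g j (idx S j x) + `|discrete_mean u j x - precise u x|)%R
      @ \oo --> 0%R.
    rewrite -[0%R](addr0 0%R); apply: cvgD => //.
    rewrite -(@normr0 _ R) -(subrr (precise u x)).
    by apply: cvg_norm; apply: cvgB => //; exact: cvg_cst.
  apply/cvgrPdist_le => e e0; move/cvgrPdist_le: c3 => /(_ e e0); apply: filterS => j.
  rewrite sub0r normrN ger0_norm ?addr_ge0 ?slope_ge0// => h.
  by rewrite distrC; exact: le_trans (close j) h.
have cn : (fun j => `|discrete_mean w j x - discrete_mean w 0 x|%:E) @ \oo -->
    `|truncate l k (precise u x) - discrete_mean w 0 x|%:E.
  apply: cvg_EFin; first exact: nearW.
  by apply: cvg_norm; apply: cvgB => //; exact: cvg_cst.
rewrite -(cvg_lim _ cn)//; apply: lime_le; first by apply/cvg_ex; eexists; exact: cn.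
apply: nearW => j.
apply: (telescope_le (f := fun i => discrete_mean w i x) (h := fun i => slope gk i (idx S i x))
  D0 _ _ (leq0n j)).
  by move=> i; exact: slope_ge0.
by move=> i; exact: (discrete_mean_le H Pt).
Qed.

(** The mean is that of [|u|] since it has to bound the coarse means of all truncations of [u] at
    once. *)
Lemma coarse_mean_bound t : exists2 a : R, (0 < a)%R & forall M u g x, (0 < M)%R ->
  datum t M u g -> dom S x ->
  (mean mu (bal S 0 (idx S 0 x) : set Tm) (fun y => `|u y|) <= a * M)%R.
Proof.
have bnd i : exists a : R, (0 <= a)%R /\ (0 < nu (cell S 0 i) -> forall M u g, (0 < M)%R ->
    datum t M u g -> (mean mu (bal S 0 i : set Tm) (fun y => `|u y|) <= a * M)%R).
  have [n0|_] := boolP (0 < nu (cell S 0 i)); last by exists 0%R.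
  have [c c0 Hc] := mean_coef_bound H mE bK t n0.
  have [b b0 Hb] := slope_bound H S bK 0 i.
  exists (b + c)%R; split; first by rewrite addr_ge0// ltW.
  move=> _ M u g M0 Dt; have [P _ _ _] := Dt.
  have [m0 moo] := mu_bal H S 0 i; have mb : measurable (bal S 0 i : set Tm).
    exact: measurable_mball.
  have iu := pp_int P (node_in S 0 i) (bal_radius H 0).
  apply: le_trans (norm_mean_le mb m0 moo iu) _.
  rewrite mulrDl lerD ?(Hc _ _ _ M0 Dt)//.
  apply: le_trans (Hb _ _ _ _ (ltW M0) Dt).
  by have := osc_slope H S 0 i P; rewrite mul1r.
have /choice[a aP] := bnd.
(* The sum over the finitely many cells dominates each constant; the [+ 1] makes it positive. *)
exists (\sum_(0 <= i < card_net S 0) a i + 1)%R.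
  by rewrite ltr_wpDl// sumr_ge0// => i _; exact: (aP i).1.
move=> M u g x M0 Dt Sx.
apply: le_trans ((aP _).2 (idx_gt0 0 Sx) M u g M0 Dt) _.
rewrite ler_wpM2r ?(ltW M0)//.
rewrite (bigD1_seq (idx S 0 x))/= ?iota_uniq ?mem_index_iota ?(idx_lt 0 Sx)//.
rewrite -addrA lerDl addr_ge0// sumr_ge0// => i _; exact: (aP i).1.
Qed.

End truncation.

(** * Maz'ya's truncation method *)

Section mazya.
Context {R : realType} {X : pointedMetricType R}.
Variables (mu nu : complete_borel_measure X) (E : set X).
Variables (p q alpha lambda r0 C delta : R).
Local Notation Tm := (g_sigma_algebraType (cb_sets mu)).
Local Notation Tn := (g_sigma_algebraType (cb_sets nu)).
Hypothesis H : doubling_pair mu nu E p q alpha lambda r0 C delta.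
Variable S : net nu E (scale lambda r0).
Hypothesis mE : measurable (E : set Tn).
Local Notation slope := (slope mu p alpha S).
Local Notation slope_sum g k x := (\sum_(k <= j <oo) (slope g j (idx S j x))%:E).
Local Notation good := (good mu p alpha S).
Local Notation precise := (precise mu S).
Local Notation discrete_mean := (discrete_mean mu S).
Local Notation datum := (datum mu nu E p alpha lambda r0).
Local Notation truncation_bound := (truncation_bound mu E p alpha lambda r0).
Variables (K eps : R) (bK : balanced mu nu E p q alpha r0 K eps).

Definition strip_energy (u g : X -> R) (l k : R) : R :=
  fine (\int[mu]_(x in ([set z | (l < u z < k)%R] : set Tm)) (g x `^ p)%:E).

Lemma strip_energy_ge0 u g l k : (0 <= strip_energy u g l k)%R.
Proof. by apply: fine_ge0; apply: integral_ge0 => x _; rewrite lee_fin powR_ge0. Qed.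

Lemma strip_energy_sum_le (u g : X -> R) (G : R) (l k : nat -> R) n :
  measurable_fun setT (u : Tm -> R) -> admissible_gradient mu p g G ->
  (forall i j z, (l i < u z < k i)%R -> (l j < u z < k j)%R -> i = j) ->
  (\sum_(0 <= i < n) strip_energy u g (l i) (k i) <= G)%R.
Proof.
move=> mu_ gG disj; have [_ mg _ gle] := gG.
rewrite -lee_fin -sumEFin; apply: le_trans gle.
pose F i := [set z | (l i < u z < k i)%R].
have mF i : measurable (F i : set Tm) by exact: measurable_strip.
rewrite (eq_bigr (fun i => \int[mu]_(x in (F i : set Tm)) (g x `^ p)%:E)); last first.
  by move=> i _; rewrite (trunc_admissible H (l i) (k i) mu_ gG).2.
rewrite -(@ge0_integral_bigsetU _ Tm _ mu _ F)//.
- apply: ge0_subset_integral => //.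
  + by apply: bigsetU_measurable => i _.
  + exact: measurable_powRp.
  + by move=> x _; rewrite lee_fin powR_ge0.
- exact: iota_uniq.
- by move=> i j _ _ [z [zi zj]]; exact: (disj _ _ _ zi zj).
- by apply: measurable_funTS; exact: measurable_powRp.
- by move=> x _; rewrite lee_fin powR_ge0.
Qed.

(** If [precise u x > 2 T], truncation at [T] and [2 T] takes the value [2 T] at [x], while its
    coarse mean is at most [T + a M <= 3 T / 2]. The gap [T / 2] forces a large slope sum for the
    gradient restricted to the strip, and the weak-type estimate then involves the energy of that
    strip only. Values below [- 2 T] use the mirrored strip. *)
Lemma level_set_le t Ct : (0 < Ct)%R -> exists2 a : R, (0 < a)%R & exists2 W : R, (0 < W)%R &
  forall M u g (T : R), (0 < M)%R -> datum t M u g -> truncation_bound Ct u g ->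
  (2 * (a * M) <= T)%R ->
  nu (good g `&` [set x | (2 * T < `|precise u x|)%R]) <=
  (W * T^-1 `^ q * (strip_energy u g T (2 * T) `^ (q / p) +
     strip_energy u g (- (2 * T)) (- T) `^ (q / p)))%:E.
Proof.
move=> Ct0; have q0 := q_gt0 H; have p0 := p_gt0 H.
have [a a0 Ha] := coarse_mean_bound H S mE bK t.
have [W W0 HW] := slope_weak_le H S bK.
set D := (C ^+ 4 * (Ct * 2 `^ alpha))%R.
have D0 : (0 < D)%R by rewrite mulr_gt0 ?exprn_gt0 ?(dp_C H)// mulr_gt0// powR_gt0.
exists a => //; exists (W * (4 * D) `^ q)%R; first by rewrite mulr_gt0// powR_gt0// pmulr_lgt0.
move=> M u g T M0 Dt Tb aT; have [P gM iu _] := Dt; have mu_ := L1loc_measurable iu.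
have T0 : (0 < T)%R by apply: lt_le_trans aT; rewrite mulr_gt0// mulr_gt0.
(* The gap [T / 2] gives a slope sum of at least [T / (2 D)]; halving once more yields the strict
   inequality in the level set. *)
have t0 : (0 < T / (4 * D))%R by rewrite divr_gt0// mulr_gt0.
have mgood := measurable_good mu p alpha S g.
have mprec : measurable_fun (good g : set Tn) (precise u : Tn -> R).
  by apply: measurable_precise H _ _ _ _ P.
pose B (h : X -> R) := [set x | dom S x /\ (T / (4 * D))%:E < slope_sum h 0 x].
have mB h : measurable (B h : set Tn) by exact: measurable_slope_gt.
pose gp := trunc_gradient u g T (2 * T); pose gn := trunc_gradient u g (- (2 * T)) (- T).
have weak l k : nu (B (trunc_gradient u g l k)) <=
    (W * (4 * D) `^ q * T^-1 `^ q * strip_energy u g l k `^ (q / p))%:E.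
  have [adm _] := trunc_admissible H l k mu_ gM.
  apply: le_trans (HW _ _ _ adm t0) _; rewrite lee_fin -/(strip_energy u g l k).
  have s0 := strip_energy_ge0 u g l k.
  have D4 : (0 <= 4 * D)%R by rewrite mulr_ge0// ltW.
  have TV : (0 <= T^-1)%R by rewrite invr_ge0 ltW.
  have -> : (strip_energy u g l k `^ p^-1 / (T / (4 * D)) =
      4 * D * T^-1 * strip_energy u g l k `^ p^-1)%R by rewrite invf_div mulrC.
  rewrite (powRM _ (mulr_ge0 D4 TV) (powR_ge0 _ _)) (powRM _ D4 TV) -powRrM.
  by rewrite [(p^-1 * q)%R]mulrC !mulrA.
have lvl l k x : (l < k)%R -> good g x ->
    (T / 2 <= `|truncate l k (precise u x) - discrete_mean (trunc l k u) 0 x|)%R ->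
    B (trunc_gradient u g l k) x.
  move=> lk gx far; have := trunc_precise_le H Ct0 Dt Tb lk gx; rewrite -/D => h.
  split; first by case: gx.
  have : (T / 2)%:E <= D%:E * slope_sum (trunc_gradient u g l k) 0 x.
    by apply: le_trans h; rewrite lee_fin.
  rewrite -lee_pdivrMl// -EFinM; apply: lt_le_trans; rewrite lte_fin.
  rewrite invfM [(D^-1 * _)%R]mulrC mulrA ltr_pM2r ?invr_gt0//.
  by move: T0; lra.
have mean_le l k x : good g x -> forall c, (forall y, trunc l k u y <= c + `|u y|)%R ->
    (l < k)%R -> (discrete_mean (trunc l k u) 0 x <= c + a * M)%R.
  move=> gx c ub lk.
  have [b0 boo] := mu_bal H S 0 (idx S 0 x); have br := bal_radius H 0.
  have mb : measurable (bal S 0 (idx S 0 x) : set Tm) by exact: measurable_mball.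
  have iw := pp_int (trunc_pair H Ct0 Dt Tb lk) (node_in S 0 (idx S 0 x)) br.
  have iu' := pp_int P (node_in S 0 (idx S 0 x)) br.
  have ia : mu.-integrable (bal S 0 (idx S 0 x) : set Tm) (EFin \o (fun y => `|u y|)%R : Tm -> _).
    exact: integrable_abse iu'.
  have := meanB mb b0 boo c iw; rewrite -/(discrete_mean (trunc l k u) 0 x) => mBE.
  rewrite addrC -lerBlDr -mBE; apply: le_trans (Ha M u g x M0 Dt _); last by case: gx.
  apply: le_mean => //; first exact: integrable_subc.
  by move=> y _; rewrite lerBlDl ub.
have mean_ge l k x : good g x -> forall c, (forall y, c - `|u y| <= trunc l k u y)%R ->
    (l < k)%R -> (c - a * M <= discrete_mean (trunc l k u) 0 x)%R.
  move=> gx c ub lk.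
  have [b0 boo] := mu_bal H S 0 (idx S 0 x); have br := bal_radius H 0.
  have mb : measurable (bal S 0 (idx S 0 x) : set Tm) by exact: measurable_mball.
  have iw := pp_int (trunc_pair H Ct0 Dt Tb lk) (node_in S 0 (idx S 0 x)) br.
  have iu' := pp_int P (node_in S 0 (idx S 0 x)) br.
  have ia : mu.-integrable (bal S 0 (idx S 0 x) : set Tm) (EFin \o (fun y => `|u y|)%R : Tm -> _).
    exact: integrable_abse iu'.
  have h1 := le_norm_meanB mb b0 boo c iw.
  have : (mean mu (bal S 0 (idx S 0 x) : set Tm) (fun y => c - trunc l k u y) <= a * M)%R.
    apply: le_trans (Ha M u g x M0 Dt _); last by case: gx.
    apply: le_mean => //; last by move=> y _; rewrite lerBlDr -lerBlDl ub.
    have := integrableB mb (integrable_cst c mb boo) iw.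
    by apply: eq_integrable.
  rewrite /mean RintegralB//; last exact: integrable_cst.
  rewrite mulrBr -/(mean mu _ (cst c)) mean_cst// -/(mean mu _ (trunc l k u)).
  by rewrite -/(discrete_mean (trunc l k u) 0 x); lra.
apply: (@le_trans _ _ (nu (B gp `|` B gn))).
  apply: le_measure; rewrite ?inE; last 2 first.
  - exact: measurableU.
  - move=> x [gx /= big].
    have [Lp|Ln] := leP 0%R (precise u x).
      left; rewrite ger0_norm// in big.
      have lk : (T < 2 * T)%R by lra.
      apply: lvl => //.
      have h : (discrete_mean (trunc T (2 * T) u) 0 x <= T + a * M)%R.
        by apply: mean_le => // y; apply: truncate_le; rewrite (ltW T0).
      have -> : truncate T (2 * T) (precise u x) = (2 * T)%R.
        by rewrite /truncate (min_idPr (ltW big)) (max_idPr (ltW lk)).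
      by apply: le_trans (ler_norm _); lra.
    right; rewrite ltr0_norm// in big.
    have lk : (- (2 * T) < - T)%R by lra.
    apply: lvl => //.
    have h : (- T - a * M <= discrete_mean (trunc (- (2 * T)) (- T) u) 0 x)%R.
      by apply: mean_ge => // y; apply: truncate_ge; rewrite lk oppr_le0 ltW.
    have -> : truncate (- (2 * T)) (- T) (precise u x) = (- (2 * T))%R.
      rewrite /truncate (min_idPl _); last by lra.
      by apply/max_idPl; lra.
    by rewrite distrC; apply: le_trans (ler_norm _); lra.
  rewrite (_ : _ `&` _ = (good g `&` precise u @^-1` [set` `]2 * T, +oo[%R]) `|`
      (good g `&` precise u @^-1` [set` `]-oo, - (2 * T)[%R])).
    apply: measurableU; [exact: (mprec mgood _ (measurable_itv _))|].
    exact: (mprec mgood _ (measurable_itv _)).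
  apply/seteqP; split => x.
    move=> [gx /=]; rewrite ltr_normr => /orP[big|big]; [left|right]; split=> //=.
      by rewrite in_itv/= big.
    by rewrite in_itv/= ltrNr.
  case=> -[gx /=]; rewrite in_itv/= ?andbT => h; split=> //=; rewrite ltr_normr.
    by rewrite h.
  by rewrite [X in _ || X]ltrNr h orbT.
apply: le_trans (measureU2 _ (mB _) (mB _)) _.
by rewrite mulrDr EFinD leeD// weak.
Qed.

End mazya.

Section truncated_bound.
Context {R : realType} {X : pointedMetricType R}.
Variables (mu nu : complete_borel_measure X) (E : set X).
Variables (p q alpha lambda r0 C delta : R).
Local Notation Tm := (g_sigma_algebraType (cb_sets mu)).
Local Notation Tn := (g_sigma_algebraType (cb_sets nu)).
Hypothesis H : doubling_pair mu nu E p q alpha lambda r0 C delta.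
Variable S : net nu E (scale lambda r0).
Hypothesis mE : measurable (E : set Tn).
Local Notation good := (good mu p alpha S).
Local Notation precise := (precise mu S).
Local Notation datum := (datum mu nu E p alpha lambda r0).
Local Notation truncation_bound := (truncation_bound mu E p alpha lambda r0).
Local Notation strip_energy := (strip_energy mu p).
Variables (K eps : R) (bK : balanced mu nu E p q alpha r0 K eps).

Lemma dyadic_cover (A y : R) : (0 < A)%R -> (2 * A < y)%R ->
  exists k, (2 * (A * 2 ^+ k) < y <= 4 * (A * 2 ^+ k))%R.
Proof.
move=> A0 Ay; have y0 : (0 < y)%R by apply: lt_trans Ay; rewrite mulr_gt0.
have ex : exists k, (y <= 4 * (A * 2 ^+ k))%R.
  have [n _ hn] := near_infty_natSinv_expn_lt (PosNum (divr_gt0 A0 y0)).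
  exists n; have := hn n (leqnn n); rewrite /= ltr_pdivrMr ?exprn_gt0// mulrAC ltr_pdivlMr// mul1r.
  move=> h; have : (0 < A * 2 ^+ n)%R by rewrite mulr_gt0// exprn_gt0.
  lra.
case: (ex_minnP ex) => k yk kmin; exists k; rewrite yk andbT.
case: k yk kmin => [|k] yk kmin; first by rewrite expr0 mulr1.
rewrite ltNge; apply/negP => h; have : (k.+1 <= k)%N.
  by apply: kmin; apply: (le_trans h); rewrite exprS le_eqVlt; apply/orP; left; apply/eqP; lra.
by rewrite ltnn.
Qed.

Lemma dyadic_disjoint (A z : R) i j : (0 < A)%R ->
  (A * 2 ^+ i < z < 2 * (A * 2 ^+ i))%R -> (A * 2 ^+ j < z < 2 * (A * 2 ^+ j))%R -> i = j.
Proof.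
move=> A0 /andP[i1 i2] /andP[j1 j2].
have lt_le m n : (A * 2 ^+ m < 2 * (A * 2 ^+ n))%R -> (m <= n)%N.
  move=> h; rewrite leqNgt; apply/negP => nm; move: h; rewrite ltNge => /negP; apply.
  have -> : (2 * (A * 2 ^+ n) = A * 2 ^+ n.+1)%R by rewrite exprS; lra.
  by rewrite ler_wpM2l ?(ltW A0)// ler_weXn2l// ler1n.
by apply/eqP; rewrite eqn_leq !lt_le//; [exact: lt_trans j1 i2|exact: lt_trans i1 j2].
Qed.

(** Over the dyadic levels the factor [T ^ q] of a layer cancels the [T ^ (- q)] of [level_set_le].
    What remains are [q / p]-th powers of energies of disjoint strips, which [powR_sum_le] bounds by
    the same power of the total energy. *)
Lemma precise_norm_le t Ct : (0 < Ct)%R -> exists2 c : R, (0 < c)%R & forall M u g,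
  (0 < M)%R -> datum t M u g -> truncation_bound Ct u g ->
  \int[nu]_(x in (good g : set Tn)) (`|precise u x| `^ q)%:E <= (c * M `^ q)%:E.
Proof.
move=> Ct0; have q0 := q_gt0 H; have p0 := p_gt0 H.
have [a a0 [W W0 HW]] := level_set_le H S mE bK t Ct0.
set V := fine (nu (dom S)).
have VE : nu (dom S) = V%:E by rewrite fineK// ge0_fin_numE// (nu_dom_fin H).
have V0 : (0 <= V)%R by exact: fine_ge0.
exists ((4 * a) `^ q * V + W * 4 `^ q * 2)%R.
  by rewrite ltr_wpDl ?mulr_ge0 ?powR_ge0// !mulr_gt0// powR_gt0.
move=> M u g M0 Dt Tb; have [P gM iu _] := Dt; have mu_ := L1loc_measurable iu.
have mgood := measurable_good mu p alpha S g.
have mprec : measurable_fun (good g : set Tn) (precise u : Tn -> R).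
  by apply: measurable_precise H _ _ _ _ P.
(* The smallest level that [level_set_le] admits; values up to [2 * A] are integrated over the
   finite measure of [dom S]. *)
set A := (2 * (a * M))%R; have A0 : (0 < A)%R by rewrite mulr_gt0// mulr_gt0.
pose T k : R := (A * 2 ^+ k)%R.
have T0 k : (0 < T k)%R by rewrite mulr_gt0// exprn_gt0.
have AT k : (A <= T k)%R by rewrite -[leLHS]mulr1 ler_wpM2l ?(ltW A0)// exprn_ege1// ler1n.
pose B k := good g `&` [set x | (2 * T k < `|precise u x|)%R].
have mB k : measurable (B k : set Tn).
  rewrite (_ : B k = good g `&` (fun x => `|precise u x|%R) @^-1` [set` `]2 * T k, +oo[%R]).
    have mn : measurable_fun (good g : set Tn) ((fun x => `|precise u x|%R) : Tn -> R).
      exact: measurableT_comp.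
    exact: (mn mgood _ (measurable_itv _)).
  by apply/seteqP; split => x [gx]/=; rewrite in_itv/= andbT.
(* A value above [2 * A] lies between [2 * T k] and [4 * T k] for some [k], by [dyadic_cover], so
   that the single term [b k] dominates its power. *)
pose b k x : R := ((4 * T k) `^ q * \1_(B k) x)%R.
have b0 k x : (0 <= b k x)%R by rewrite mulr_ge0 ?powR_ge0.
have mb k : measurable_fun (good g : set Tn) (b k : Tn -> R).
  by apply: measurable_funM => //; exact: measurable_indic.
have mbs := measurable_nneseries 0 mb b0.
have pt x : good g x ->
    (`|precise u x| `^ q)%:E <= ((2 * A) `^ q)%:E + \sum_(0 <= k <oo) (b k x)%:E.
  move=> gx; have bs0 : 0 <= \sum_(0 <= k <oo) (b k x)%:E.
    by apply: nneseries_ge0 => k _ _; rewrite lee_fin.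
  have [small|big] := leP `|precise u x|%R (2 * A)%R.
    apply: (@le_trans _ _ ((2 * A) `^ q)%:E); last by rewrite leeDl.
    by rewrite lee_fin; apply: powR_le => //; exact: ltW.
  have [k /andP[k1 k2]] := dyadic_cover A0 big.
  apply: (@le_trans _ _ (b k x)%:E).
    rewrite lee_fin /b indicE mem_set ?mulr1; last by split.
    by apply: powR_le => //; exact: ltW.
  apply: (@le_trans _ _ (\sum_(0 <= k <oo) (b k x)%:E)).
    by apply: (@le_nneseries_term _ (fun k => (b k x)%:E)) => // j; rewrite lee_fin.
  by rewrite leeDr// lee_fin powR_ge0.
apply: (@le_trans _ _ (\int[nu]_(x in (good g : set Tn))
    (((2 * A) `^ q)%:E + \sum_(0 <= k <oo) (b k x)%:E))).
  apply: ge0_le_integral => //.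
  - by apply: (measurable_powR_norm q mprec).
  - exact: emeasurable_funD.
rewrite ge0_integralD//; last 2 first.
- by move=> x _; rewrite lee_fin powR_ge0.
- by move=> x _; apply: nneseries_ge0 => k _ _; rewrite lee_fin.
have -> : (((4 * a) `^ q * V + W * 4 `^ q * 2) * M `^ q)%:E =
    ((4 * a) `^ q * V * M `^ q)%:E + (W * 4 `^ q * 2 * M `^ q)%:E.
  by rewrite -EFinD mulrDl.
apply: leeD.
  rewrite (@integral_cst _ Tn R nu _ mgood ((2 * A) `^ q)%:E).
  apply: (@le_trans _ _ (((2 * A) `^ q)%:E * V%:E)).
    rewrite lee_wpmul2l ?lee_fin ?powR_ge0// -VE; apply: le_measure; rewrite ?inE//.
      exact: dom_meas.
    by move=> x [].
  rewrite -EFinM lee_fin (_ : 2 * A = 4 * a * M)%R; last by rewrite /A; lra.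
  by rewrite powRM ?mulr_ge0 ?(ltW a0) ?(ltW M0)// mulrAC.
rewrite integral_nneseries//; last 2 first.
- by move=> k; exact/measurable_EFinP.
- by move=> k x _; rewrite lee_fin.
have Bint k : \int[nu]_(x in (good g : set Tn)) (b k x)%:E <=
    (W * 4 `^ q * (strip_energy u g (T k) (2 * T k) `^ (q / p) +
     strip_energy u g (- (2 * T k)) (- T k) `^ (q / p)))%:E.
  rewrite /b; under eq_integral do rewrite EFinM.
  rewrite ge0_integralZl_EFin ?powR_ge0//; last first.
    by apply/measurable_EFinP; exact: measurable_indic.
  rewrite integral_indic// setIidl; last by move=> x [].
  apply: le_trans (lee_wpmul2l _ (HW M u g (T k) M0 Dt Tb (AT k))) _.
    by rewrite lee_fin powR_ge0.
  rewrite -EFinM lee_fin powRM ?(ltW (T0 k))//.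
  set s := (_ + _)%R; have e : (T k `^ q * (T k)^-1 `^ q = 1)%R.
    by rewrite -powRM ?invr_ge0 ?(ltW (T0 k))// mulfV ?gt_eqF// powR1.
  rewrite (_ : 4 `^ q * T k `^ q * (W * (T k)^-1 `^ q * s) =
    W * 4 `^ q * s * (T k `^ q * (T k)^-1 `^ q))%R; last by lra.
  by rewrite e mulr1.
apply: nneseries_le => [k|n].
  by apply: integral_ge0 => x _; rewrite lee_fin.
apply: le_trans (lee_sum _ (fun k _ => Bint k)) _.
rewrite sumEFin lee_fin -mulr_sumr big_split/= -[leRHS]mulrA.
rewrite ler_wpM2l ?mulr_ge0 ?powR_ge0 ?(ltW W0)//.
have qp : (1 <= q / p)%R by rewrite ler_pdivlMr// mul1r ltW// (dp_pq H).
have -> : (2 * M `^ q = (M `^ p) `^ (q / p) + (M `^ p) `^ (q / p))%R.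
  by rewrite -powRrM [(p * _)%R]mulrC divfK ?gt_eqF//; lra.
apply: lerD; apply: powR_sum_le => // [k|]; first exact: strip_energy_ge0.
- apply: (@strip_energy_sum_le _ _ _ _ _ _ _ _ _ _ _ _ H u g _ T (fun k => 2 * T k)%R n mu_ gM) => i j z zi zj.
  exact: dyadic_disjoint A0 zi zj.
- exact: strip_energy_ge0.
- apply: (@strip_energy_sum_le _ _ _ _ _ _ _ _ _ _ _ _ H u g _ (fun k => - (2 * T k))%R
    (fun k => - T k)%R n mu_ gM).
  move=> i j z /andP[i1 i2] /andP[j1 j2].
  by apply: (@dyadic_disjoint A (- u z)%R) A0 _ _; apply/andP; split; rewrite -/(T _); lra.
Qed.

Lemma datum_bounded t Ct : (0 < Ct)%R -> exists2 c : R, (0 < c)%R & forall M u g,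
  (0 < M)%R -> datum t M u g -> truncation_bound Ct u g ->
  in_Lp nu E q (ubar mu u) /\ norm_Lp nu E q (ubar mu u) <= (c * M)%:E.
Proof.
move=> Ct0; have q0 := q_gt0 H; have [c c0 Hc] := precise_norm_le t Ct0.
exists (c `^ q^-1)%R; first by rewrite powR_gt0.
move=> M u g M0 Dt Tb; have [P gM _ _] := Dt.
have mg := measurable_good mu p alpha S g.
have gS : good g `<=` dom S by move=> x [].
have mprec : measurable_fun (good g : set Tn) (precise u : Tn -> R).
  by apply: measurable_precise H _ _ _ _ P.
have ug x : good g x -> ubar mu u x = (precise u x)%:E by exact: (ubar_precise H P).
have [mf nE] := norm_Lp_full H mE mg gS (dom_good H S bK gM) mprec ug.
have ub : norm_Lp nu E q (ubar mu u) <= (c `^ q^-1 * M)%:E.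
  rewrite nE -[in leRHS](@powRK _ M q) ?gt_eqF ?(ltW M0)//.
  rewrite -powRM ?powR_ge0 ?(ltW c0)// -poweR_EFin.
  apply: poweR_le; [by rewrite invr_ge0 ltW| |exact: Hc].
  by apply: integral_ge0 => x _; rewrite lee_fin powR_ge0.
by split=> //; split=> //; apply: le_lt_trans ub _; rewrite ltry.
Qed.

End truncated_bound.

(** * Exponent conditions and embeddings *)

Section conclusion.
Context {R : realType} {X : pointedMetricType R}.
Variables (mu nu : complete_borel_measure X) (E : set X).
Variables (p q alpha lambda r0 C delta : R).
Local Notation Tm := (g_sigma_algebraType (cb_sets mu)).
Local Notation Tn := (g_sigma_algebraType (cb_sets nu)).
Hypothesis H : doubling_pair mu nu E p q alpha lambda r0 C delta.
Variables (C' s : R).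
Hypothesis C'_gt0 : (0 < C')%R.
Hypothesis mu_lower : forall (x : X) (r : R), E x -> (0 < r <= r0)%R ->
  (C' * r `^ s)%:E <= mu (ball x r).

Let fine_mu_lower x r : E x -> (0 < r <= r0)%R ->
  (C' * r `^ s <= fine (mu (ball x r)))%R.
Proof.
move=> Ex rr; have [m0 moo] := mu_bounds H Ex rr.
by rewrite -lee_fin fineK ?ge0_fin_numE//; exact: mu_lower.
Qed.

(** The upper bound on [nu] contributes [r ^ (sigma / q)], the lower bound on [mu] contributes
    [r ^ (s / p)], and the exponent is what remains. *)
Lemma balanced_upper C'' sigma : (0 < C'')%R ->
  upper_mass_bound nu E r0 C'' sigma ->
  (0 <= alpha + sigma / q - s / p)%R ->
  balanced mu nu E p q alpha r0 (C'' `^ q^-1 / C' `^ p^-1) (alpha + sigma / q - s / p).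
Proof.
move=> C''0 upper eps0; have p0 := p_gt0 H; have q0 := q_gt0 H.
have Cp : (0 < C' `^ p^-1)%R by rewrite powR_gt0.
split; first by rewrite divr_gt0// powR_gt0.
split=> // x r Ex rr; have [n0 noo] := nu_bounds H Ex rr.
have r_gt0 : (0 < r)%R by case/andP: rr.
have nr : (fine (nu (ball x r)) <= C'' * r `^ sigma)%R.
  by rewrite -lee_fin fineK ?ge0_fin_numE//; exact: upper.
apply: (@le_trans _ _ (r `^ alpha * (C'' * r `^ sigma) `^ q^-1)%R).
  rewrite ler_wpM2l ?powR_ge0//.
  by apply: powR_le; [rewrite invr_ge0 ltW|exact: fine_ge0|exact: nr].
apply: (@le_trans _ _ (C'' `^ q^-1 / C' `^ p^-1 * r `^ (alpha + sigma / q - s / p) *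
    (C' * r `^ s) `^ p^-1)%R); last first.
  rewrite ler_wpM2l ?mulr_ge0 ?powR_ge0 ?invr_ge0 ?powR_ge0//.
  apply: powR_le; [by rewrite invr_ge0 ltW|by rewrite mulr_ge0 ?powR_ge0// ltW|].
  exact: fine_mu_lower.
rewrite (powRM _ (ltW C''0) (powR_ge0 _ _)) (powRM _ (ltW C'_gt0) (powR_ge0 _ _)) -!powRrM.
have rD (b c : R) : (r `^ (b + c) = r `^ b * r `^ c)%R.
  by rewrite powRD// (gt_eqF r_gt0) implybT.
have e : (r `^ (alpha + sigma / q - s / p) * r `^ (s / p) =
    r `^ alpha * r `^ (sigma / q))%R by rewrite -!rD subrK.
rewrite (_ : C'' `^ q^-1 / C' `^ p^-1 * r `^ (alpha + sigma / q - s / p) *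
    (C' `^ p^-1 * r `^ (s / p)) = C'' `^ q^-1 * (C' `^ p^-1 / C' `^ p^-1) *
    (r `^ (alpha + sigma / q - s / p) * r `^ (s / p)))%R; last first.
  by move: (C' `^ p^-1)^-1%R => z; lra.
rewrite e divff ?gt_eqF// mulr1 le_eqVlt; apply/orP; left; apply/eqP; lra.
Qed.

(** With [nu = mu] the factor [mu(B) ^ (1/q)] appears on both sides. The spare power [1/p - 1/q] of
    [mu(B)] is positive and is bounded below by [mu_lower]. *)
Lemma balanced_same : nu = mu -> (0 <= alpha - s * (p^-1 - q^-1))%R ->
  balanced mu nu E p q alpha r0 (C' `^ (p^-1 - q^-1))^-1 (alpha - s * (p^-1 - q^-1)).
Proof.
move=> numu eps0; have p0 := p_gt0 H; have q0 := q_gt0 H.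
have ab : (0 <= p^-1 - q^-1)%R.
  by rewrite subr_ge0 lef_pV2 ?posrE// ltW// (dp_pq H).
set b := (p^-1 - q^-1)%R in ab eps0 *.
have Cb : (0 < C' `^ b)%R by rewrite powR_gt0.
split; first by rewrite invr_gt0.
split=> // x r Ex rr; have [m0 moo] := mu_bounds H Ex rr.
have r_gt0 : (0 < r)%R by case/andP: rr.
have fm0 : (0 < fine (mu (ball x r)))%R by rewrite fine_gt0// m0.
rewrite numu; have lo := fine_mu_lower Ex rr.
set m := fine _ in fm0 lo *.
have -> : (m `^ p^-1 = m `^ q^-1 * m `^ b)%R.
  by rewrite -powRD ?(gt_eqF fm0) ?implybT// /b addrC subrK.
have rD (c d : R) : (r `^ (c + d) = r `^ c * r `^ d)%R.
  by rewrite powRD// (gt_eqF r_gt0) implybT.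
have mb : (C' `^ b * r `^ (s * b) <= m `^ b)%R.
  rewrite powRrM -powRM ?powR_ge0 ?(ltW C'_gt0)//.
  by apply: powR_le => //; rewrite mulr_ge0 ?powR_ge0// ltW.
have -> : (r `^ alpha = (C' `^ b)^-1 * r `^ (alpha - s * b) * (C' `^ b * r `^ (s * b)))%R.
  rewrite (_ : (C' `^ b)^-1 * r `^ (alpha - s * b) * (C' `^ b * r `^ (s * b)) =
    (C' `^ b)^-1 * C' `^ b * (r `^ (alpha - s * b) * r `^ (s * b)))%R; last first.
    by move: (C' `^ b)^-1%R => z; lra.
  by rewrite mulVf ?gt_eqF// mul1r -rD subrK.
rewrite -!mulrA ler_wpM2l ?invr_ge0 ?powR_ge0// ler_wpM2l ?powR_ge0//.
by rewrite mulrA mulrC ler_wpM2l ?powR_ge0.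
Qed.

Hypothesis E_meas : measurable (E : set Tn).
Hypothesis E_pos : 0 < nu E.
Hypothesis E_tb : totally_bounded E.
Variables (Y : set (X -> R)) (G : (X -> R) -> (X -> R)) (t : L1_term).
Hypothesis Y_sub : Y `<=` P_space mu E alpha p lambda r0.
Hypothesis G_grad : forall u, Y u -> poincare_gradient mu E alpha p lambda r0 u (G u).
Hypothesis Y_norm_fin : forall u, Y u -> Y_norm t mu nu E p G u < +oo.
Variables (K eps : R) (bK : balanced mu nu E p q alpha r0 K eps).
Local Notation datum := (datum mu nu E p alpha lambda r0).

Let datum_Y M u : (0 <= M)%R -> Y u -> Y_norm t mu nu E p G u <= M%:E ->
  datum t M u (G u).
Proof.
move=> M0 Yu NM; apply: (datum_of_norm H) => //; last exact: G_grad.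
by have [] := Y_sub Yu.
Qed.

Let Y_normE u : Y u -> exists2 N : R, (0 <= N)%R & Y_norm t mu nu E p G u = N%:E.
Proof.
move=> Yu; have N0 : 0 <= Y_norm t mu nu E p G u.
  by rewrite /Y_norm adde_ge0//; [case: t|]; exact: Lnorm_ge0.
exists (fine (Y_norm t mu nu E p G u)); first exact: fine_ge0.
by rewrite fineK// ge0_fin_numE// Y_norm_fin.
Qed.

Let net_E : inhabited (net nu E (scale lambda r0)).
Proof.
apply: net_exists => // [|k]; last exact: (scale_gt0 H).
by apply/set0P/eqP => E0; move: E_pos; rewrite E0 measure0 ltxx.
Qed.

Lemma balanced_compact : (0 < eps)%R ->
  compact_embedding mu nu E q Y (Y_norm t mu nu E p G).
Proof.
move=> eps0; have [S] := net_E; split.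
  move=> u Yu; have [N N0 NE] := Y_normE Yu.
  have Dt : datum t N u (G u) by apply: datum_Y => //; rewrite NE.
  exact: (datum_in_Lp H S E_meas bK eps0 N0 Dt).
(* The bound [M] may be zero or negative, while the data need a positive one. *)
move=> u_ Yu [M NM]; have M0 : (0 < `|M| + 1)%R by rewrite ltr_wpDl.
have Dt n : datum t (`|M| + 1)%R (u_ n) (G (u_ n)).
  apply: datum_Y => //; apply: (le_trans (NM n)); rewrite lee_fin; apply: (le_trans (ler_norm M)).
  by rewrite lerDl.
exact: (datum_compact H S E_meas bK eps0 M0 Dt).
Qed.

Lemma balanced_bounded : truncation_property mu E alpha p lambda r0 Y G ->
  bounded_embedding mu nu E q Y (Y_norm t mu nu E p G).
Proof.
move=> [Ct Ct0 Tb]; have [S] := net_E.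
have [c c0 Hc] := datum_bounded H S E_meas bK t Ct0.
have bnd u M : (0 < M)%R -> Y u -> Y_norm t mu nu E p G u <= M%:E ->
    in_Lp nu E q (ubar mu u) /\ norm_Lp nu E q (ubar mu u) <= (c * M)%:E.
  move=> M0 Yu NM; apply: (Hc M u (G u)) => //; first exact: datum_Y (ltW M0) Yu NM.
  by move=> l k lk x r Ex rr; exact: Tb.
split.
  move=> u Yu; have [N N0 NE] := Y_normE Yu.
  have N1 : (0 < N + 1)%R by rewrite ltr_wpDl.
  by have [] := bnd u _ N1 Yu _; rewrite ?NE ?lee_fin ?lerDl.
exists c => // u Yu; have [N N0 NE] := Y_normE Yu; rewrite NE.
(* The norm [N] may vanish, but [datum_bounded] requires a positive bound: it is applied to
   [N + e / c]. *)
apply/lee_addgt0Pr => e e0.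
have Ne : (0 < N + e / c)%R by rewrite ltr_wpDl// divr_gt0.
have [|_] := bnd u _ Ne Yu.
  by rewrite NE lee_fin lerDl divr_ge0// ltW.
by rewrite mulrDr [(c * (e / c))%R]mulrC divfK ?gt_eqF// EFinD EFinM.
Qed.

End conclusion.

Theorem corollary5p2 (R : realType) (X : pointedMetricType R)
    (mu nu : complete_borel_measure X) (E : set X)
    (p q alpha r0 lambda C C' delta s : R)
    (Y : set (X -> R)) (G : (X -> R) -> (X -> R)) (t : L1_term)
    (E_meas : measurable (E : set (g_sigma_algebraType (cb_sets nu))))
    (E_pos : 0 < nu E)
    (hpq : (1 <= p < q)%R) (alpha_gt0 : (0 < alpha)%R) (r0_gt0 : (0 < r0)%R)
    (lambda_ge1 : (1 <= lambda)%R)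
    (E_tb : totally_bounded E)
    (C_gt0 : (0 < C)%R) (C'_gt0 : (0 < C')%R) (delta_gt0 : (0 < delta)%R)
    (s_gt0 : (0 < s)%R)
    (mu_doubling : forall (x : X) (r : R), E x -> (0 < r <= r0)%R ->
      [/\ 0 < mu (ball x (2 * r)%R),
          mu (ball x (2 * r)%R) <= C%:E * mu (ball x r) &
          C%:E * mu (ball x r) < +oo])
    (nu_doubling : forall (x : X) (r : R), E x -> (0 < r <= r0)%R ->
      [/\ 0 < nu (ball x (2 * r)%R),
          nu (ball x (2 * r)%R) <= C%:E * nu (ball x r) &
          C%:E * nu (ball x r) < +oo])
    (nu_ratio : forall (x : X) (r' r : R), E x -> (0 < r')%R -> (r' < r <= r0)%R ->
      nu (ball x r') / nu (ball x r) <= (C * (r' / r) `^ delta)%:E)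
    (mu_lower : forall (x : X) (r : R), E x -> (0 < r <= r0)%R ->
      (C' * r `^ s)%:E <= mu (ball x r))
    (Y_sub : Y `<=` P_space mu E alpha p lambda r0)
    (G_grad : forall u, Y u -> poincare_gradient mu E alpha p lambda r0 u (G u))
    (Y_norm_fin : forall u, Y u -> Y_norm t mu nu E p G u < +oo) :
  ((forall C'' sigma : R, (0 < C'')%R -> (0 < sigma)%R ->
      (s - alpha * p < sigma)%R -> upper_mass_bound nu E r0 C'' sigma ->
      (q * (s - alpha * p) < sigma * p)%R ->
      compact_embedding mu nu E q Y (Y_norm t mu nu E p G)) /\
   (nu = mu ->
      (q * (s - alpha * p) < s * p)%R ->
      compact_embedding mu nu E q Y (Y_norm t mu nu E p G))) /\
  (truncation_property mu E alpha p lambda r0 Y G ->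
   (forall C'' sigma : R, (0 < C'')%R -> (0 < sigma)%R ->
      (s - alpha * p < sigma)%R -> upper_mass_bound nu E r0 C'' sigma ->
      (q * (s - alpha * p) <= sigma * p)%R ->
      bounded_embedding mu nu E q Y (Y_norm t mu nu E p G)) /\
   (nu = mu ->
      (q * (s - alpha * p) <= s * p)%R ->
      bounded_embedding mu nu E q Y (Y_norm t mu nu E p G))).
Proof.
have /andP[p1 pq] := hpq; have p0 : (0 < p)%R by rewrite (lt_le_trans ltr01).
have q0 : (0 < q)%R by rewrite (lt_trans p0).
have H : doubling_pair mu nu E p q alpha lambda r0 C delta by split.
(* The two values of [eps] are the gaps in the hypotheses on [q], divided by [p * q]: strict
   inequality means [eps > 0], equality means [eps = 0]. *)
have upper_exp sigma :
    (alpha + sigma / q - s / p = (sigma * p - q * (s - alpha * p)) / (p * q))%R.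
  have pV : (p^-1 * p = 1)%R by rewrite mulVf// gt_eqF.
  have qV : (q^-1 * q = 1)%R by rewrite mulVf// gt_eqF.
  rewrite invfM; move: p^-1%R q^-1%R pV qV => u v pV qV.
  rewrite (_ : (sigma * p - q * (s - alpha * p)) * (u * v) =
    alpha * (u * p) * (v * q) + sigma * v * (u * p) - s * u * (v * q))%R; last by lra.
  by rewrite pV qV; lra.
have same_exp :
    (alpha - s * (p^-1 - q^-1) = (s * p - q * (s - alpha * p)) / (p * q))%R.
  have pV : (p^-1 * p = 1)%R by rewrite mulVf// gt_eqF.
  have qV : (q^-1 * q = 1)%R by rewrite mulVf// gt_eqF.
  rewrite invfM; move: p^-1%R q^-1%R pV qV => u v pV qV.
  rewrite (_ : (s * p - q * (s - alpha * p)) * (u * v) =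
    alpha * (u * p) * (v * q) + s * v * (u * p) - s * u * (v * q))%R; last by lra.
  by rewrite pV qV; lra.
split; [split|].
- move=> C'' sigma C''0 _ _ upper crit.
  have e0 : (0 < alpha + sigma / q - s / p)%R.
    by rewrite upper_exp divr_gt0 ?subr_gt0// mulr_gt0.
  apply: (balanced_compact H E_meas E_pos E_tb Y_sub G_grad Y_norm_fin _ e0).
  exact: (balanced_upper H C'_gt0 mu_lower C''0 upper (ltW e0)).
- move=> numu crit.
  have e0 : (0 < alpha - s * (p^-1 - q^-1))%R.
    by rewrite same_exp divr_gt0 ?subr_gt0// mulr_gt0.
  apply: (balanced_compact H E_meas E_pos E_tb Y_sub G_grad Y_norm_fin _ e0).
  exact: (balanced_same H C'_gt0 mu_lower numu (ltW e0)).
- move=> Tb; split.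
  + move=> C'' sigma C''0 _ _ upper crit.
    have e0 : (0 <= alpha + sigma / q - s / p)%R.
      by rewrite upper_exp divr_ge0 ?subr_ge0// mulr_ge0// ltW.
    apply: (balanced_bounded H E_meas E_pos E_tb Y_sub G_grad Y_norm_fin _ Tb).
    exact: (balanced_upper H C'_gt0 mu_lower C''0 upper e0).
  + move=> numu crit.
    have e0 : (0 <= alpha - s * (p^-1 - q^-1))%R.
      by rewrite same_exp divr_ge0 ?subr_ge0// mulr_ge0// ltW.
    apply: (balanced_bounded H E_meas E_pos E_tb Y_sub G_grad Y_norm_fin _ Tb).
    exact: (balanced_same H C'_gt0 mu_lower numu e0).
Qed.
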